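(* Let $M$ be a manifold of dimension $n=\dim M\ge 3$. Let $g(t)$, $t\in[0,T)$, be an asymptotically hyperbolic solution on $M$ of $$\frac{\partial g_{ij}}{\partial t}=-2\left(R_{ij}+(n-1)g_{ij}\right)$$ developing from an asymptotically hyperbolic metric $g(0)=g_0$ of mass $m_0$, and let $m(t)$ be the mass of $g(t)$. Then there exist times $0\le t_1<t_2<T$ such that $m(t_1)=m(t_2)$ if and only if $m(t)=m_0=0$ for all $t\in[0,T)$.
   Context: Conformally compactifiable: a complete Riemannian manifold $(M,g)$ of dimension $n$ is (smoothly) conformally compactifiable if there are a manifold-with-boundary $\tilde M$, a function $\rho\in C^\infty(\tilde M)$ (the defining function) with $\rho(p)=0\Leftrightarrow p\in\partial\tilde M$ and $d\rho|_p\ne 0$ for $p\in\partial\tilde M$, and a smooth diffeomorphism $\psi$ from the interior of $\tilde M$ onto $M$ such that $\rho^2\psi^*g=\tilde g$ is a smooth metric on $\tilde M$ (up to the boundary). The boundary-at-infinity is $\partial_\infty M:=\partial\tilde M$, taken compact. Asymptotically hyperbolic: $(M,g)$ is asymptotically hyperbolic if it is conformally compactifiable, the metric induced by $\tilde g$ on $\partial_\infty M$ has constant sectional curvature $k\in\{0,1\}$, and $\tilde g^{ij}\partial_i\rho\,\partial_j\rho=1+O(\rho)$. Mass: let $g_{(k)}$ be a metric on $\partial_\infty M$ of constant sectional curvature $k$, with ${\rm Ric}[g_{(k)}]=(n-2)k\,g_{(k)}$, and let $\rho_{(1)}(x)=\sinh x$, $\rho_{(0)}(x)=x$. Suppose that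 on a collar neighbourhood of $\partial_\infty M=\{x=0\}$ with coordinates $(x,y^A)$ (the $y^A$ being coordinates on $\partial_\infty M$) one can write $$g=\frac{1}{\rho_{(k)}^2(x)}\left[dx^2+g_{(k)}+\frac{x^n}{n}\kappa+O(x^{n+1})\right],\qquad (\ast)$$ where $\kappa=\kappa_{AB}(y)\,dy^A dy^B$ and $O(x^{n+1})$ is a symmetric tensor in the $dy^A$ whose components are bounded in magnitude by $Cx^{n+1}$ as $x\to0$. The mass of $g$ is $$m=m[g]:=\int_{\partial_\infty M}g_{(k)}^{AB}\kappa_{AB}\,d\mu_{(k)},$$ with $d\mu_{(k)}$ the volume element of $g_{(k)}$. If instead $g=\rho_{(k)}^{-2}(x)\left[dx^2+g_{(k)}+\frac{x^n}{n}\kappa_{ij}dx^idx^j+O(x^{n+1})\right]$ with possibly nonzero components $\kappa_{11},\kappa_{1A}$ (index $1$ denoting the $x$-direction, $\kappa_{ij}=\kappa_{ij}(y)$), then the mass is that of the metric after it is brought to the form $(\ast)$ by a coordinate change $x\mapsto x(1+O(x^n))$, $y^A\mapsto y^A+O(x^{n+1})$. Solutions of the flow: the initial metric $g_0$ is of the form $(\ast)$, so its mass $m_0$ is defined. The solution $g(t)$ has, in the same fixed collar coordinates, the form $$g(t)=\frac{1}{\rho_{(k)}^2(x)}\left[dx^2+g_{(k)}+\frac{x^q}{q}\kappa_{ij}(t,y)\,dx^idx^j+O(x^{q+1})\right]$$ for some integer $1\le q\le n$, with $k$ and $g_{(k)}$ independent of $t$, where $\rho_{(k)}^2g(t)$ is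 smooth up to $x=0$ and smooth in $t$, so that these expansions may be differentiated in $x$, $y^A$ and $t$. Here $O(x^{q+1})$ may have components in all directions. *)

(* Defs.v *)
From HB Require Import structures.
From mathcomp Require Import all_boot all_order all_algebra.
From mathcomp Require Import all_classical all_reals all_analysis.

Set Implicit Arguments.
Unset Strict Implicit.
Unset Printing Implicit Defensive.

Import Order.TTheory GRing.Theory Num.Theory.
Import numFieldNormedType.Exports.

Local Open Scope classical_set_scope.
Local Open Scope ring_scope.

Definition pd (R : realType) (n : nat) (i : 'I_n) (f : 'rV[R]_n -> R)
    (v : 'rV[R]_n) : R :=
  'D_(delta_mx 0 i) f v.

Definition iter_pd (R : realType) (n : nat) (s : seq 'I_n)
    (f : 'rV[R]_n -> R) : 'rV[R]_n -> R :=
  foldr (@pd R n) f s.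

Definition open_smooth (R : realType) (n : nat) (U : set 'rV[R]_n)
    (f : 'rV[R]_n -> R) : Prop :=
  forall (s : seq 'I_n) (v : 'rV[R]_n), U v ->
    (forall i, derivable (iter_pd s f) v (delta_mx 0 i)) /\
    {for v, continuous (iter_pd s f)}.

Definition extends_near (R : realType) (n : nat) (A : set 'rV[R]_n)
    (f : 'rV[R]_n -> R) (U : set 'rV[R]_n) (F : 'rV[R]_n -> R) : Prop :=
  [/\ open U, open_smooth U F & forall w, U w -> A w -> F w = f w].

(* Smoothness on a set that need not be open (half-spaces, [0,T) x ...):
   existence of local smooth extensions. *)
Definition smooth_on (R : realType) (n : nat) (A : set 'rV[R]_n)
    (f : 'rV[R]_n -> R) : Prop :=
  forall v, A v -> exists U F, U v /\ extends_near A f U F.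

Definition inner (R : realType) (n : nat) (G : 'M[R]_n) (a b : 'rV[R]_n) : R :=
  (a *m G *m b^T) 0 0.

Definition christoffel (R : realType) (n : nat) (G : 'rV[R]_n -> 'M[R]_n)
    (k i j : 'I_n) (v : 'rV[R]_n) : R :=
  2^-1 * \sum_(l < n) invmx (G v) k l *
    (pd i (fun w => G w j l) v + pd j (fun w => G w i l) v
     - pd l (fun w => G w i j) v).

(* R^l_{kij} = dx^l (R(d_i, d_j) d_k),
   with R(X, Y) = [nabla_X, nabla_Y] - nabla_[X, Y] *)
Definition riemann (R : realType) (n : nat) (G : 'rV[R]_n -> 'M[R]_n)
    (l k i j : 'I_n) (v : 'rV[R]_n) : R :=
  pd i (christoffel G l j k) v - pd j (christoffel G l i k) v
  + \sum_(p < n) (christoffel G l i p v * christoffel G p j k v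
                  - christoffel G l j p v * christoffel G p i k v).

Definition ricci (R : realType) (n : nat) (G : 'rV[R]_n -> 'M[R]_n)
    (v : 'rV[R]_n) : 'M[R]_n :=
  \matrix_(j, k) \sum_(i < n) riemann G i k i j v.

Definition area2 (R : realType) (n : nat) (G : 'M[R]_n) (a b : 'rV[R]_n) : R :=
  inner G a a * inner G b b - inner G a b ^+ 2.

(* < R(a, b) b, a > / |a /\ b|^2 *)
Definition sectional (R : realType) (n : nat) (G : 'rV[R]_n -> 'M[R]_n)
    (v a b : 'rV[R]_n) : R :=
  (\sum_(i < n) \sum_(j < n) \sum_(k < n) \sum_(l < n) \sum_(m < n)
     a 0 i * b 0 j * b 0 k * a 0 m * G v m l * riemann G l k i j v)
  / area2 (G v) a b.

Definition constant_sectional (R : realType) (n : nat)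
    (G : 'rV[R]_n -> 'M[R]_n) (v : 'rV[R]_n) (K : R) : Prop :=
  forall a b, area2 (G v) a b != 0 -> sectional G v a b = K.

(* Charts are partial maps represented by total functions; only the values of
   cmap on cdom and of cinv on cimg are meaningful. *)
Record chart (R : realType) (n : nat) (X : Type) := Chart {
  cdom : set X;
  cmap : X -> 'rV[R]_n;
  cinv : 'rV[R]_n -> X
}.

Definition cimg (R : realType) (n : nat) (X : Type) (c : chart R n X) :
    set 'rV[R]_n :=
  cmap c @` cdom c.

Definition is_chart (R : realType) (n : nat) (H : set 'rV[R]_n)
    (X : topologicalType) (c : chart R n X) : Prop :=
  [/\ open (cdom c),
      exists2 O, open O & cimg c = O `&` H,
      forall p, cdom c p -> cinv c (cmap c p) = p,
      forall p, cdom c p -> {for p, continuous (cmap c)} &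
      {within cimg c, continuous (cinv c)}].

Definition transition (R : realType) (n : nat) (X : Type)
    (c1 c2 : chart R n X) (v : 'rV[R]_n) : 'rV[R]_n :=
  cmap c2 (cinv c1 v).

Definition compatible (R : realType) (n : nat) (X : Type)
    (c1 c2 : chart R n X) : Prop :=
  forall i, smooth_on (cmap c1 @` (cdom c1 `&` cdom c2))
                      (fun v => transition c1 c2 v 0 i).

(* chart_at carries no structure: it selects a chart of the atlas at each point. *)
Record manifold (R : realType) (n : nat) (H : set 'rV[R]_n) := Manifold {
  mspace :> ptopologicalType;
  atlas : set (chart R n mspace);
  atlas_is_chart : forall c, atlas c -> is_chart H c;
  atlas_compatible :
    forall c1 c2, atlas c1 -> atlas c2 -> compatible c1 c2;
  atlas_maximal : forall c, is_chart H c ->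
    (forall c', atlas c' -> compatible c c' /\ compatible c' c) -> atlas c;
  chart_at : mspace -> chart R n mspace;
  chart_atP : forall p, atlas (chart_at p) /\ cdom (chart_at p) p;
  mspace_hausdorff : hausdorff_space mspace;
  mspace_second_countable : @second_countable mspace
}.

Definition minterior (R : realType) (n : nat) (H : set 'rV[R]_n)
    (X : manifold H) : set X :=
  [set p | exists c, [/\ atlas c, cdom c p & H° (cmap c p)]].

Definition mboundary (R : realType) (n : nat) (H : set 'rV[R]_n)
    (X : manifold H) : set X :=
  ~` @minterior R n H X.

Definition smooth_fun (R : realType) (n : nat) (H : set 'rV[R]_n)
    (X : manifold H) (f : X -> R) : Prop :=
  forall c : chart R n X, atlas c ->
    smooth_on (cimg c) (fun v => f (cinv c v)).

Definition smooth_map (R : realType) (n1 n2 : nat)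
    (H1 : set 'rV[R]_n1) (H2 : set 'rV[R]_n2)
    (X : manifold H1) (Y : manifold H2) (A : set X) (f : X -> Y) : Prop :=
  (forall p, A p -> {for p, continuous f}) /\
  forall (c1 : chart R n1 X) (c2 : chart R n2 Y), atlas c1 -> atlas c2 ->
    forall i, smooth_on (cmap c1 @` (A `&` cdom c1 `&` f @^-1` cdom c2))
                        (fun v => cmap c2 (f (cinv c1 v)) 0 i).

Definition interior_diffeo (R : realType) (n : nat)
    (H1 H2 : set 'rV[R]_n) (X : manifold H1) (Y : manifold H2)
    (psi : X -> Y) (psi' : Y -> X) : Prop :=
  [/\ forall p, minterior p -> psi' (psi p) = p,
      forall q, minterior (psi' q) /\ psi (psi' q) = q,
      smooth_map (@minterior R n H1 X) psi &
      smooth_map setT psi'].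

(* The chart c o psi^-1 of Y.  The components of psi^* g in the chart c of the
   interior of X are those of g in this chart. *)
Definition push_chart (R : realType) (n : nat)
    (H1 H2 : set 'rV[R]_n) (X : manifold H1) (Y : manifold H2)
    (psi : X -> Y) (psi' : Y -> X) (c : chart R n X) : chart R n Y :=
  Chart (psi @` (cdom c `&` @minterior R n H1 X))
        (fun q => cmap c (psi' q)) (fun v => psi (cinv c v)).

(* g c v is the matrix of components, in the chart c, at the point of
   coordinates v. *)
Definition tensor2 (R : realType) (n : nat) (H : set 'rV[R]_n)
    (X : manifold H) : Type :=
  chart R n X -> 'rV[R]_n -> 'M[R]_n.

Definition jacobian_mx (R : realType) (n : nat) (f : 'rV[R]_n -> 'rV[R]_n)
    (v : 'rV[R]_n) : 'M[R]_n :=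
  \matrix_(i, j) pd i (fun w => f w 0 j) v.

(* The transformation law is imposed at the points of H° only, where partial
   derivatives make sense; it extends to the boundary by continuity. *)
Definition covariant (R : realType) (n : nat) (H : set 'rV[R]_n)
    (X : manifold H) (g : tensor2 X) : Prop :=
  forall (c1 c2 : chart R n X) v, atlas c1 -> atlas c2 ->
    cimg c1 v -> H° v -> cdom c2 (cinv c1 v) ->
    let J := jacobian_mx (transition c1 c2) v in
    g c1 v = J *m g c2 (transition c1 c2 v) *m J^T.

Definition riemannian_metric (R : realType) (n : nat) (H : set 'rV[R]_n)
    (X : manifold H) (g : tensor2 X) : Prop :=
  covariant g /\
  forall c : chart R n X, atlas c ->
    [/\ forall i j, smooth_on (cimg c) (fun v => g c v i j),
        forall v, cimg c v -> (g c v)^T = g c v &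
        forall v, cimg c v -> forall a, a != 0 -> 0 < inner (g c v) a a].

Definition C1_curve (R : realType) (n : nat) (H : set 'rV[R]_n)
    (X : manifold H) (gam : R -> X) : Prop :=
  continuous gam /\
  forall (c : chart R n X) s i, atlas c -> cdom c (gam s) ->
    let x := fun u : R => cmap c (gam u) 0 i in
    derivable x s 1 /\ {for s, continuous (derive1 x)}.

Definition speed (R : realType) (n : nat) (H : set 'rV[R]_n)
    (X : manifold H) (g : tensor2 X) (gam : R -> X) (s : R) : R :=
  let c := chart_at (gam s) in
  let u := \row_(i < n) derive1 (fun r : R => cmap c (gam r) 0 i) s in
  Num.sqrt (inner (g c (cmap c (gam s))) u u).

Definition riem_dist (R : realType) (n : nat) (H : set 'rV[R]_n)
    (X : manifold H) (g : tensor2 X) (p q : X) : \bar R :=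
  ereal_inf [set (\int[@lebesgue_measure R]_(s in `[0%R, 1%R])
                    (speed g gam s)%:E)%E
            | gam in [set gam : R -> X |
                       [/\ C1_curve gam, gam 0 = p & gam 1 = q]]].

Definition complete_metric (R : realType) (n : nat) (H : set 'rV[R]_n)
    (X : manifold H) (g : tensor2 X) : Prop :=
  forall u : nat -> X,
    (forall e : R, 0 < e -> exists N : nat, forall i j : nat,
       (N <= i)%N -> (N <= j)%N -> (riem_dist g (u i) (u j) < e%:E)%E) ->
    exists p : X, u @ \oo --> p.

(* Iterated Lebesgue integral over R^d; used for continuous compactly
   supported functions. *)
Fixpoint iint (R : realType) (d : nat) : ('rV[R]_d -> R) -> R :=
  match d with
  | 0 => fun f => f 0
  | d'.+1 => fun f : 'rV[R]_(1 + d') -> R =>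
      \int[@lebesgue_measure R]_x
        iint (fun w : 'rV[R]_d' => f (row_mx x%:M w))
  end.

Definition borel (X : ptopologicalType) := g_sigma_algebraType (@open X).

(* mu has density sqrt (det h) dy in every chart.  By the Riesz representation
   theorem there is exactly one such measure. *)
Definition volume_measure (R : realType) (d : nat)
    (N : manifold [set: 'rV[R]_d]) (h : tensor2 N)
    (mu : {measure set (borel N) -> \bar R}) : Prop :=
  forall (c : chart R d N) (f : N -> R), atlas c -> continuous f ->
    (exists K : set N, [/\ compact K, K `<=` cdom c &
                           forall y, ~ K y -> f y = 0]) ->
    (\int[mu]_y (f y)%:E)%E =
    (iint ((fun w => f (cinv c w) * Num.sqrt (\det (h c w))) \_ (cimg c)))%:E.

(* In R^(1+d) the coordinates are (x, y^A); pack x y is the point (x, y). *)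
Definition xcoord (R : realType) (d : nat) (v : 'rV[R]_(1 + d)) : R :=
  v 0 (lshift d ord0).

Definition ycoord (R : realType) (d : nat) (v : 'rV[R]_(1 + d)) : 'rV[R]_d :=
  rsubmx v.

Definition pack (R : realType) (d : nat) (x : R) (w : 'rV[R]_d) :
    'rV[R]_(1 + d) :=
  row_mx x%:M w.

Definition halfspace (R : realType) (d : nat) : set 'rV[R]_(1 + d) :=
  [set v | 0 <= xcoord v].

Definition defining_function (R : realType) (d : nat)
    (Mt : manifold (@halfspace R d)) (rho : Mt -> R) : Prop :=
  [/\ smooth_fun rho,
      forall p, rho p = 0 <-> mboundary p &
      forall p, mboundary p ->
        exists c : chart R (1 + d) Mt,
          [/\ atlas c, cdom c p &
            exists U F, [/\ U (cmap c p),
              extends_near (cimg c) (fun v => rho (cinv c v)) U F &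
              exists i, pd i F (cmap c p) != 0]]].

(* rho ^ 2 psi^* g extends to the metric gt on Mt. *)
Definition conformal_compactification (R : realType) (d : nat)
    (M : manifold [set: 'rV[R]_(1 + d)]) (Mt : manifold (@halfspace R d))
    (psi : Mt -> M) (psi' : M -> Mt) (g : tensor2 M)
    (rho : Mt -> R) (gt : tensor2 Mt) : Prop :=
  [/\ interior_diffeo psi psi',
      defining_function rho,
      riemannian_metric gt,
      compact (@mboundary R (1 + d) (@halfspace R d) Mt) &
      forall (c : chart R (1 + d) Mt) v, atlas c -> cimg c v ->
        minterior (cinv c v) ->
        gt c v = rho (cinv c v) ^+ 2 *: g (push_chart psi psi' c) v].

Definition asymptotically_hyperbolic (R : realType) (d : nat)
    (M : manifold [set: 'rV[R]_(1 + d)]) (Mt : manifold (@halfspace R d))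
    (psi : Mt -> M) (psi' : M -> Mt) (k : bool) (g : tensor2 M) : Prop :=
  [/\ riemannian_metric g, complete_metric g &
    exists rho gt,
      [/\ conformal_compactification psi psi' g rho gt,
          (* the restriction of gt to directions tangent to the boundary *)
          forall (c : chart R (1 + d) Mt) w, atlas c -> cimg c (pack 0 w) ->
            constant_sectional
              (fun w' => drsubmx (gt c (pack 0 w'))) w k%:R &
          (* |d rho|^2 = 1 + O(rho), locally uniformly *)
          forall (c : chart R (1 + d) Mt) K, atlas c -> compact K ->
            K `<=` cimg c ->
            exists C : R, forall v, K v -> (@halfspace R d)° v ->
              let f := fun w => rho (cinv c w) in
              let df := \row_i pd i f v in
              `| inner (invmx (gt c v)) df df - 1 | <= C * `| f v |]].

Definition collar_chart_of (R : realType) (d : nat) (Mt : Type) (N : Type)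
    (w : R) (chi : R -> N -> Mt) (px : Mt -> R) (py : Mt -> N)
    (c : chart R d N) : chart R (1 + d) Mt :=
  Chart [set chi s.1 s.2 | s in [set s : R * N |
                                  0 <= s.1 /\ s.1 < w /\ cdom c s.2]]
        (fun p => pack (px p) (cmap c (py p)))
        (fun v => chi (xcoord v) (cinv c (ycoord v))).

(* A diffeomorphism chi from [0, width) x N onto a neighbourhood of the
   boundary of Mt, with inverse p |-> (px p, py p).  In particular chi 0
   identifies N with the boundary. *)
Record collar (R : realType) (d : nat)
    (Mt : manifold (@halfspace R d)) (N : manifold [set: 'rV[R]_d]) := Collar {
  width : R;
  width_gt0 : 0 < width;
  chi : R -> N -> Mt;
  px : Mt -> R;
  py : Mt -> N;
  px_chi : forall x y, 0 <= x -> x < width -> px (chi x y) = x;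
  py_chi : forall x y, 0 <= x -> x < width -> py (chi x y) = y;
  collar_atlas : forall c : chart R d N, atlas c ->
    atlas (collar_chart_of width chi px py c);
  collar_boundary : forall p : Mt, mboundary p <-> exists y, p = chi 0 y
}.

Definition collar_chart (R : realType) (d : nat)
    (Mt : manifold (@halfspace R d)) (N : manifold [set: 'rV[R]_d])
    (X : collar Mt N) (c : chart R d N) : chart R (1 + d) Mt :=
  collar_chart_of (width X) (chi X) (px X) (py X) c.

Definition sinh (R : realType) (x : R) : R := (expR x - expR (- x)) / 2.

Definition rhok (R : realType) (k : bool) (x : R) : R :=
  if k then sinh x else x.

(* rho_k(x)^2 g at (x, y) in the collar coordinates defined by the chart c *)
Definition collar_metric (R : realType) (d : nat)
    (M : manifold [set: 'rV[R]_(1 + d)]) (Mt : manifold (@halfspace R d))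
    (N : manifold [set: 'rV[R]_d]) (psi : Mt -> M) (psi' : M -> Mt)
    (k : bool) (X : collar Mt N) (g : tensor2 M)
    (c : chart R d N) (x : R) (y : 'rV[R]_d) : 'M[R]_(1 + d) :=
  rhok k x ^+ 2 *: g (push_chart psi psi' (collar_chart X c)) (pack x y).

(* E = O(x^p) as x -> 0, componentwise and locally uniformly in y *)
Definition collar_bigO (R : realType) (d : nat) (N : manifold [set: 'rV[R]_d])
    (r s p : nat) (E : chart R d N -> R -> 'rV[R]_d -> 'M[R]_(r, s)) : Prop :=
  forall (c : chart R d N) K, atlas c -> compact K -> K `<=` cimg c ->
    exists C delta : R, 0 < delta /\
      forall x y i j, 0 < x -> x < delta -> K y ->
        `| E c x y i j | <= C * x ^+ p.

(* g = rho_k^-2 [dx^2 + h + (x^q / q) kappa_ij dx^i dx^j + O(x^(q+1))] *)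
Definition has_expansion (R : realType) (d : nat)
    (M : manifold [set: 'rV[R]_(1 + d)]) (Mt : manifold (@halfspace R d))
    (N : manifold [set: 'rV[R]_d]) (psi : Mt -> M) (psi' : M -> Mt)
    (k : bool) (h : tensor2 N) (X : collar Mt N) (g : tensor2 M) (q : nat)
    (kappa : chart R d N -> 'rV[R]_d -> 'M[R]_(1 + d)) : Prop :=
  collar_bigO q.+1 (fun c x y =>
    collar_metric psi psi' k X g c x y
    - block_mx (1%:M : 'M[R]_1) 0 0 (h c y)
    - (x ^+ q / q%:R) *: kappa c y).

(* g = rho_k^-2 [dx^2 + h + (x^n / n) kappa + O(x^(n+1))] with n = 1 + d, where
   kappa and the remainder have components in the y directions only *)
Definition mass_form (R : realType) (d : nat)
    (M : manifold [set: 'rV[R]_(1 + d)]) (Mt : manifold (@halfspace R d))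
    (N : manifold [set: 'rV[R]_d]) (psi : Mt -> M) (psi' : M -> Mt)
    (k : bool) (h : tensor2 N) (X : collar Mt N) (g : tensor2 M)
    (kappa : tensor2 N) : Prop :=
  (forall (c : chart R d N) x y, atlas c -> 0 < x -> x < width X ->
     cimg c y ->
     let G := collar_metric psi psi' k X g c x y in
     [/\ ulsubmx G = 1%:M, ursubmx G = 0 & dlsubmx G = 0]) /\
  collar_bigO (1 + d).+1 (fun c x y =>
    drsubmx (collar_metric psi psi' k X g c x y)
    - h c y - (x ^+ (1 + d) / (1 + d)%:R) *: kappa c y).

Definition trace_wrt (R : realType) (d : nat) (N : manifold [set: 'rV[R]_d])
    (h kappa : tensor2 N) (y : N) : R :=
  let c := chart_at y in
  \tr (invmx (h c (cmap c y)) *m kappa c (cmap c y)).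

Definition mass_integral (R : realType) (d : nat)
    (N : manifold [set: 'rV[R]_d]) (h : tensor2 N)
    (mu : {measure set (borel N) -> \bar R}) (kappa : tensor2 N) : R :=
  \int[mu]_y trace_wrt h kappa y.

(* The change from the collar coordinates of X' to those of X is
   x |-> x (1 + O(x^n)), y^A |-> y^A + O(x^(n+1)), with n = 1 + d. *)
Definition collar_change (R : realType) (d : nat)
    (Mt : manifold (@halfspace R d)) (N : manifold [set: 'rV[R]_d])
    (X X' : collar Mt N) : Prop :=
  (forall (c : chart R d N) K, atlas c -> compact K -> K `<=` cimg c ->
     exists delta : R, 0 < delta /\
       forall x y, 0 < x -> x < delta -> K y ->
         cdom (collar_chart X c) (chi X' x (cinv c y))) /\
  collar_bigO (1 + d).+1 (fun c x y =>
    cmap (collar_chart X c) (chi X' x (cinv c y)) - pack x y).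

Definition is_mass (R : realType) (d : nat)
    (M : manifold [set: 'rV[R]_(1 + d)]) (Mt : manifold (@halfspace R d))
    (N : manifold [set: 'rV[R]_d]) (psi : Mt -> M) (psi' : M -> Mt)
    (k : bool) (h : tensor2 N) (mu : {measure set (borel N) -> \bar R})
    (X : collar Mt N) (g : tensor2 M) (m : R) : Prop :=
  exists (X' : collar Mt N) (kappa : tensor2 N),
    [/\ collar_change X X', mass_form psi psi' k h X' g kappa &
        m = mass_integral h mu kappa].

(* [0, T), with T possibly infinite *)
Definition times (R : realType) (T : \bar R) : set R :=
  [set t | 0 <= t /\ (t%:E < T)%E].

(* dg/dt = -2 (Ric + (n-1) g) with n - 1 = d; the time derivative is one-sided
   at t = 0. *)
Definition normalized_ricci_flow (R : realType) (d : nat)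
    (M : manifold [set: 'rV[R]_(1 + d)]) (T : \bar R) (g : R -> tensor2 M) :
    Prop :=
  forall (t : R) (c : chart R (1 + d) M) v i j, times T t -> atlas c ->
    cimg c v ->
    (fun s : R => (g s c v i j - g t c v i j) / (s - t))
      @ within (times T) (t^')
      --> - 2 * (ricci (g t c) v i j + d%:R * g t c v i j).

(* rho_k^2 g(t) is smooth in (t, x, y) for t in [0, T), up to x = 0. *)
Definition smooth_up_to_collar (R : realType) (d : nat)
    (M : manifold [set: 'rV[R]_(1 + d)]) (Mt : manifold (@halfspace R d))
    (N : manifold [set: 'rV[R]_d]) (psi : Mt -> M) (psi' : M -> Mt)
    (k : bool) (X : collar Mt N) (T : \bar R) (g : R -> tensor2 M) : Prop :=
  forall (c : chart R d N) (i j : 'I_(1 + d)), atlas c ->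
    exists F : 'rV[R]_(1 + (1 + d)) -> R,
      smooth_on [set z | [/\ times T (xcoord z),
                             0 <= xcoord (ycoord z),
                             xcoord (ycoord z) < width X &
                             cimg c (ycoord (ycoord z))]] F /\
      forall t x y, times T t -> 0 < x -> x < width X -> cimg c y ->
        F (pack t (pack x y)) = collar_metric psi psi' k X (g t) c x y i j.

(* Main.v *)
Require Import Defs.
From HB Require Import structures.
From mathcomp Require Import all_boot all_order all_algebra.
From mathcomp Require Import all_classical all_reals all_analysis.
From mathcomp Require Import perm.
From mathcomp Require Import ring lra.

Set Implicit Arguments.
Unset Strict Implicit.
Unset Printing Implicit Defensive.

Import Order.TTheory GRing.Theory Num.Theory.
Import numFieldNormedType.Exports.

Local Open Scope classical_set_scope.
Local Open Scope ring_scope.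

(** The mass decays exponentially, m(t) = exp(- (n - 2) t) m_0, because the
    coefficients of the expansion of the metric at x = 0 satisfy linear ordinary
    differential equations in t. As n >= 3, two values of m coincide only if
    m_0 = 0.

    Write rho for rho_k and suppose that
    rho^2 g = dx^2 + h + (x^q/q) kappa + O(x^(q+1)). The background
    rho^-2 (dx^2 + h) is exactly Einstein, since rho'^2 = 1 + k rho^2 and
    Ric[h] = (n - 2) k h. Hence rho^2 (Ric + (n - 1) g) is of order x^q, and its
    coefficient is an algebraic linear function of kappa, as derivatives along
    the boundary only enter at higher order ([local_ricci]). Since rho^2 g is
    smooth up to x = 0 and in t, the tensor kappa is a multiple of a normal
    derivative at x = 0, which commutes with d/dt; so the flow gives a linear
    equation for kappa at each boundary point ([kappa_flow]).

    Let K be the trace of kappa and kappa_oo its xx component. The combination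
    S = q K + (n - 1 - q) kappa_oo satisfies K' = - 2 (n - q) S and
    kappa_oo' = (q - 2) S, hence S is an exponential ([aspect_evolution]). For
    q < n the coefficient vanishes at t = 0, so S = 0, so K and kappa_oo vanish,
    and then the other components, which satisfy scalar linear equations, vanish
    too ([kappa_vanishes]). The expansion therefore starts at order q + 1, with a
    coefficient obtained from Taylor's formula ([next_expansion]), and after
    finitely many steps q = n.

    For q = n one finds S = n K - kappa_oo and S' = - (n - 2) S. A change of
    coordinates that brings the metric to the normalized form, in which kappa has
    tangential components only, has the leading terms
    x |-> x + a_o x^(n+1)/(n + 1) and y |-> y + O(x^(n+1)). The transformation law
    at order x^n determines a_o from kappa_oo and shows that the trace of the new
    coefficient is S/n ([mass_aspect_of_change]). So the mass density at each
    boundary point is exp(- (n - 2) t) times the initial one, and integration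
    over the boundary gives the formula for m(t). *)

(** * Functions of order x^p as x tends to 0 *)

Definition bigO0 (R : realType) (p : nat) (u : R -> R) : Prop :=
  exists C, \forall x \near 0^'+, `|u x| <= C * x ^+ p.

Section BigO0.
Variable R : realType.
Implicit Types (u v : R -> R) (p q : nat).

Lemma bigO0_near p u v :
  (\forall x \near 0^'+, u x = v x) -> bigO0 p u -> bigO0 p v.
Proof.
move=> uv [C Cu]; exists C; near=> x.
have <- : u x = v x by near: x.
by near: x.
Unshelve. all: by end_near. Qed.

Lemma bigO0_ext p u v : u =1 v -> bigO0 p u -> bigO0 p v.
Proof. by move=> uv; apply: bigO0_near; apply: nearW. Qed.

Lemma bigO0D p u v : bigO0 p u -> bigO0 p v -> bigO0 p (fun x => u x + v x).
Proof.
move=> [C Cu] [D Dv]; exists (C + D); near=> x.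
rewrite (le_trans (ler_normD _ _))// mulrDl lerD//; near: x; [exact: Cu|exact: Dv].
Unshelve. all: by end_near. Qed.

Lemma bigO0N p u : bigO0 p u -> bigO0 p (fun x => - u x).
Proof. by move=> [C Cu]; exists C; near=> x; rewrite normrN; near: x.
Unshelve. all: by end_near. Qed.

Lemma bigO0B p u v : bigO0 p u -> bigO0 p v -> bigO0 p (fun x => u x - v x).
Proof. by move=> Cu Cv; apply: bigO0D => //; apply: bigO0N. Qed.

Lemma bigO0M p q u v :
  bigO0 p u -> bigO0 q v -> bigO0 (p + q) (fun x => u x * v x).
Proof.
move=> [C Cu] [D Dv]; exists (C * D); near=> x.
rewrite normrM exprD mulrACA ler_pM//; near: x; [exact: Cu|exact: Dv].
Unshelve. all: by end_near. Qed.

Lemma bigO0_0 p : bigO0 p (fun=> 0 : R).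
Proof. by exists 0; near=> x; rewrite normr0 mul0r. Unshelve. all: by end_near. Qed.

Lemma bigO0_cst (c : R) : bigO0 0 (fun=> c).
Proof. by exists `|c|; near=> x; rewrite mulr1. Unshelve. all: by end_near. Qed.

Lemma bigO0_X p : bigO0 p (fun x : R => x ^+ p).
Proof.
exists 1; near=> x; have x0 : 0 < x by near: x; apply: nbhs_right_gt.
by rewrite mul1r ger0_norm// exprn_ge0// ltW.
Unshelve. all: by end_near. Qed.

Lemma bigO0_id : bigO0 1 (fun x : R => x).
Proof. by apply: bigO0_ext (bigO0_X 1) => x; rewrite expr1. Qed.

Lemma bigO0W p q u : (p <= q)%N -> bigO0 q u -> bigO0 p u.
Proof.
move=> pq [C Cu]; exists `|C|; near=> x.
have x0 : 0 < x by near: x; apply: nbhs_right_gt.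
have x1 : x < 1 by near: x; apply: nbhs_right_lt.
rewrite (@le_trans _ _ (C * x ^+ q))//; first by near: x.
rewrite (@le_trans _ _ (`|C| * x ^+ q))//.
  by rewrite ler_wpM2r ?ler_norm// exprn_ge0// ltW.
by rewrite ler_wpM2l// ler_wiXn2l// ltW.
Unshelve. all: by end_near. Qed.

Lemma bigO0Ml p (c : R) u : bigO0 p u -> bigO0 p (fun x => c * u x).
Proof. by move=> pu; have := bigO0M (bigO0_cst c) pu; rewrite add0n. Qed.

Lemma bigO0_sum p (I : Type) (s : seq I) (f : I -> R -> R) :
  (forall i, bigO0 p (f i)) -> bigO0 p (fun x => \sum_(i <- s) f i x).
Proof.
move=> pf; elim: s => [|i s IH].
  by apply: bigO0_ext (bigO0_0 p) => x; rewrite big_nil.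
by apply: bigO0_ext (bigO0D (pf i) IH) => x; rewrite big_cons.
Qed.

Lemma bigO0_cvg0 u : bigO0 1 u -> u x @[x --> 0^'+] --> (0 : R).
Proof.
move=> [C Cu].
apply/cvgrPdist_le => e e0; near=> x.
have x0 : 0 < x by near: x; apply: nbhs_right_gt.
rewrite sub0r normrN (@le_trans _ _ (C * x ^+ 1))//; first by near: x.
rewrite expr1 (@le_trans _ _ ((`|C| + 1) * x))//.
  rewrite ler_wpM2r ?ltW//.
  by rewrite (le_lt_trans (ler_norm C))// ltrDl.
rewrite -ler_pdivlMl ?ltr_wpDl//; near: x; apply: nbhs_right_le.
by rewrite mulr_gt0// invr_gt0 ltr_wpDl.
Unshelve. all: by end_near. Qed.

Lemma cvg_bounded_bigO0 u (l : R) : u x @[x --> 0^'+] --> l -> bigO0 0 u.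
Proof.
move=> /cvgrPdist_le/(_ 1 ltr01) ul; exists (`|l| + 1); near=> x.
rewrite mulr1 -(subrK l (u x)) addrC (le_trans (ler_normD _ _))// lerD2l.
by rewrite distrC; near: x.
Unshelve. all: by end_near. Qed.

(** Dividing by x^p leaves a constant which tends to 0. Coefficients of
    expansions are compared in this way throughout. *)
Lemma bigO0_coef0 p (a : R) : bigO0 p.+1 (fun x => a * x ^+ p) -> a = 0.
Proof.
move=> [C Ca].
have : bigO0 1 (fun=> a).
  exists C; near=> x.
  have x0 : 0 < x by near: x; apply: nbhs_right_gt.
  have : `|a * x ^+ p| <= C * x ^+ p.+1 by near: x.
  rewrite normrM (ger0_norm (exprn_ge0 p (ltW x0))) exprS mulrA.
  by rewrite (ler_pM2r (exprn_gt0 p x0)) expr1.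
move=> /bigO0_cvg0/cvg_lim => /(_ (@Rhausdorff R)) <-.
by rewrite lim_cst.
Unshelve. all: by end_near. Qed.

End BigO0.

(** * Mean value estimates and the symmetry of mixed derivatives *)

Section Taylor.
Variable R : realType.

(** Here phi l stands for the l-th derivative. Downward induction on l: the
    mean value theorem on [0, x] turns a bound on phi l.+1 into one on phi l
    with one more factor x. Only the order of vanishing is of interest, so the
    factorials of the Taylor formula are dropped. *)
Lemma taylor_bound (phi : nat -> R -> R) (N : nat) (delta C : R) :
  (forall l (x : R), (l <= N)%N -> `|x| < delta ->
     is_derive x 1 (phi l) (phi l.+1 x)) ->
  (forall l, (l <= N)%N -> phi l 0 = 0) ->
  (forall x : R, `|x| < delta -> `|phi N.+1 x| <= C) ->
  forall l (x : R), (l <= N.+1)%N -> 0 <= x -> x < delta ->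
    `|phi l x| <= C * x ^+ (N.+1 - l).
Proof.
move=> dphi phi0 phiC l x lN; rewrite -(subKn lN).
elim: (N.+1 - l)%N (leq_subr l N.+1) x => [|m IH] mN x x0 xd.
  by rewrite subn0 subnn mulr1 phiC// ger0_norm.
have lN' : (N.+1 - m.+1 <= N)%N by rewrite leq_subLR addSn ltnS leq_addl.
have el : (N.+1 - m = (N.+1 - m.+1).+1)%N by rewrite -subSn.
have cont : {within `[0, x], continuous (phi (N.+1 - m.+1)%N)}.
  apply: derivable_within_continuous => y; rewrite in_itv /= => /andP[y0 yx].
  have yd : `|y| < delta by rewrite ger0_norm// (le_lt_trans yx).
  by have [] := dphi _ y lN' yd.
have [|c] := @MVT_segment R _ (phi (N.+1 - m)%N) 0 x x0 _ cont.
  move=> y; rewrite in_itv /= => /andP[y0 yx].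
  rewrite el; apply: dphi => //.
  by rewrite ger0_norm ?ltW// (lt_trans yx).
rewrite in_itv /= => /andP[c0 cx].
rewrite (phi0 _ lN') !subr0 => ->.
rewrite normrM (ger0_norm x0) subKn//.
have mN' : (m <= N.+1)%N by exact: leq_trans mN.
have := IH mN' c c0 (le_lt_trans cx xd).
rewrite subKn// => H.
have C0 : 0 <= C.
  by rewrite (le_trans (normr_ge0 _) (phiC x _))// ger0_norm.
rewrite exprSr mulrA ler_wpM2r// (le_trans H)//.
by rewrite ler_wpM2l// lerXn2r.
Qed.

End Taylor.

Section Lines.
Variables (R : realType) (n : nat).
Implicit Types (f : 'rV[R]_n -> R) (u v a b e : 'rV[R]_n).

Lemma is_derive_line f v e (s df : R) : is_derive (v + s *: e) e f df ->
  is_derive s 1 (fun r : R => f (v + r *: e)) df.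
Proof.
move=> [fd fE].
have E : (fun h : R => h^-1 *: (((fun r : R => f (v + r *: e)) \o shift s) (h *: 1)
            - (fun r : R => f (v + r *: e)) s)) =
         (fun h : R => h^-1 *: ((f \o shift (v + s *: e)) (h *: e)
            - f (v + s *: e))).
  apply/funext => h /=; congr (_ *: (f _ - _)).
  by rewrite [h *: 1]mulr1 scalerDl addrCA.
by apply: DeriveDef; rewrite -?fE /derivable /derive E.
Qed.

Lemma open_plane (U : set 'rV[R]_n) v a b : open U -> U v ->
  exists2 r : R, 0 < r &
    forall s t : R, `|s| < r -> `|t| < r -> U (v + s *: a + t *: b).
Proof.
move=> oU Uv; have /nbhs_ballP[r /= r0 Ur] : nbhs v U by exact: open_nbhs_nbhs.
have M0 : 0 < `|a| + `|b| + 1 by rewrite ltr_wpDl ?addr_ge0.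
exists (r / (`|a| + `|b| + 1)); first by rewrite divr_gt0.
move=> s t sr tr; apply: Ur; rewrite -ball_normE /= distrC -[v + _ + _]addrA [v + _]addrC addrK.
have [s0|s0] := eqVneq (Num.max `|s| `|t|) 0.
  have := le_max `|s| `|s| `|t|; have := le_max `|t| `|s| `|t|.
  rewrite !lexx orbT /= s0 !normr_le0 => /eqP -> /eqP ->.
  by rewrite !scale0r addr0 normr0.
rewrite (le_lt_trans (ler_normD _ _))// !normrZ.
have m0 : 0 < Num.max `|s| `|t|.
  by rewrite lt_neqAle eq_sym s0 le_max normr_ge0.
apply: (@le_lt_trans _ _ (Num.max `|s| `|t| * (`|a| + `|b|))).
  by rewrite mulrDr lerD// ler_wpM2r// le_max lexx ?orbT.
have mr : Num.max `|s| `|t| < r / (`|a| + `|b| + 1) by rewrite gt_max sr tr.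
rewrite ltr_pdivlMr// in mr.
by rewrite (lt_le_trans _ (ltW mr))// ltr_pM2l// ltrDl.
Qed.

(** The mean value theorem is applied twice, first in the direction a to the
    difference in the direction b, then in the direction b. *)
Lemma second_difference f fa fab (U : set 'rV[R]_n) v a b (r h : R) :
  (forall s t : R, `|s| < r -> `|t| < r -> U (v + s *: a + t *: b)) ->
  (forall w, U w -> is_derive w a f (fa w)) ->
  (forall w, U w -> is_derive w b fa (fab w)) ->
  0 < h -> h < r ->
  exists s t : R, [/\ 0 <= s <= h, 0 <= t <= h &
    f (v + h *: a + h *: b) - f (v + h *: a) - (f (v + h *: b) - f v)
    = fab (v + s *: a + t *: b) * h ^+ 2].
Proof.
move=> Ur fda fdab h0 hr.
have in_r (s : R) : s \in `[0, h]%R -> `|s| < r.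
  by rewrite in_itv /= => /andP[s0 sh]; rewrite ger0_norm// (le_lt_trans sh).
have r0 : `|0 : R| < r by rewrite normr0 (lt_trans h0).
have rh : `|h| < r by rewrite gtr0_norm.
pose g (s : R) := f (v + h *: b + s *: a) - f (v + s *: a).
pose dg (s : R) := fa (v + h *: b + s *: a) - fa (v + s *: a).
have gd (s : R) : s \in `[0, h]%R -> is_derive s 1 g (dg s).
  move=> /in_r sr; apply: is_deriveB; apply: is_derive_line; apply: fda.
    by rewrite addrAC; apply: Ur.
  by have := Ur s 0 sr r0; rewrite scale0r addr0.
have gc : {within `[0, h], continuous g}.
  by apply: derivable_within_continuous => x xh; have [] := gd x xh.
have gd' (s : R) : s \in `]0, h[%R -> is_derive s 1 g (dg s).
  by move=> sh; apply: gd; apply: subset_itv_oo_cc sh.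
have [s shs Es] := MVT_segment (ltW h0) gd' gc.
have sr := in_r _ shs.
pose k (t : R) := fa (v + s *: a + t *: b).
pose dk (t : R) := fab (v + s *: a + t *: b).
have kd (t : R) : t \in `[0, h]%R -> is_derive t 1 k (dk t).
  by move=> /in_r tr; apply: is_derive_line; apply: fdab; apply: Ur.
have kc : {within `[0, h], continuous k}.
  by apply: derivable_within_continuous => x xh; have [] := kd x xh.
have kd' (t : R) : t \in `]0, h[%R -> is_derive t 1 k (dk t).
  by move=> th; apply: kd; apply: subset_itv_oo_cc th.
have [t tht Et] := MVT_segment (ltW h0) kd' kc.
exists s, t; split; rewrite ?(itvP shs) ?(itvP tht)//.
move: Es Et; rewrite /g /dg /k /dk !scale0r !addr0 subr0.
rewrite [v + h *: b + h *: a]addrAC [v + h *: b + s *: a]addrAC => -> ->.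
by rewrite -mulrA -expr2.
Qed.

(** Both mixed derivatives are limits of the same second difference quotient. *)
Lemma mixed_derive f fa fb fab fba (U : set 'rV[R]_n) v a b : open U -> U v ->
  (forall w, U w -> is_derive w a f (fa w)) ->
  (forall w, U w -> is_derive w b fa (fab w)) ->
  (forall w, U w -> is_derive w b f (fb w)) ->
  (forall w, U w -> is_derive w a fb (fba w)) ->
  {for v, continuous fab} -> {for v, continuous fba} ->
  fab v = fba v.
Proof.
move=> oU Uv fda fdab fdb fdba cab cba.
have near_v (g : 'rV[R]_n -> R) (e : R) : 0 < e -> {for v, continuous g} ->
    exists2 r : R, 0 < r & forall s t : R, `|s| < r -> `|t| < r ->
      `|g v - g (v + s *: a + t *: b)| < e.
  move=> e0 /cvgrPdist_lt/(_ e e0) ge.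
  have [A [oA Av] Ag] : exists2 A, open_nbhs v A & A `<=` [set w | `|g v - g w| < e].
    by move: ge; rewrite {1}nbhsE => -[A ? ?]; exists A.
  have [r r0 Ar] := open_plane a b oA Av.
  by exists r => // s t sr tr; apply: Ag; apply: Ar.
apply/eqP; rewrite -subr_eq0 -normr_le0; apply/ler_addgt0Pr => e e0; rewrite add0r.
have e2 : 0 < e / 2 by rewrite divr_gt0.
have [r1 r10 H1] := near_v _ _ e2 cab.
have [r2 r20 H2] := near_v _ _ e2 cba.
have [r3 r30 H3] := open_plane a b oU Uv.
pose r := Num.min r1 (Num.min r2 r3).
have r0 : 0 < r by rewrite /r !lt_min r10 r20 r30.
pose h := r / 2.
have h0 : 0 < h by rewrite divr_gt0.
have hr : h < r by rewrite /h ltr_pdivrMr// mulr_natr mulr2n ltrDl.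
have /and3P[hr1 hr2 hr3] : [&& h < r1, h < r2 & h < r3].
  by move: hr; rewrite /r !lt_min.
have [s [t [/andP[s0 sh] /andP[t0 th] Est]]] := second_difference H3 fda fdab h0 hr3.
have H3' (x y : R) : `|x| < r3 -> `|y| < r3 -> U (v + x *: b + y *: a).
  by move=> xr yr; rewrite addrAC; apply: H3.
have [s' [t' [/andP[s'0 s'h] /andP[t'0 t'h] Est']]] :=
  second_difference H3' fdb fdba h0 hr3.
move: (H1 s t) (H2 t' s').
rewrite (ger0_norm s0) (ger0_norm t0) (ger0_norm s'0) (ger0_norm t'0) => {}H1 {}H2.
have K1 := H1 (le_lt_trans sh hr1) (le_lt_trans th hr1).
have K2 := H2 (le_lt_trans t'h hr2) (le_lt_trans s'h hr2).
move: Est Est' K1 K2.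
rewrite [v + s' *: b + t' *: a]addrAC [v + h *: b + h *: a]addrAC.
move: (fab (v + s *: a + t *: b)) (fba (v + t' *: a + s' *: b)) (fab v) (fba v).
move: (f (v + h *: a + h *: b)) (f (v + h *: a)) (f (v + h *: b)) (f v).
move=> f1 f2 f3 f4 z z' x y E E' K1 K2.
have zz' : z = z'.
  apply: (@mulIf _ (h ^+ 2)); first by rewrite expf_neq0// gt_eqF.
  by rewrite -E -E'; ring.
rewrite -zz' in K2.
rewrite (le_trans (ler_distD z x y))// [leRHS]splitr lerD ?ltW//.
by rewrite distrC.
Qed.

End Lines.

(** * Smooth functions on open sets *)

Section Smooth.
Variable R : realType.

Lemma near_open (T : topologicalType) (U P : set T) (v : T) :
  open U -> U v -> U `<=` P -> \forall w \near v, P w.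
Proof. by move=> oU Uv UP; apply: filterS UP _; exact: open_nbhs_nbhs. Qed.

Lemma near_eq_pd n (i : 'I_n) (f g : 'rV[R]_n -> R) (v : 'rV[R]_n) :
  (\forall w \near v, f w = g w) -> pd i f v = pd i g v.
Proof. exact: near_eq_derive. Qed.

Lemma near_eq_iter_pd n (s : seq 'I_n) (f g : 'rV[R]_n -> R) (v : 'rV[R]_n) :
  (\forall w \near v, f w = g w) ->
  \forall w \near v, iter_pd s f w = iter_pd s g w.
Proof.
move=> fg; elim: s => [//|i s IH].
by apply: filterS (nbhs_interior IH) => w; exact: near_eq_pd.
Qed.

Lemma open_smooth_near n (U : set 'rV[R]_n) f g : open U -> open_smooth U f ->
  (forall w, U w -> f w = g w) -> open_smooth U g.
Proof.
move=> oU sf fg s v Uv.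
have sfg : \forall w \near v, iter_pd s f w = iter_pd s g w.
  exact/near_eq_iter_pd/(near_open oU Uv).
have [fd fc] := sf s v Uv; split=> [i|].
  exact: near_eq_derivable sfg (fd i).
rewrite /prop_for /continuous_at -(nbhs_singleton sfg).
exact: cvg_trans (near_eq_cvg sfg) fc.
Qed.

Lemma open_smoothS n (U V : set 'rV[R]_n) f :
  V `<=` U -> open_smooth U f -> open_smooth V f.
Proof. by move=> VU sf s v /VU; apply: sf. Qed.

Lemma iter_pd_cat n (s1 s2 : seq 'I_n) (f : 'rV[R]_n -> R) :
  iter_pd (s1 ++ s2) f = iter_pd s1 (iter_pd s2 f).
Proof. by rewrite /iter_pd foldr_cat. Qed.

Lemma open_smooth_iter n (U : set 'rV[R]_n) f s :
  open_smooth U f -> open_smooth U (iter_pd s f).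
Proof. by move=> sf s' v Uv; rewrite -iter_pd_cat; exact: sf. Qed.

Lemma open_smooth_pd n (U : set 'rV[R]_n) f i :
  open_smooth U f -> open_smooth U (pd i f).
Proof. exact: (@open_smooth_iter n U f [:: i]). Qed.

Lemma open_smooth_derivable n (U : set 'rV[R]_n) f i v :
  open_smooth U f -> U v -> derivable f v (delta_mx 0 i).
Proof. by move=> sf Uv; exact: (sf [::] v Uv).1. Qed.

Lemma pd_comm n (U : set 'rV[R]_n) f i j v : open U -> open_smooth U f ->
  U v -> pd i (pd j f) v = pd j (pd i f) v.
Proof.
move=> oU sf Uv.
have der g k w : open_smooth U g -> U w -> is_derive w (delta_mx 0 k) g (pd k g w).
  by move=> sg Uw; apply: derivableP; exact: open_smooth_derivable sg Uw.
apply: (mixed_derive (f := f) (fa := pd j f) (fb := pd i f) oU Uv).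
- by move=> w; exact: der.
- by move=> w; apply: der; exact: open_smooth_pd.
- by move=> w; exact: der.
- by move=> w; apply: der; exact: open_smooth_pd.
- exact: (sf [:: i; j] v Uv).2.
- exact: (sf [:: j; i] v Uv).2.
Qed.

Lemma pd_iter_comm n (U : set 'rV[R]_n) f i s v : open U -> open_smooth U f ->
  U v -> pd i (iter_pd s f) v = iter_pd s (pd i f) v.
Proof.
move=> oU sf; elim: s v => [//|j s IH] v Uv /=.
rewrite (pd_comm _ _ oU (open_smooth_iter s sf) Uv).
exact/near_eq_pd/(near_open oU Uv).
Qed.

Lemma iter_pd_comm n (U : set 'rV[R]_n) f s1 s2 v : open U -> open_smooth U f ->
  U v -> iter_pd s1 (iter_pd s2 f) v = iter_pd s2 (iter_pd s1 f) v.
Proof.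
move=> oU sf; elim: s1 v => [//|i s IH] v Uv /=.
rewrite -(pd_iter_comm i s2 oU (open_smooth_iter s sf) Uv).
exact/near_eq_pd/(near_open oU Uv).
Qed.

End Smooth.

Section Slices.
Variable R : realType.

(* iota is an affine map sending the i-th coordinate line to the sigma i-th *)
Variables (m n : nat) (iota : 'rV[R]_m -> 'rV[R]_n) (sigma : 'I_m -> 'I_n).
Hypothesis iota_line : forall (h : R) i v,
  iota (h *: delta_mx 0 i + v) = h *: delta_mx 0 (sigma i) + iota v.
Hypothesis iota_continuous : continuous iota.

Lemma slice_quotient (f : 'rV[R]_n -> R) i v :
  (fun h : R => h^-1 *: (((f \o iota) \o shift v) (h *: delta_mx 0 i) - (f \o iota) v))
  = (fun h : R => h^-1 *: ((f \o shift (iota v)) (h *: delta_mx 0 (sigma i)) - f (iota v))).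
Proof. by apply/funext => h /=; rewrite iota_line. Qed.

Lemma pd_slice (f : 'rV[R]_n -> R) i v :
  pd i (f \o iota) v = pd (sigma i) f (iota v).
Proof. by rewrite /pd /derive slice_quotient. Qed.

Lemma iter_pd_slice (f : 'rV[R]_n -> R) s :
  iter_pd s (f \o iota) = iter_pd (map sigma s) f \o iota.
Proof.
elim: s => [//|i s IH]; apply/funext => v.
rewrite -[iter_pd (i :: s) _]/(pd i (iter_pd s _)) IH.
exact: pd_slice.
Qed.

Lemma open_smooth_slice (U : set 'rV[R]_n) f :
  open_smooth U f -> open_smooth (iota @^-1` U) (f \o iota).
Proof.
move=> sf s v Uv; rewrite iter_pd_slice; have [fd fc] := sf (map sigma s) _ Uv.
split=> [i|]; first by rewrite /derivable slice_quotient; exact: fd.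
by apply: continuous_comp; [exact: iota_continuous|exact: fc].
Qed.

End Slices.

Section Pack.
Variables (R : realType) (d : nat).
Implicit Types (x : R) (y w : 'rV[R]_d) (v : 'rV[R]_(1 + d)).

Lemma xcoord_pack x y : xcoord (pack x y) = x.
Proof. by rewrite /xcoord /pack row_mxEl mxE eqxx. Qed.

Lemma ycoord_pack x y : ycoord (pack x y) = y.
Proof. exact: row_mxKr. Qed.

Lemma packK v : pack (xcoord v) (ycoord v) = v.
Proof.
rewrite -[RHS]hsubmxK; congr row_mx.
apply/matrixP => i j; rewrite !mxE !ord1 /= mulr1n /xcoord.
by congr (v _ _); apply: val_inj.
Qed.

Lemma packl x y : pack x y 0 (lshift d ord0) = x.
Proof. exact: xcoord_pack. Qed.

Lemma packr x y A : pack x y 0 (rshift 1 A) = y 0 A.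
Proof. by rewrite /pack row_mxEr. Qed.

Lemma pack_rowP x y v :
  v 0 (lshift d ord0) = x -> (forall A, v 0 (rshift 1 A) = y 0 A) -> v = pack x y.
Proof.
move=> vx vy; apply/rowP => j; case: (split_ordP j) => k ->.
  by rewrite ord1 packl.
by rewrite packr.
Qed.

Lemma pack_line_y x (h : R) (A : 'I_d) y :
  pack x (h *: delta_mx 0 A + y) = h *: delta_mx 0 (rshift 1 A) + pack x y.
Proof.
apply/esym/pack_rowP => [|B]; rewrite [LHS]mxE [X in X + _]mxE ?packl ?packr !mxE.
  by rewrite eq_lrshift andbF mulr0 add0r.
by rewrite (inj_eq (@rshift_inj _ _)).
Qed.

Lemma pack_line_x x (h : R) y :
  pack (x + h) y = pack x y + h *: delta_mx 0 (lshift d ord0).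
Proof.
apply/esym/pack_rowP => [|B]; rewrite [LHS]mxE [X in _ + X]mxE ?packl ?packr !mxE.
  by rewrite !eqxx mulr1.
by rewrite eq_rlshift andbF mulr0 addr0.
Qed.

Lemma mx_norm_ge_entry m n (A : 'M[R]_(m, n)) i j : `|A i j| <= `|A|.
Proof.
rewrite [X in _ <= X]/Num.Def.normr /= mx_normrE.
exact: (@le_bigmax _ _ _ 0 (fun ij : 'I_m * 'I_n => `|A ij.1 ij.2|) (i, j)).
Qed.

Lemma mx_norm_ltP m n (A : 'M[R]_(m, n)) (e : R) : 0 < e ->
  `|A| < e <-> forall i j, `|A i j| < e.
Proof.
move=> e0; split=> [Ae i j|Ae]; first exact: le_lt_trans (mx_norm_ge_entry A i j) Ae.
rewrite [X in X < _]/Num.Def.normr /= mx_normrE.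
by apply/bigmax_ltP; split => // -[i j] _ /=.
Qed.

Lemma norm_pack x y (e : R) : 0 < e ->
  `|pack x y| < e <-> `|x| < e /\ `|y| < e.
Proof.
move=> e0; rewrite !mx_norm_ltP//; split.
  by move=> H; split=> [|i j]; [have := H 0 (lshift d ord0); rewrite packl|
    have := H 0 (rshift 1 j); rewrite packr ord1].
move=> [xe ye] i j; rewrite ord1; case: (split_ordP j) => k ->.
  by rewrite ord1 packl.
by rewrite packr.
Qed.

Lemma packB x y x' y' : pack x y - pack x' y' = pack (x - x') (y - y').
Proof.
by apply/pack_rowP => [|B]; rewrite [LHS]mxE [X in _ + X]mxE ?packl ?packr ?mxE.
Qed.

Lemma near_norm m n (v : 'M[R]_(m, n)) (e : R) (P : set 'M[R]_(m, n)) : 0 < e ->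
  (forall w : 'M[R]_(m, n), `|v - w| < e -> P w) -> nbhs v P.
Proof.
move=> e0 H; apply: filterS (nbhsx_ballx v e e0) => w.
by rewrite -ball_normE => /H.
Qed.

Lemma pack_continuous x : continuous (@pack R d x).
Proof.
move=> y; apply/(@cvgrPdist_lt _ _ _ (nbhs y)) => e e0; apply: (near_norm e0) => z yz /=.
by rewrite packB norm_pack// subrr normr0.
Qed.

Lemma ycoord_continuous : continuous (@ycoord R d).
Proof.
move=> v; apply/(@cvgrPdist_lt _ _ _ (nbhs v)) => e e0; apply: (near_norm e0) => z.
rewrite -{1}(packK v) -{1}(packK z) packB norm_pack// => -[_].
by [].
Qed.

Lemma xcoord_continuous : continuous (@xcoord R d).
Proof. exact: coord_continuous. Qed.

End Pack.

(** * Taylor coefficients in the normal direction *)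

Notation ox d := (lshift d (ord0 : 'I_1)).

Section Expansion.
Variables (R : realType) (d : nat).
Implicit Types (f u : 'rV[R]_(1 + d) -> R) (U : set 'rV[R]_(1 + d)).
Implicit Types (y : 'rV[R]_d).

(** The l-th normal derivative at the boundary: the Taylor coefficient of x^l
    times l!. *)
Definition xcoef f (l : nat) y : R := iter_pd (nseq l (ox d)) f (pack 0 y).

Lemma box_nbhs U (x0 : R) y0 : open U -> U (pack x0 y0) ->
  exists2 r : R, 0 < r & forall x y, `|x - x0| < r -> `|y - y0| < r -> U (pack x y).
Proof.
move=> oU Uv; have /nbhs_ballP[r /= r0 Ur] : nbhs (pack x0 y0) U by exact: open_nbhs_nbhs.
exists r => // x y xr yr; apply: Ur; rewrite -ball_normE /= packB norm_pack//.
by rewrite distrC [`|y0 - y|]distrC.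
Qed.

Lemma is_derive_pack f (x : R) y : derivable f (pack x y) (delta_mx 0 (ox d)) ->
  is_derive x 1 (fun x => f (pack x y)) (pd (ox d) f (pack x y)).
Proof.
move=> fd.
have E : (fun x => f (pack x y)) = (fun x => f (pack 0 y + x *: delta_mx 0 (ox d))).
  by apply/funext => z; rewrite -pack_line_x add0r.
rewrite E; apply: is_derive_line; rewrite -pack_line_x add0r.
exact: derivableP.
Qed.

Lemma is_derive_monomial (a x : R) (m : nat) :
  is_derive x 1 (fun x => a / m.+1`!%:R * x ^+ m.+1) (a / m`!%:R * x ^+ m).
Proof.
have d1 : is_derive x 1 (fun x : R => x ^+ m.+1) (m.+1%:R * x ^+ m).
  apply: DeriveDef; first exact: exprn_derivable.
  by rewrite exp_derive /GRing.scale /= mulr1.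
rewrite (_ : (fun x => _) = (a / m.+1`!%:R) *: (fun x : R => x ^+ m.+1))//.
apply: is_derive_eq; rewrite /GRing.scale /= mulrA; congr (_ * _).
by rewrite factS natrM invfM [_^-1 * _]mulrC mulrA divfK// pnatr_eq0.
Qed.

(** The constants are uniform for y near y0, as required by remainders that
    are locally uniform along the boundary. The number c is the value at x =
    0, which is subtracted when it belongs to the Taylor polynomial, that is
    for N > 0. *)
Lemma taylor_uniform f U y0 N : open U -> open_smooth U f -> U (pack 0 y0) ->
  exists C r : R, 0 < r /\ forall y, `|y - y0| < r ->
    (forall x, `|x| < r -> U (pack x y)) /\
    forall c, (forall l, (l < N)%N -> xcoef f l y = c * (l == 0)%:R) ->
    forall x, 0 <= x -> x < r ->
    `|f (pack x y) - c * (0 < N)%:R - xcoef f N y / N`!%:R * x ^+ N| <= C * x ^+ N.+1.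
Proof.
move=> oU sf Uv.
have [r1 r10 Ur1] := box_nbhs oU Uv.
pose fN := iter_pd (nseq N.+1 (ox d)) f.
have fNc : {for pack 0 y0, continuous fN} by exact: (sf _ _ Uv).2.
pose C := `|fN (pack 0 y0)| + 1.
have [A [oA Av] AC] : exists2 A, open_nbhs (pack 0 y0) A &
    A `<=` [set w | `|fN w| <= C].
  have : nbhs (pack 0 y0) [set w | `|fN w| <= C].
    move: fNc => /cvgrPdist_lt/(_ 1 ltr01); apply: filterS => w /= H.
    rewrite -(subrK (fN (pack 0 y0)) (fN w)) (le_trans (ler_normD _ _))// addrC.
    by rewrite lerD2l distrC ltW.
  by rewrite nbhsE => -[A ? ?]; exists A.
have [r2 r20 Ar2] := box_nbhs oA Av.
pose r := Num.min r1 r2; exists C, r.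
split=> [|y]; first by rewrite lt_min r10.
rewrite lt_min => /andP[y1 y2].
have Ux x : `|x| < r -> U (pack x y) /\ A (pack x y).
  rewrite lt_min => /andP[x1 x2].
  by split; [apply: Ur1|apply: Ar2]; rewrite ?subr0.
split=> [x /Ux[]//|c fl x x0 xr].
set a := xcoef f N y.
pose phi l x := iter_pd (nseq l (ox d)) f (pack x y) - c * ((l == 0) && (0 < N))%N%:R
  - (if (l <= N)%N then a / (N - l)`!%:R * x ^+ (N - l) else 0).
suff H : `|phi 0%N x| <= C * x ^+ (N.+1 - 0) by rewrite /phi /= !subn0 in H.
apply: (@taylor_bound R phi N r C _ _ _ 0 x isT x0 xr).
- move=> l z lN zr; rewrite /phi.
  have d1 : is_derive z 1 (fun x => iter_pd (nseq l (ox d)) f (pack x y))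
     (iter_pd (nseq l.+1 (ox d)) f (pack z y)).
    apply: is_derive_pack; apply: (open_smooth_derivable (U := U)).
      exact: open_smooth_iter.
    exact: (Ux _ zr).1.
  have d2 : is_derive z 1
     (fun x => if (l <= N)%N then a / (N - l)`!%:R * x ^+ (N - l) else 0)
     (if (l.+1 <= N)%N then a / (N - l.+1)`!%:R * z ^+ (N - l.+1) else 0).
    rewrite lN; case: ltnP => lN'.
      rewrite -(subnSK lN'); exact: is_derive_monomial.
    have -> : l = N by apply/eqP; rewrite eqn_leq lN.
    rewrite subnn (_ : (fun _ => _) = cst (a / 1)); last first.
      by apply/funext => t; rewrite mulr1.
    exact: is_derive_cst.
  set k := c * _; rewrite (_ : (fun z => _) = (fun x => iter_pd (nseq l (ox d)) f (pack x y)) - cst k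
     - (fun x => if (l <= N)%N then a / (N - l)`!%:R * x ^+ (N - l) else 0))//.
  by apply: is_derive_eq; rewrite mulr0.
- move=> l lN; rewrite /phi lN; case: (ltngtP l N) lN => // [lN _|-> _].
    have Nl : ((N - l)%N == 0%N) = false by rewrite subn_eq0 leqNgt lN.
    have N0 : (0 < N)%N by exact: leq_ltn_trans lN.
    rewrite expr0n Nl mulr0 subr0 -[iter_pd _ _ _]/(xcoef f l y) fl// N0 andbT.
    by rewrite subrr.
  rewrite subnn mulr1 fact0 divr1 -[iter_pd _ _ _]/a.
  have -> : (N == 0)%N && (0 < N)%N = false by rewrite lt0n; case: (N == 0)%N.
  by rewrite mulr0 subr0 subrr.
- move=> z /Ux[_ /AC]; rewrite /phi ltnn /= mulr0 !subr0.
  exact.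
Qed.

Let mul0b (c : R) : c * (0%N == 0%N)%:R = c. Proof. exact: mulr1. Qed.
Let mulSb (c : R) l : c * (l.+1 == 0%N)%:R = 0. Proof. exact: mulr0. Qed.

Lemma expand f U y N c : open U -> open_smooth U f -> U (pack 0 y) ->
  (forall l, (l < N)%N -> xcoef f l y = c * (l == 0)%:R) ->
  bigO0 N.+1 (fun x => f (pack x y) - c * (0 < N)%:R - xcoef f N y / N`!%:R * x ^+ N).
Proof.
move=> oU sf Uy fl; have [C [r [r0 H]]] := taylor_uniform N oU sf Uy.
have [|_ /(_ c fl) {}H] := H y; first by rewrite subrr normr0.
exists C; near=> x; apply: H; near: x.
  exact: nbhs_right_ge.
exact: nbhs_right_lt.
Unshelve. all: by end_near. Qed.

Lemma expand_le f U y N : open U -> open_smooth U f -> U (pack 0 y) ->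
  (forall l, (0 < l < N)%N -> xcoef f l y = 0) -> (0 < N)%N ->
  bigO0 N (fun x => f (pack x y) - f (pack 0 y)).
Proof.
move=> oU sf Uy fl N0.
have := @expand f U y N (f (pack 0 y)) oU sf Uy.
rewrite N0 mulr1 => H.
have {}H := H _.
have /H E : forall l, (l < N)%N -> xcoef f l y = f (pack 0 y) * (l == 0)%:R.
  by case=> [_|l lN]; [rewrite mul0b|rewrite mulSb fl].
have := bigO0D (bigO0W (leqnSn N) E) (bigO0Ml (xcoef f N y / N`!%:R) (bigO0_X R N)).
by apply: bigO0_ext => x; rewrite subrK.
Qed.

Lemma expand_le0 f U y N : open U -> open_smooth U f -> U (pack 0 y) ->
  (forall l, (l < N)%N -> xcoef f l y = 0) -> bigO0 N (fun x => f (pack x y)).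
Proof.
move=> oU sf Uy fl.
have := @expand f U y N 0 oU sf Uy.
rewrite mul0r => H; have {}H := H _.
have /H E : forall l, (l < N)%N -> xcoef f l y = 0 * (l == 0)%:R.
  by move=> l lN; rewrite mul0r fl.
have := bigO0D (bigO0W (leqnSn N) E) (bigO0Ml (xcoef f N y / N`!%:R) (bigO0_X R N)).
by apply: bigO0_ext => x; rewrite subrK subr0.
Qed.

(** By strong induction: once the lower coefficients are known, the Taylor
    expansion identifies the next one. *)
Lemma xcoef_vanish f U y q b : open U -> open_smooth U f -> U (pack 0 y) ->
  bigO0 q (fun x => f (pack x y) - b) ->
  forall l, (l < q)%N -> xcoef f l y = b * (l == 0)%:R.
Proof.
move=> oU sf Uy fb l; elim/ltn_ind: l => l IH lq.
have fl k : (k < l)%N -> xcoef f k y = b * (k == 0)%:R.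
  by move=> kl; apply: IH => //; exact: ltn_trans lq.
have := bigO0B (bigO0W lq fb) (expand oU sf Uy fl).
have E : xcoef f l y / l`!%:R - b * (l == 0)%:R = 0 ->
    xcoef f l y = b * (l == 0)%:R.
  move/eqP; rewrite subr_eq0 => /eqP.
  have lf : l`!%:R != 0 :> R by rewrite pnatr_eq0 -lt0n fact_gt0.
  move/(congr1 (fun z => z * l`!%:R)); rewrite divfK// => ->.
  by case: l {IH lq fl lf} => [|l]; rewrite ?mul0b ?mulSb ?mul0r// mulr1.
move=> H; apply/E/(@bigO0_coef0 _ l); apply: bigO0_ext H => x.
case: l {IH lq fl E} => [|l] /=; rewrite ?expr0; ring.
Qed.

Lemma xcoef_leading f U y q b a : open U -> open_smooth U f -> U (pack 0 y) ->
  (0 < q)%N -> bigO0 q.+1 (fun x => f (pack x y) - b - a * x ^+ q) ->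
  xcoef f q y = a * q`!%:R.
Proof.
move=> oU sf Uy q0 fb.
have H : bigO0 q (fun x => f (pack x y) - b).
  have := bigO0D (bigO0W (leqnSn q) fb) (bigO0Ml a (bigO0_X R q)).
  by apply: bigO0_ext => x; rewrite subrK.
have := bigO0B (expand oU sf Uy (xcoef_vanish oU sf Uy H)) fb.
rewrite q0 mulr1 => E.
have /eqP : a - xcoef f q y / q`!%:R = 0.
  by apply: (@bigO0_coef0 _ q); apply: bigO0_ext E => x; ring.
by rewrite subr_eq0 => /eqP ->; rewrite divfK// pnatr_eq0 -lt0n fact_gt0.
Qed.

Lemma iter_pd_cst0 n (s : seq 'I_n) : iter_pd s (fun=> 0 : R) = (fun=> 0).
Proof.
elim: s => [//|i s IH].
rewrite -[iter_pd (i :: s) _]/(pd i (iter_pd s _)) IH.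
by apply/funext => v; exact: derive_cst.
Qed.

Lemma iter_pd_tangential f s y x :
  iter_pd s (fun z => f (pack x z)) y = iter_pd (map (@rshift 1 d) s) f (pack x y).
Proof.
have := @iter_pd_slice R d (1 + d) (pack x) (@rshift 1 d) _ f s.
by move=> /(_ (fun h i v => pack_line_y x h i v))/(congr1 (fun F => F y)).
Qed.

(** Normal and tangential derivatives commute, so a normal coefficient that
    vanishes near y0 still does after differentiation along the boundary. *)
Lemma xcoef_tangential f U y0 l s : open U -> open_smooth U f -> U (pack 0 y0) ->
  (\forall y \near y0, xcoef f l y = 0) ->
  xcoef (iter_pd (map (@rshift 1 d) s) f) l y0 = 0.
Proof.
move=> oU sf Uy fl; rewrite /xcoef (iter_pd_comm _ _ oU sf Uy) -iter_pd_tangential.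
have /(near_eq_iter_pd s) : \forall y \near y0,
    iter_pd (nseq l (ox d)) f (pack 0 y) = (fun=> 0) y by [].
by move=> /nbhs_singleton ->; rewrite iter_pd_cst0.
Qed.

Lemma xcoef_pd f l y : xcoef (pd (ox d) f) l y = xcoef f l.+1 y.
Proof.
rewrite /xcoef -[pd _ f]/(iter_pd [:: ox d] f) -iter_pd_cat.
by rewrite -[[:: _]]/(nseq 1 _) -nseqD addn1.
Qed.

End Expansion.

Section Jets.
Variables (R : realType) (d : nat) (u : 'rV[R]_(1 + d) -> R) (U : set 'rV[R]_(1 + d)).
Variables (y0 : 'rV[R]_d) (q : nat).
Hypotheses (oU : open U) (su : open_smooth U u) (Uy0 : U (pack 0 y0)).
Hypothesis q_gt0 : (0 < q)%N.
Hypothesis ub : \forall y \near y0, bigO0 q (fun x => u (pack x y) - u (pack 0 y)).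

Lemma near_slice : \forall y \near y0, U (pack 0 y).
Proof.
by apply: (near_open (U := pack 0 @^-1` U)) => //; apply: open_comp => // y _; exact: pack_continuous.
Qed.

Lemma near_xcoef l : (0 < l < q)%N -> \forall y \near y0, xcoef u l y = 0.
Proof.
move=> /andP[l0 lq]; apply: filterS2 near_slice ub => y Uy uy.
by rewrite (xcoef_vanish oU su Uy uy lq) gtn_eqF// mulr0.
Qed.

Lemma tangential_coef s l : (0 < l < q)%N ->
  xcoef (iter_pd (map (@rshift 1 d) s) u) l y0 = 0.
Proof. by move=> /near_xcoef; exact: (xcoef_tangential s oU su Uy0). Qed.

Let a := xcoef u q y0 / (q.-1)`!%:R.

(** For u (x, y) - u (0, y) = O(x^q) near y0, the next lemmas give the orders
    of the derivatives of u at (x, y0): every normal derivative costs one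
    power of x, the tangential ones cost none, because they preserve the
    vanishing of the lower normal coefficients. *)
Lemma jet_value :
  bigO0 q.+1 (fun x => u (pack x y0) - u (pack 0 y0) - a * (x ^+ q / q%:R)).
Proof.
have := @expand R d u U y0 q (u (pack 0 y0)) oU su Uy0.
rewrite q_gt0 mulr1 => H; have {}H := H _.
have /H : forall l, (l < q)%N -> xcoef u l y0 = u (pack 0 y0) * (l == 0)%:R.
  case=> [|l] lq; first by rewrite [RHS]mulr1.
  by rewrite [RHS]mulr0; exact: (tangential_coef [::]).
apply: bigO0_ext => x; congr (_ - _); rewrite /a.
case: q q_gt0 => // p _ /=; rewrite factS natrM invfM; ring.
Qed.

Lemma jet_dx : bigO0 q.+1 (fun x => x * pd (ox d) u (pack x y0) - a * x ^+ q).
Proof.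
have sf := open_smooth_pd (ox d) su.
have := @expand R d _ U y0 q.-1 0 oU sf Uy0.
rewrite mul0r => H; have {}H := H _.
have /H E : forall l, (l < q.-1)%N -> xcoef (pd (ox d) u) l y0 = 0 * (l == 0)%:R.
  move=> l lq; rewrite mul0r xcoef_pd; apply: (tangential_coef [::]).
  by rewrite /= -(prednK q_gt0).
have := bigO0M (bigO0_id R) E; rewrite prednK// add1n.
apply: bigO0_ext => x; rewrite xcoef_pd prednK// -/a.
by rewrite -[in RHS](prednK q_gt0) exprS; ring.
Qed.

Lemma jet_dxdx : bigO0 q.+1 (fun x => x ^+ 2 * pd (ox d) (pd (ox d) u) (pack x y0)
   - a * (q%:R - 1) * x ^+ q).
Proof.
have sf := open_smooth_pd (ox d) (open_smooth_pd (ox d) su).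
have [q1|q1] := leqP q 1%N.
  have -> : q = 1%N by apply/eqP; rewrite eqn_leq q1.
  have H : bigO0 0 (fun x => pd (ox d) (pd (ox d) u) (pack x y0)).
    by apply: expand_le0 oU sf Uy0 _.
  have := bigO0M (bigO0_X R 2) H; rewrite addn0; apply: bigO0_ext => x.
  by rewrite subrr mulr0 mul0r subr0.
have := @expand R d _ U y0 q.-2 0 oU sf Uy0.
rewrite mul0r => H; have {}H := H _.
have /H E : forall l, (l < q.-2)%N ->
    xcoef (pd (ox d) (pd (ox d) u)) l y0 = 0 * (l == 0)%:R.
  move=> l lq; rewrite mul0r !xcoef_pd; apply: (tangential_coef [::]).
  by move: lq; case: (q) => [|[|p]].
have qE : q.-2.+2 = q by case: (q) q1 => [|[|p]].
have qE' : (2 + q.-2.+1)%N = q.+1 by rewrite -[in RHS]qE.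
have {}E := bigO0M (bigO0_X R 2) E; rewrite qE' in E.
apply: bigO0_ext E => x; rewrite !xcoef_pd qE /a.
move: (xcoef u q y0) => c; case: (q) qE {qE'} => [|[|p]] // _ /=.
have p1 : p.+1%:R != 0 :> R by rewrite pnatr_eq0.
have pf : p`!%:R != 0 :> R by rewrite pnatr_eq0 -lt0n fact_gt0.
rewrite !exprS factS natrM -[p.+2]addn1 natrD; field.
by rewrite pf /=; move: p1; rewrite -addn1 natrD.
Qed.

Lemma jet_tangential s : bigO0 q (fun x =>
  iter_pd (map (@rshift 1 d) s) u (pack x y0) - iter_pd s (fun y => u (pack 0 y)) y0).
Proof.
rewrite (iter_pd_tangential u); apply: expand_le oU (open_smooth_iter _ su) Uy0 _ q_gt0.
exact: tangential_coef.
Qed.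

Lemma jet_mixed A : bigO0 q (fun x => x * pd (ox d) (pd (rshift 1 A) u) (pack x y0)) /\
  bigO0 q (fun x => x * pd (rshift 1 A) (pd (ox d) u) (pack x y0)).
Proof.
have H : bigO0 q (fun x => x * pd (ox d) (pd (rshift 1 A) u) (pack x y0)).
  have : bigO0 q.-1 (fun x => pd (ox d) (pd (rshift 1 A) u) (pack x y0)).
    apply: expand_le0 oU _ Uy0 _; first exact/open_smooth_pd/open_smooth_pd.
    move=> l lq; rewrite xcoef_pd; apply: (tangential_coef [:: A]).
    by rewrite /= -(prednK q_gt0).
  by move=> /(bigO0M (bigO0_id R)); rewrite add1n prednK.
split; first exact: H.
apply: bigO0_near H.
have [r r0 Ur] := box_nbhs oU Uy0.
near=> x.
have xr : `|x - 0| < r.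
  rewrite subr0 ger0_norm; first by near: x; apply: nbhs_right_lt.
  by near: x; apply: nbhs_right_ge.
have Ux : U (pack x y0) by apply: Ur; rewrite ?subrr ?normr0.
by rewrite (pd_comm (ox d) (rshift 1 A) oU su Ux).
Unshelve. all: by end_near. Qed.

End Jets.

(** * Lipschitz bounds and time derivatives on [0, T) *)

Section Lipschitz.
Variable R : realType.

Lemma lip_line n (f : 'rV[R]_n -> R) z e (w C : R) :
  (forall s : R, `|s| <= `|w| -> derivable f (z + s *: e) e /\ `|'D_e f (z + s *: e)| <= C) ->
  `|f (z + w *: e) - f z| <= C * `|w|.
Proof.
move=> H.
have key (a b : R) : a <= b -> `|a| <= `|w| -> `|b| <= `|w| ->
    `|f (z + b *: e) - f (z + a *: e)| <= C * `|b - a|.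
  move=> ab aw bw.
  have sw (s : R) : s \in `[a, b]%R -> `|s| <= `|w|.
    rewrite in_itv /= => /andP[as_ sb]; rewrite ler_norml.
    move: aw bw; rewrite !ler_norml => /andP[aw _] /andP[_ bw].
    by rewrite (le_trans aw as_) (le_trans sb bw).
  pose g (s : R) := f (z + s *: e); pose dg (s : R) := 'D_e f (z + s *: e).
  have gd (s : R) : s \in `[a, b]%R -> is_derive s 1 g (dg s).
    by move=> /sw/H[fd _]; apply: is_derive_line; exact: derivableP.
  have gc : {within `[a, b], continuous g}.
    by apply: derivable_within_continuous => x xh; have [] := gd x xh.
  have gd' (s : R) : s \in `]a, b[%R -> is_derive s 1 g (dg s).
    by move=> sh; apply: gd; apply: subset_itv_oo_cc sh.
  have [s /sw/H[_ dC] Es] := MVT_segment ab gd' gc.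
  by rewrite -/(g b) -/(g a) Es normrM ler_wpM2r.
have z0 : z = z + (0 : R) *: e by rewrite scale0r addr0.
case: (leP 0 w) => w0.
  by have := key 0 w w0; rewrite -z0 normr0 subr0; apply.
have := key w 0 (ltW w0); rewrite -z0 normr0 sub0r normrN distrC; apply => //.
Qed.

(** Moving from v to w one coordinate at a time reduces the estimate to lines. *)
Lemma locally_lipschitz n (f : 'rV[R]_n -> R) (U : set 'rV[R]_n) v0 :
  open U -> open_smooth U f -> U v0 ->
  exists C r : R, 0 < r /\ forall v w, `|v - v0| < r -> `|w - v0| < r ->
    `|f w - f v| <= C * `|w - v|.
Proof.
move=> oU sf Uv0.
pose C := \sum_(i < n) `|pd i f v0| + 1.
have Ci i : `|pd i f v0| < C.
  rewrite /C (bigD1 i)//= ltr_pwDr// lerDl sumr_ge0//.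
have nU : nbhs v0 U by exact: open_nbhs_nbhs.
have nC i : nbhs v0 [set v | `|pd i f v| < C].
  have ci : {for v0, continuous (pd i f)} by exact: (sf [:: i] v0 Uv0).2.
  have cn : {for v0, continuous (fun v => `|pd i f v|)}.
    by apply: continuous_comp ci _; exact: norm_continuous.
  apply: (cn [set x | x < C]); apply: open_nbhs_nbhs; split; last exact: Ci.
  exact: open_lt.
have nUC : nbhs v0 (U `&` [set v | forall i, `|pd i f v| < C]).
  have FF : Filter (nbhs v0) by typeclasses eauto.
  apply: filterI => //.
  exact: (@filter_forall _ _ (fun i v => `|pd i f v| < C) (nbhs v0) FF nC).
have /nbhs_ballP[r /= r0 Hr] := nUC.
exists (C * n%:R), (r / 3); split=> [|v w vr wr]; first by rewrite divr_gt0.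
have r3 : 0 < r / 3 by rewrite divr_gt0.
pose mix m : 'rV[R]_n := \row_j (if (j < m)%N then w 0 j else v 0 j).
have mixS m (mn : (m < n)%N) : mix m.+1 = mix m + (w 0 (Ordinal mn) - v 0 (Ordinal mn)) *: delta_mx 0 (Ordinal mn).
  apply/rowP => j; rewrite !mxE /= ltnS leq_eqVlt -val_eqE /=.
  case: (ltngtP j m) => jm /=; rewrite ?mulr0 ?addr0//.
  have -> : j = Ordinal mn by exact: val_inj.
  by rewrite mulr1 addrC subrK.
have C0 : 0 <= C by rewrite addr_ge0// sumr_ge0.
have main m : (m <= n)%N -> `|f (mix m) - f v| <= C * m%:R * `|w - v|.
  elim: m => [_|m IH mn].
    have -> : mix 0%N = v by apply/rowP => j; rewrite !mxE.
    by rewrite subrr normr0 mulr0 mul0r.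
  rewrite (le_trans (ler_distD (f (mix m)) _ _))//.
  rewrite -natr1 mulrDr mulr1 mulrDl addrC lerD ?IH ?(ltnW mn)//.
  set i := Ordinal mn; set t := w 0 i - v 0 i.
  have tw : `|t| <= `|w - v|.
    by have := mx_norm_ge_entry (w - v) 0 i; rewrite !mxE.
  apply: (@le_trans _ _ (C * `|t|)); last by rewrite ler_wpM2l.
  rewrite mixS; apply: lip_line => s st.
  suff [Us /(_ i)/ltW ?] : U (mix m + s *: delta_mx 0 i) /\
      (forall i0, `|pd i0 f (mix m + s *: delta_mx 0 i)| < C).
    by split=> //; exact: open_smooth_derivable sf Us.
  apply: Hr; rewrite -ball_normE /= distrC; apply/mx_norm_ltP => // i0 j.
  rewrite ord1 !mxE /=.
  move: (vr) (wr); rewrite !mx_norm_ltP// => /(_ 0 j) + /(_ 0 j).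
  rewrite !mxE => vj wj.
  have ts : `|s| < r / 3 + r / 3.
    rewrite (le_lt_trans st)// (le_lt_trans tw)//.
    rewrite -(subrKA v0) (le_lt_trans (ler_normD _ _))// ltrD//.
    by rewrite distrC.
  have r3E : r = r / 3 + r / 3 + r / 3 by field.
  rewrite -val_eqE /= [X in _ < X]r3E; case: (ltngtP j m) => jm.
  - by rewrite mulr0 addr0 (lt_trans wj)// -addrA ltrDl addr_gt0.
  - by rewrite mulr0 addr0 (lt_trans vj)// -addrA ltrDl addr_gt0.
  rewrite mulr1 addrAC (le_lt_trans (ler_normD _ _))//.
  by rewrite [ltLHS]addrC ltrD.
by have := main n (leqnn n); rewrite (_ : mix n = w)//; apply/rowP => j; rewrite !mxE ltn_ord.
Qed.

End Lipschitz.

Section Time.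
Variable R : realType.

Lemma derive_within (D : set R) (f : R -> R) (t df : R) : is_derive t 1 f df ->
  (fun s => (f s - f t) / (s - t)) @ within D (t^') --> df.
Proof.
move=> [fd <-]; move: fd => /cvg_ex[l fl].
have -> : 'D_1 f t = l by exact: cvg_lim fl.
apply: cvg_within_filter.
apply/cvgrPdist_lt => e e0.
move: fl => /cvgrPdist_lt/(_ e e0)/nbhs_ballP[r /= r0 Hr].
apply/nbhs_ballP; exists r => // s; rewrite /ball /= => str st.
have := Hr (s - t); rewrite /ball /= sub0r normrN distrC => /(_ str).
rewrite subr_eq0 => /(_ st); rewrite [_ *: 1]mulr1 subrK.
by rewrite /GRing.scale /= [_^-1 * _]mulrC.
Qed.

(** Every time of [0, T) is a limit of other ones, so that time derivatives
    are unique. *)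
Lemma within_times_proper (T : \bar R) t : times T t ->
  ProperFilter (within (times T) (t^')).
Proof.
move=> [t0 tT].
have [e e0 eT] : exists2 e : R, 0 < e & ((t + e)%:E < T)%E.
  case: T tT => [x| |] //=; last by exists 1; rewrite // ltry.
  rewrite lte_fin => tx; exists ((x - t) / 2); first by rewrite divr_gt0// subr_gt0.
  by rewrite lte_fin; lra.
apply: Build_ProperFilter_ex => A.
rewrite /within /= => /nbhs_ballP[r /= r0 Hr].
pose s := t + Num.min e (r / 2).
have m0 : 0 < Num.min e (r / 2) by rewrite lt_min e0 divr_gt0.
exists s; apply: Hr.
- rewrite /ball /= /s opprD addNKr normrN gtr0_norm//.
  by rewrite gt_min; apply/orP; right; rewrite ltr_pdivrMr// mulr_natr mulr2n ltrDl.
- by rewrite /s -subr_eq0 [t + _]addrC addrK gt_eqF.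
- split; first by rewrite addr_ge0// ltW.
  apply: le_lt_trans eT; rewrite lee_fin lerD2l ge_min lexx//.
Qed.

(** The limit is taken within [0, T), hence it is one-sided at t = 0. *)
Definition has_dt (T : \bar R) (phi : R -> R) (t l : R) : Prop :=
  (fun s => (phi s - phi t) / (s - t)) @ within (times T) (t^') --> l.

Lemma has_dt_near T (phi psi : R -> R) t l :
  times T t -> (\forall s \near t, times T s -> phi s = psi s) ->
  has_dt T phi t l -> has_dt T psi t l.
Proof.
move=> Tt pp; rewrite /has_dt.
have -> : phi t = psi t by exact: (nbhs_singleton pp).
move=> H; apply: cvg_trans H; apply: near_eq_cvg.
rewrite near_withinE; apply: filterS (nbhs_dnbhs pp) => s H Ts.
by rewrite H.
Qed.

Lemma has_dt_unique T phi t l l' : times T t ->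
  has_dt T phi t l -> has_dt T phi t l' -> l = l'.
Proof.
move=> Tt; have P := within_times_proper Tt.
exact: cvg_unique.
Qed.

Lemma has_dtD T phi psi t l l' : times T t -> has_dt T phi t l -> has_dt T psi t l' ->
  has_dt T (fun s => phi s + psi s) t (l + l').
Proof.
move=> Tt H H'; have P := within_times_proper Tt.
rewrite /has_dt (_ : (fun s => _) =
  (fun s => (phi s - phi t) / (s - t) + (psi s - psi t) / (s - t))).
  exact: cvgD H H'.
by apply/funext => s; rewrite -mulrDl; congr (_ / _); ring.
Qed.

Lemma has_dtZ T (c : R) phi t l : times T t -> has_dt T phi t l ->
  has_dt T (fun s => c * phi s) t (c * l).
Proof.
move=> Tt H; have P := within_times_proper Tt.
rewrite /has_dt (_ : (fun s => _) = (fun s => c * ((phi s - phi t) / (s - t)))).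
  exact: cvgMl_tmp.
by apply/funext => s; rewrite -mulrBr mulrA.
Qed.

Lemma has_dt_cst T (c : R) t : times T t -> has_dt T (fun=> c) t 0.
Proof.
move=> Tt; have P := within_times_proper Tt; rewrite /has_dt.
rewrite (_ : (fun s => _) = (fun=> 0)); first exact: cvg_cst.
by apply/funext => s; rewrite subrr mul0r.
Qed.

Lemma has_dt_sum T (I : Type) (r : seq I) (phi : I -> R -> R) t (l : I -> R) :
  times T t -> (forall i, has_dt T (phi i) t (l i)) ->
  has_dt T (fun s => \sum_(i <- r) phi i s) t (\sum_(i <- r) l i).
Proof.
move=> Tt H; elim: r => [|i r IH].
  rewrite big_nil (_ : (fun s => _) = (fun=> 0)); first exact: has_dt_cst.
  by apply/funext => s; rewrite big_nil.
rewrite big_cons (_ : (fun s => _) = (fun s => phi i s + \sum_(j <- r) phi j s)).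
  exact: has_dtD.
by apply/funext => s; rewrite big_cons.
Qed.

Lemma times_open (T : \bar R) (t : R) : times T t -> 0 < t -> \forall s \near t, times T s.
Proof.
move=> [_ tT] t0.
have sT : \forall s \near t, (s%:E < T)%E.
  case: T tT => [x| |] // tx.
    have tx' : t < x by rewrite -lte_fin.
    near=> s; rewrite lte_fin; near: s; exact: lt_nbhsl.
  by near=> s; rewrite ltry.
have s0 : \forall s \near t, 0 < s by exact: lt_nbhsr.
near=> s; split; last by near: s; exact: sT.
by apply: ltW; near: s; exact: s0.
Unshelve. all: by end_near. Qed.

Lemma has_dt_is_derive T phi t l : times T t -> 0 < t -> has_dt T phi t l ->
  is_derive t 1 phi l.
Proof.
move=> Tt t0 /cvgrPdist_lt H.
suff E : (fun h : R => h^-1 *: ((phi \o shift t) (h *: 1) - phi t)) @ 0^' --> l.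
  by apply: DeriveDef; [apply/cvg_ex; exists l|exact: cvg_lim E].
apply/cvgrPdist_lt => e e0; have := H e e0.
rewrite near_withinE => /nbhs_ballP[r /= r0 Hr].
have /nbhs_ballP[r' /= r'0 Hr'] := times_open Tt t0.
apply/nbhs_ballP; exists (Num.min r r'); first by rewrite /= lt_min r0.
move=> h; rewrite /ball /= sub0r normrN lt_min => /andP[hr hr'] h0.
rewrite [h *: 1]mulr1 /GRing.scale /= mulrC.
have E : h + t - t = h by rewrite addrK.
have := Hr (h + t); rewrite /ball /= opprD addrCA subrr addr0 normrN E.
apply => //; first by rewrite -subr_eq0 E.
by apply: Hr'; rewrite /ball /= opprD addrCA subrr addr0 normrN.
Qed.

Lemma has_dt_continuous0 T phi l : times T 0 -> has_dt T phi 0 l ->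
  phi x @[x --> 0^'+] --> phi 0.
Proof.
move=> T0 H.
have TT : \forall x \near 0^'+, times T x.
  have [e e0 eT] : exists2 e : R, 0 < e & (e%:E <= T)%E.
    case: T T0 {H} => [x| |] [_] //=; last by exists 1; rewrite ?leey.
    by rewrite lte_fin => x0; exists x.
  near=> x; split; first by near: x; exact: nbhs_right_ge.
  apply: lt_le_trans eT; rewrite lte_fin; near: x; exact: nbhs_right_lt.
have sub : (0 : R)^'+ --> within (times T) ((0 : R)^').
  move=> A; rewrite /within /= => HA; move: HA TT.
  move=> /nbhs_ballP[r /= r0 Hr] /nbhs_ballP[r' /= r'0 Hr'].
  apply/nbhs_ballP; exists (Num.min r r'); first by rewrite /= lt_min r0.
  move=> x; rewrite /ball /= lt_min => /andP[xr xr'] x0.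
  by apply: Hr => //; [rewrite gt_eqF|apply: Hr'].
have H' : (phi x - phi 0) / (x - 0) @[x --> 0^'+] --> l.
  exact: cvg_trans (cvg_app _ sub) H.
have xx : (x : R) @[x --> 0^'+] --> (0 : R).
  by apply: cvg_at_right_filter; exact: cvg_id.
have := cvgD (cvgM H' xx) (cvg_cst (phi 0)); rewrite mulr0 add0r => H2.
suff E : phi = (fun x => (phi x - phi 0) / (x - 0) * x + phi 0) by rewrite {1}E; exact: H2.
apply/funext => x; have [->|x0] := eqVneq x 0; first by rewrite mulr0 add0r.
by rewrite subr0 divfK ?subrK.
Unshelve. all: by end_near. Qed.

(** The function expR (- c * t) * phi t has zero derivative for t > 0 and is
    continuous up to t = 0. *)
Lemma ode_linear T (c : R) phi : (0 < T)%E ->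
  (forall t, times T t -> has_dt T phi t (c * phi t)) ->
  forall t, times T t -> phi t = expR (c * t) * phi 0.
Proof.
move=> T_gt0 H t Tt; have [t0 tT] := Tt.
have T0 : times T 0 by split.
have [->|tn0] := eqVneq t 0; first by rewrite mulr0 expR0 mul1r.
have {tn0}t0 : 0 < t by rewrite lt_neqAle eq_sym tn0.
pose psi (s : R) := expR (- c * s) * phi s.
have ed (s : R) : is_derive s 1 (fun s : R => expR (- c * s)) (- c * expR (- c * s)).
  have d1 : is_derive s 1 (fun s : R => - c * s) (- c).
    have := is_deriveZ (- c) (is_derive_id s (1 : R)).
    by rewrite [_ *: 1]mulr1.
  have := is_derive1_comp (is_derive_expR (- c * s)) d1.
  by rewrite mulrC.
have pd s : s \in `]0, t[%R -> is_derive s 1 psi 0.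
  rewrite in_itv /= => /andP[s0 st].
  have Ts : times T s by split; [exact: ltW|exact: lt_trans tT].
  apply: is_derive_eq (is_deriveM (ed s) (has_dt_is_derive Ts s0 (H s Ts))) _.
  by rewrite /GRing.scale /=; ring.
have pc : {within `[0, t], continuous psi}.
  apply/continuous_within_itvP => //.
  have cphi s : 0 < s -> times T s -> {for s, continuous psi}.
    move=> s0 Ts; apply: differentiable_continuous; apply/derivable1_diffP.
    have [] := is_deriveM (ed s) (has_dt_is_derive Ts s0 (H s Ts)); exact.
  have ce : continuous (fun s : R => expR (- c * s)).
    move=> s; apply: differentiable_continuous; apply/derivable1_diffP.
    by have [] := ed s.
  split.
  - move=> s; rewrite in_itv /= => /andP[s0 st]; apply: cphi => //.
    by split; [exact: ltW|exact: lt_trans tT].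
  - apply: cvgM; last exact: has_dt_continuous0 T0 (H 0 T0).
    by apply: cvg_at_right_filter; exact: ce.
  - by apply: cvg_at_left_filter; exact: cphi.
have [s _] := MVT_segment (ltW t0) pd pc.
rewrite mul0r /psi mulr0 expR0 mul1r => /eqP; rewrite subr_eq0 => /eqP <-.
by rewrite mulrA -expRD mulNr subrr expR0 mul1r.
Qed.

End Time.

Section TimeCoefficient.
Variables (R : realType) (d : nat).
Implicit Types (F : 'rV[R]_(1 + (1 + d)) -> R).

Notation ot := (lshift (1 + d) (ord0 : 'I_1)).

Lemma slice_smooth F U t : open_smooth U F ->
  open_smooth (pack t @^-1` U) (fun v => F (pack t v)).
Proof.
move=> sF; apply: (@open_smooth_slice R (1 + d) (1 + (1 + d)) (pack t) (@rshift 1 (1 + d))) => //.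
  by move=> h i v; exact: pack_line_y.
exact: pack_continuous.
Qed.

Lemma slice_open (U : set 'rV[R]_(1 + (1 + d))) t : open U -> open (pack t @^-1` U).
Proof. by move=> oU; apply: open_comp => // v _; exact: pack_continuous. Qed.

(** The time derivative commutes with the normal derivatives at x = 0, so the
    leading coefficient of dF/dt is the time derivative of that of F. *)
Lemma time_coef F U (T : \bar R) t y q (b : R) (a : R -> R) l :
  open U -> open_smooth U F -> times T t -> U (pack t (pack 0 y)) -> (0 < q)%N ->
  (forall s, times T s -> U (pack s (pack 0 y)) ->
    bigO0 q.+1 (fun x => F (pack s (pack x y)) - b - a s * x ^+ q)) ->
  bigO0 q.+1 (fun x => pd ot F (pack t (pack x y)) - l * x ^+ q) ->
  has_dt T a t l.
Proof.
move=> oU sF Tt Ut q0 Fa dFl.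
pose e : 'I_(1 + (1 + d)) := rshift 1 (ox d).
have qf : q`!%:R != 0 :> R by rewrite pnatr_eq0 -lt0n fact_gt0.
have xE G s : xcoef (fun v => G (pack s v)) q y = iter_pd (nseq q e) G (pack s (pack 0 y)).
  by rewrite /xcoef iter_pd_tangential map_nseq.
pose c s := iter_pd (nseq q e) F (pack s (pack 0 y)).
have cE s : times T s -> U (pack s (pack 0 y)) -> c s = a s * q`!%:R.
  move=> Ts Us; rewrite /c -(xE F).
  exact: (xcoef_leading (slice_open (t := s) oU) (slice_smooth (t := s) sF) Us q0 (Fa s Ts Us)).
have sc : open_smooth U (iter_pd (nseq q e) F) by exact: open_smooth_iter.
have cd : is_derive t 1 c (pd ot (iter_pd (nseq q e) F) (pack t (pack 0 y))).
  by apply: is_derive_pack; exact: open_smooth_derivable sc Ut.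
have lE : pd ot (iter_pd (nseq q e) F) (pack t (pack 0 y)) = l * q`!%:R.
  rewrite (pd_iter_comm _ _ oU sF Ut) -(xE (pd ot F)).
  apply: (xcoef_leading (slice_open (t := t) oU) (slice_smooth (t := t) (open_smooth_pd ot sF)) (b := 0)) => //.
  by apply: bigO0_ext dFl => x; rewrite subr0.
have H : has_dt T c t (l * q`!%:R) by rewrite -lE; exact: derive_within.
have {}H := has_dtZ (c := q`!%:R^-1) Tt H.
have E : q`!%:R^-1 * (l * q`!%:R) = l by field.
rewrite E in H; move: H.
apply: has_dt_near => //.
have [r r0 Ur] := box_nbhs oU Ut.
apply/nbhs_ballP; exists r => // s; rewrite /ball /= distrC => sr Ts.
rewrite cE//; first by field.
by apply: Ur; rewrite // subrr normr0.
Qed.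

End TimeCoefficient.

(** * The Ricci tensor as a function of the 2-jet of the metric *)

Section JetRicci.
Variables (R : realType) (n : nat).
Implicit Types (W : 'I_n -> 'I_n -> R) (D : 'I_n -> 'I_n -> 'I_n -> R).
Implicit Types (H : 'I_n -> 'I_n -> 'I_n -> 'I_n -> R).

(** The arguments W, D, H stand for the inverse metric and the first and
    second derivatives of the metric at one point, D i j l being d_i g_jl and
    H a i j l being d_a d_i g_jl. In these terms jetGam, jetdGam a and jetRic
    are the Christoffel symbols, their derivatives in the direction a, and the
    Ricci tensor: curvature becomes algebra. *)
Definition jetGam W D (k i j : 'I_n) : R :=
  2^-1 * \sum_(l < n) W k l * (D i j l + D j i l - D l i j).

Definition jetdGam W D H (a k i j : 'I_n) : R :=
  - (\sum_(p < n) (\sum_(m < n) W k m * D a m p) * jetGam W D p i j)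
  + 2^-1 * \sum_(l < n) W k l * (H a i j l + H a j i l - H a l i j).

Definition jetRic W D H (j k : 'I_n) : R :=
  \sum_(i < n) (jetdGam W D H i i j k - jetdGam W D H j i i k
    + \sum_(p < n) (jetGam W D i i p * jetGam W D p j k
                    - jetGam W D i j p * jetGam W D p i k)).

Lemma jetGam_scale (a b : R) W D k i j :
  jetGam (fun k l => a * W k l) (fun i j l => b * D i j l) k i j
  = a * b * jetGam W D k i j.
Proof.
rewrite /jetGam mulrCA; congr (_ * _); rewrite mulr_sumr.
by apply: eq_bigr => l _; ring.
Qed.

Lemma jetdGam_scale (a b : R) W D H c k i j :
  jetdGam (fun k l => a * W k l) (fun i j l => b * D i j l)
    (fun c i j l => a * b ^+ 2 * H c i j l) c k i j
  = (a * b) ^+ 2 * jetdGam W D H c k i j.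
Proof.
rewrite /jetdGam.
set S1 := \sum_(p < n) _; set S2 := \sum_(l < n) _.
set S1' := \sum_(p < n) _; set S2' := \sum_(l < n) _.
have -> : S1 = (a * b) ^+ 2 * S1'.
  rewrite mulr_sumr; apply: eq_bigr => p _; rewrite jetGam_scale.
  rewrite (_ : \sum_(m < n) _ = a * b * \sum_(m < n) W k m * D c m p); first by ring.
  by rewrite mulr_sumr; apply: eq_bigr => m _; ring.
have -> : S2 = (a * b) ^+ 2 * S2'.
  by rewrite mulr_sumr; apply: eq_bigr => l _; ring.
ring.
Qed.

(** For g = rho^-2 u the natural weights of the inverse metric and of the
    first and second derivatives are rho^2, rho^-3 and rho^-4. Scaling them
    away leaves quantities that are regular at x = 0. *)
Lemma jetRic_scale (a b : R) W D H j k :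
  jetRic (fun k l => a * W k l) (fun i j l => b * D i j l)
    (fun c i j l => a * b ^+ 2 * H c i j l) j k
  = (a * b) ^+ 2 * jetRic W D H j k.
Proof.
rewrite /jetRic mulr_sumr; apply: eq_bigr => i _.
rewrite !jetdGam_scale.
set S := \sum_(p < n) _; set S' := \sum_(p < n) _.
have -> : S = (a * b) ^+ 2 * S'; last by ring.
by rewrite mulr_sumr; apply: eq_bigr => p _; rewrite !jetGam_scale; ring.
Qed.

Lemma eq_jetRic W W' D D' H H' j k : W =2 W' -> (forall i, D i =2 D' i) ->
  (forall a i, H a i =2 H' a i) -> jetRic W D H j k = jetRic W' D' H' j k.
Proof.
move=> WW DD HH.
have -> : W = W' by apply/funext => x; apply/funext => y.
have -> : D = D' by apply/funext => x; apply/funext => y; apply/funext => z; exact: DD.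
have -> // : H = H'.
by do 3 (apply/funext => ?); apply/funext => ?; exact: HH.
Qed.

End JetRicci.

Section DeriveMatrix.
Variables (R : realType) (V : normedModType R).
Implicit Types (v e : V).

Lemma derivable_bigsum (I : Type) (r : seq I) (P : pred I) (F : I -> V -> R) v e :
  (forall i, derivable (F i) v e) ->
  derivable (fun w => \sum_(i <- r | P i) F i w) v e.
Proof.
move=> H; elim: r => [|i r IH].
  rewrite (_ : (fun w => _) = cst 0); first exact: derivable_cst.
  by apply/funext => w; rewrite big_nil.
rewrite (_ : (fun w => _) = if P i then F i + (fun w => \sum_(j <- r | P j) F j w)
  else (fun w => \sum_(j <- r | P j) F j w)).
  by case: ifP => _; [apply: derivableD; [exact: H|exact: IH]|exact: IH].
by apply/funext => w; rewrite big_cons; case: ifP.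
Qed.

Lemma derive_bigsum (I : Type) (r : seq I) (F : I -> V -> R) v e :
  (forall i, derivable (F i) v e) ->
  'D_e (fun w => \sum_(i <- r) F i w) v = \sum_(i <- r) 'D_e (F i) v.
Proof.
move=> H; elim: r => [|i r IH].
  rewrite big_nil (_ : (fun w => _) = cst 0); first exact: derive_cst.
  by apply/funext => w; rewrite big_nil.
rewrite big_cons -IH -deriveD//; last exact: derivable_bigsum.
by congr ('D_e _ v); apply/funext => w; rewrite big_cons.
Qed.

Lemma derivable_bigprod (I : Type) (r : seq I) (F : I -> V -> R) v e :
  (forall i, derivable (F i) v e) ->
  derivable (fun w => \prod_(i <- r) F i w) v e.
Proof.
move=> H; elim: r => [|i r IH].
  rewrite (_ : (fun w => _) = cst 1); first exact: derivable_cst.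
  by apply/funext => w; rewrite big_nil.
rewrite (_ : (fun w => _) = F i * (fun w => \prod_(j <- r) F j w)).
  by apply: derivableM; [exact: H|exact: IH].
by apply/funext => w; rewrite big_cons.
Qed.

Lemma derivable_det n (G : V -> 'M[R]_n) v e :
  (forall i j, derivable (fun w => G w i j) v e) ->
  derivable (fun w => \det (G w)) v e.
Proof.
move=> H; apply: derivable_bigsum => s.
rewrite (_ : (fun w => _) = (-1) ^+ s *: (fun w => \prod_i G w i (s i)))//.
by apply: derivableZ; exact: derivable_bigprod.
Qed.

Lemma derivable_invmx n (G : V -> 'M[R]_n) v e :
  (forall i j, derivable (fun w => G w i j) v e) ->
  (\forall w \near v, G w \in unitmx) ->
  forall k l, derivable (fun w => invmx (G w) k l) v e.
Proof.
move=> H Gu k l.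
have near_adj : \forall w \near v, (\det (G w))^-1 * cofactor (G w) l k = invmx (G w) k l.
  by apply: filterS Gu => w Gw; rewrite /invmx Gw !mxE.
apply: (near_eq_derivable near_adj).
apply: derivableM; first apply: derivableV.
- by have := nbhs_singleton Gu; rewrite unitmxE unitfE.
- exact: derivable_det.
rewrite (_ : (fun w => _) = (-1) ^+ (l + k) *: (fun w => \det (row' l (col' k (G w)))))//.
apply: derivableZ; apply: derivable_det => i j.
rewrite (_ : (fun w => _) = (fun w => G w (lift l i) (lift k j)))//.
by apply/funext => w; rewrite !mxE.
Qed.

Lemma derive_mulfun (f g : V -> R) v e : derivable f v e -> derivable g v e ->
  'D_e (fun w => f w * g w) v = 'D_e f v * g v + f v * 'D_e g v.
Proof.
move=> fd gd; have := deriveM fd gd.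
by rewrite /GRing.scale /= [g v * _]mulrC addrC.
Qed.

Lemma derivable_mulfun (f g : V -> R) v e : derivable f v e -> derivable g v e ->
  derivable (fun w => f w * g w) v e.
Proof. exact: derivableM. Qed.

(** Differentiate W G = 1. *)
Lemma derive_invmx n (G : V -> 'M[R]_n) v e :
  (forall i j, derivable (fun w => G w i j) v e) ->
  (\forall w \near v, G w \in unitmx) ->
  forall k l, 'D_e (fun w => invmx (G w) k l) v =
    - \sum_(m < n) (\sum_(j < n) invmx (G v) k j * 'D_e (fun w => G w j m) v) * invmx (G v) m l.
Proof.
move=> H Gu k l; have Wd := derivable_invmx H Gu.
pose W' := \matrix_(i, j) 'D_e (fun w => invmx (G w) i j) v.
pose D := \matrix_(i, j) 'D_e (fun w => G w i j) v.
have Gv : G v \in unitmx by exact: nbhs_singleton Gu.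
suff E : W' = - (invmx (G v) *m D *m invmx (G v)).
  have := congr1 (fun M : 'M[R]_n => M k l) E; rewrite mxE => ->.
  rewrite !mxE; congr (- _); apply: eq_bigr => m _; rewrite mxE; congr (_ * _).
  by apply: eq_bigr => j _; rewrite mxE.
suff : W' *m G v + invmx (G v) *m D = 0.
  move/eqP; rewrite addr_eq0 => /eqP/(congr1 (mulmx^~ (invmx (G v)))).
  by rewrite mulmxK// mulNmx.
apply/matrixP => i j; rewrite !mxE -big_split /=.
have E0 : 'D_e (fun w => \sum_(p < n) invmx (G w) i p * G w p j) v = 0.
  rewrite (near_eq_derive (g := fun=> ((i == j)%:R : R))) ?derive_cst//.
  apply: filterS Gu => w Gw.
  by have := congr1 (fun M : 'M[R]_n => M i j) (mulVmx Gw); rewrite !mxE.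
rewrite -[RHS]E0 derive_bigsum => [|p]; last exact: derivable_mulfun.
by apply: eq_bigr => p _; rewrite !mxE derive_mulfun.
Qed.

End DeriveMatrix.

Section RicciJet.
Variables (R : realType) (n : nat) (G : 'rV[R]_n -> 'M[R]_n) (U : set 'rV[R]_n).
Hypotheses (oU : open U) (sG : forall i j, open_smooth U (fun w => G w i j)).
Hypothesis Gu : forall w, U w -> G w \in unitmx.

Let W v k l := invmx (G v) k l.
Let D v i j l := pd i (fun w => G w j l) v.
Let H v a i j l := pd a (pd i (fun w => G w j l)) v.

Lemma pd_christoffel v a k i j : U v ->
  derivable (christoffel G k i j) v (delta_mx 0 a) /\
  pd a (christoffel G k i j) v = jetdGam (W v) (D v) (H v) a k i j.
Proof.
move=> Uv.
have Gd b i' j' : derivable (fun w => G w i' j') v (delta_mx 0 b).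
  exact: open_smooth_derivable (sG i' j') Uv.
have Dd b i' j' l' : derivable (fun w => D w i' j' l') v (delta_mx 0 b).
  exact: open_smooth_derivable (open_smooth_pd i' (sG j' l')) Uv.
have nu : \forall w \near v, G w \in unitmx by exact: near_open oU Uv Gu.
have Wd := derivable_invmx (Gd a) nu.
have CE : christoffel G k i j = 2^-1 *: (fun w => \sum_(l < n) W w k l *
     (D w i j l + D w j i l - D w l i j)) by [].
have Cd l : derivable (fun w => D w i j l + D w j i l - D w l i j) v (delta_mx 0 a).
  by apply: derivableB; [apply: derivableD|]; exact: Dd.
have Sd l : derivable (fun w => W w k l * (D w i j l + D w j i l - D w l i j)) v (delta_mx 0 a).
  by apply: derivable_mulfun => //; exact: Wd.
split; first by rewrite CE; apply: derivableZ; exact: derivable_bigsum.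
rewrite CE /pd deriveZ; last exact: derivable_bigsum.
rewrite derive_bigsum// /jetdGam.
rewrite (_ : \sum_(l < n) _ =
   - (\sum_l (\sum_p (\sum_m W v k m * D v a m p) * W v p l) * (D v i j l + D v j i l - D v l i j))
   + \sum_l W v k l * (H v a i j l + H v a j i l - H v a l i j)).
  rewrite /GRing.scale /= mulrDr; congr (_ + _); rewrite mulrN; congr (- _).
  pose U' p := \sum_m W v k m * D v a m p; rewrite -/U'.
  transitivity (\sum_l \sum_p 2^-1 * (U' p * W v p l *
     (D v i j l + D v j i l - D v l i j))).
    by rewrite mulr_sumr; apply: eq_bigr => l _; rewrite mulr_suml mulr_sumr.
  rewrite exchange_big /=; apply: eq_bigr => p _.
  rewrite /jetGam -/(U' p) !mulr_sumr; apply: eq_bigr => l _; ring.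
rewrite -sumrN -big_split /=; apply: eq_bigr => l _.
rewrite derive_mulfun//; last exact: Wd.
rewrite (derive_invmx (Gd a) nu) mulNr; congr (- _ + _).
congr (_ * _).
rewrite -[(fun w => _)]/(((fun w => D w i j l) + (fun w => D w j i l)) - (fun w => D w l i j)).
rewrite deriveB; [|apply: derivableD; exact: Dd|exact: Dd].
by rewrite deriveD; [|exact: Dd|exact: Dd].
Qed.

Lemma ricci_jet v j k : U v -> ricci G v j k = jetRic (W v) (D v) (H v) j k.
Proof.
move=> Uv; rewrite mxE; apply: eq_bigr => i _; rewrite /riemann.
by rewrite (pd_christoffel i i j k Uv).2 (pd_christoffel j i i k Uv).2.
Qed.

End RicciJet.

(** * Linearization of the Ricci tensor at the background *)

Section IndexAlgebra.
Variables (R : realType) (n : nat) (o : 'I_n).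

Definition kron (i j : 'I_n) : R := (i == j)%:R.
(** The components of dx, when o is the index of the direction x. *)
Definition dxc (i : 'I_n) : R := kron i o.

Lemma kronC i j : kron i j = kron j i. Proof. by rewrite /kron eq_sym. Qed.

Lemma sum_kron (f : 'I_n -> R) k : \sum_l kron k l * f l = f k.
Proof.
rewrite (bigD1 k)//= big1 => [|i ik]; rewrite /kron ?eqxx ?mul1r ?addr0//.
by rewrite eq_sym (negbTE ik) mul0r.
Qed.

Lemma sum_kronr (f : 'I_n -> R) k : \sum_l kron l k * f l = f k.
Proof. by rewrite -[RHS]sum_kron; apply: eq_bigr => l _; rewrite kronC. Qed.

Lemma sum_dx (f : 'I_n -> R) : \sum_l dxc l * f l = f o.
Proof. exact: sum_kronr. Qed.

Lemma dx_self : dxc o = 1. Proof. by rewrite /dxc /kron eqxx. Qed.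

Lemma trace_kron : \sum_i kron i i = n%:R.
Proof.
rewrite (eq_bigr (fun=> 1)) ?sumr_const ?card_ord// => i _.
by rewrite /kron eqxx.
Qed.

(* G0 is dx^2 + h at one point, W0 its inverse *)
Variables (G0 W0 : 'I_n -> 'I_n -> R).
Hypothesis G0C : forall i j, G0 i j = G0 j i.
Hypothesis W0C : forall i j, W0 i j = W0 j i.
Hypothesis G0o : forall j, G0 o j = dxc j.
Hypothesis W0o : forall j, W0 o j = dxc j.
Hypothesis WG : forall k j, \sum_l W0 k l * G0 l j = kron k j.

Lemma GW k j : \sum_l G0 k l * W0 l j = kron k j.
Proof.
rewrite kronC -WG; apply: eq_bigr => l _.
by rewrite mulrC W0C G0C.
Qed.

(** The limit at x = 0 of rho times the Christoffel symbols of rho^-2 G0. *)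
Definition Gam0 k i j : R := - (dxc i * kron k j + dxc j * kron k i - dxc k * G0 i j).

Lemma Gam0C k i j : Gam0 k i j = Gam0 k j i.
Proof. by rewrite /Gam0 [G0 j i]G0C; ring. Qed.

Lemma sum_Gam0_up (X : 'I_n -> R) k j : \sum_i X i * Gam0 i k j
  = - (dxc k * X j + dxc j * X k - X o * G0 k j).
Proof.
rewrite (_ : \sum_i _ = - (dxc k * \sum_i kron i j * X i + dxc j * \sum_i kron i k * X i
   - G0 k j * \sum_i dxc i * X i)).
  by rewrite !sum_kronr; ring.
rewrite !mulr_sumr -sumrN -!big_split -sumrN /=.
by apply: eq_bigr => i _; rewrite /Gam0; ring.
Qed.

Lemma sum_Gam0_low (X : 'I_n -> R) k i : \sum_j Gam0 k i j * X j
  = - (dxc i * X k + kron k i * X o - dxc k * \sum_j G0 i j * X j).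
Proof.
rewrite (_ : \sum_j _ = - (dxc i * \sum_j kron k j * X j + kron k i * \sum_j dxc j * X j
   - dxc k * \sum_j G0 i j * X j)).
  by rewrite sum_kron ?sum_dx.
rewrite !mulr_sumr -sumrN -!big_split -sumrN /=.
by apply: eq_bigr => j _; rewrite /Gam0; ring.
Qed.

Lemma trace_Gam0 p : \sum_i Gam0 i i p = - n%:R * dxc p.
Proof.
rewrite (_ : \sum_i _ = - (\sum_i dxc i * kron i p + dxc p * \sum_i kron i i - \sum_i dxc i * G0 i p)).
  by rewrite !sum_dx trace_kron G0o kronC -/(dxc p); ring.
rewrite !mulr_sumr -sumrN -!big_split -sumrN /=.
by apply: eq_bigr => j _; rewrite /Gam0; ring.
Qed.

Lemma sum_Gam0_X (X : 'I_n -> 'I_n -> 'I_n -> R) j k :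
  \sum_i \sum_p Gam0 i j p * X p i k
  = - (dxc j * (\sum_i X i i k) + X o j k - \sum_p G0 j p * X p o k).
Proof.
under eq_bigr do rewrite sum_Gam0_low.
rewrite (_ : \sum_i _ = - (dxc j * (\sum_i X i i k) + (\sum_i kron i j * X o i k)
   - (\sum_i dxc i * \sum_p G0 j p * X p i k))).
  by rewrite sum_kronr ?sum_dx.
rewrite !mulr_sumr -sumrN -!big_split -sumrN /=.
by apply: eq_bigr => i _; ring.
Qed.

Lemma sum_X_Gam0 (X : 'I_n -> 'I_n -> 'I_n -> R) j k :
  (forall k i j, X k i j = X k j i) ->
  \sum_i \sum_p X i j p * Gam0 p i k
  = - (dxc k * (\sum_i X i i j) + X o k j - \sum_p G0 k p * X p o j).
Proof.
move=> XC; rewrite -(sum_Gam0_X X) exchange_big /=.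
apply: eq_bigr => i _; apply: eq_bigr => p _.
by rewrite XC Gam0C mulrC.
Qed.

Lemma sum_traceX (X Y : 'I_n -> 'I_n -> 'I_n -> R) j k :
  \sum_i \sum_p X i i p * Y p j k = \sum_p (\sum_i X i i p) * Y p j k.
Proof. by rewrite exchange_big /=; apply: eq_bigr => p _; rewrite mulr_suml. Qed.

Lemma jetGam_const (c : R) k i j :
  jetGam W0 (fun i j l => c * (dxc i * G0 j l)) k i j = - (c / 2) * Gam0 k i j.
Proof.
rewrite /jetGam (_ : \sum_l _ = c * (dxc i * (\sum_l W0 k l * G0 l j)
  + dxc j * (\sum_l W0 k l * G0 l i) - G0 i j * \sum_l dxc l * W0 k l)).
  by rewrite !WG sum_dx W0C W0o /Gam0; field.
rewrite !mulr_sumr -sumrN -!big_split mulr_sumr /=.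
by apply: eq_bigr => l _; rewrite [G0 j l]G0C [G0 i l]G0C; ring.
Qed.

Section Perturbation.
Variables (kap : 'I_n -> 'I_n -> R) (q : nat).
Hypothesis kapC : forall i j, kap i j = kap j i.
Local Notation Q := (q%:R : R).

Definition kup k j : R := \sum_l W0 k l * kap l j.
Definition ktr : R := \sum_k kup k k.

Lemma kupo j : kup o j = kap o j.
Proof. by rewrite /kup; under eq_bigr do rewrite W0o; rewrite sum_dx. Qed.

Lemma sum_Gkup j k : \sum_p G0 j p * kup p k = kap j k.
Proof.
under eq_bigr do rewrite mulr_sumr; rewrite exchange_big /=.
rewrite -(sum_kron (fun l => kap l k) j); apply: eq_bigr => l _.
by rewrite -GW mulr_suml; apply: eq_bigr => p _; rewrite mulrA.
Qed.

Lemma sum_kupG k : \sum_i kup i o * G0 i k = kap k o.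
Proof. by rewrite -sum_Gkup; apply: eq_bigr => i _; rewrite mulrC G0C. Qed.

(** The first order variations, under G0 |-> G0 + (x^q/q) kap, of the inverse
    metric, of the first and second derivatives of rho^-2 G0 and of its
    Christoffel symbols, after division by the natural powers of rho. The factors
    Q - 2 and Q - 3 come from differentiating x^(q-2) kap. *)
Definition vW k l : R := - \sum_m kup k m * W0 m l.
Definition vD i j l : R := (Q - 2) * (dxc i * kap j l).
Definition vH a i j l : R := (Q - 2) * (Q - 3) * (dxc a * dxc i * kap j l).
Definition vGam k i j : R :=
  Q / 2 * (dxc i * kup k j + dxc j * kup k i) - kup k o * G0 i j
  - (Q - 2) / 2 * (dxc k * kap i j).

Lemma vGamC k i j : vGam k i j = vGam k j i.
Proof. by rewrite /vGam [G0 j i]G0C [kap j i]kapC; ring. Qed.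

Lemma sum_vWG k j : \sum_l vW k l * G0 j l = - kup k j.
Proof.
rewrite (eq_bigr (fun l => - \sum_m kup k m * (W0 m l * G0 l j))); last first.
  move=> l _; rewrite /vW mulNr mulr_suml; congr (- _).
  by apply: eq_bigr => m _; rewrite [G0 j l]G0C mulrA.
rewrite sumrN exchange_big /=; congr (- _).
rewrite -[RHS](sum_kronr (fun m => kup k m)); apply: eq_bigr => m _.
by rewrite -mulr_sumr WG mulrC.
Qed.

Lemma vW_o k : vW k o = - kup k o.
Proof.
rewrite /vW; congr (- _).
by under eq_bigr do rewrite W0C W0o mulrC; rewrite sum_dx.
Qed.

Lemma sum_W0kap k j : \sum_l W0 k l * kap j l = kup k j.
Proof. by apply: eq_bigr => l _; rewrite kapC. Qed.

Let S3 (c1 c2 : R) k i j :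
  \sum_l (W0 k l * (c1 * (dxc i * kap j l + dxc j * kap i l - dxc l * kap i j))
        + vW k l * (c2 * (dxc i * G0 j l + dxc j * G0 i l - dxc l * G0 i j)))
  = c1 * (dxc i * kup k j + dxc j * kup k i - dxc k * kap i j)
    - c2 * (dxc i * kup k j + dxc j * kup k i - kup k o * G0 i j).
Proof.
rewrite (_ : \sum_l _ =
  c1 * (dxc i * (\sum_l W0 k l * kap j l) + dxc j * (\sum_l W0 k l * kap i l)
        - kap i j * \sum_l dxc l * W0 k l)
  + c2 * (dxc i * (\sum_l vW k l * G0 j l) + dxc j * (\sum_l vW k l * G0 i l)
        - G0 i j * \sum_l dxc l * vW k l)).
  by rewrite !sum_W0kap !sum_vWG !sum_dx vW_o W0C W0o; ring.
rewrite !mulr_sumr -!sumrN -!big_split !mulr_sumr -!big_split /=.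
by apply: eq_bigr => l _; ring.
Qed.

Lemma vGamE k i j :
  2^-1 * \sum_l (W0 k l * (vD i j l + vD j i l - vD l i j)
     + vW k l * (-2 * (dxc i * G0 j l) + -2 * (dxc j * G0 i l) - -2 * (dxc l * G0 i j)))
  = vGam k i j.
Proof.
rewrite (eq_bigr (fun l => W0 k l * ((Q - 2) * (dxc i * kap j l + dxc j * kap i l - dxc l * kap i j))
        + vW k l * (-2 * (dxc i * G0 j l + dxc j * G0 i l - dxc l * G0 i j)))).
  by rewrite S3 /vGam; field.
by move=> l _; rewrite /vD; ring.
Qed.

Lemma sum_WD0 k a p : \sum_m W0 k m * (-2 * (dxc a * G0 m p)) = -2 * dxc a * kron k p.
Proof. by rewrite -WG mulr_sumr; apply: eq_bigr => m _; ring. Qed.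

Lemma sum_vWD k a p :
  \sum_m (W0 k m * vD a m p + vW k m * (-2 * (dxc a * G0 m p))) = Q * dxc a * kup k p.
Proof.
rewrite (_ : \sum_m _ = (Q - 2) * dxc a * kup k p + -2 * dxc a * \sum_m vW k m * G0 p m).
  by rewrite sum_vWG; ring.
rewrite /kup !mulr_sumr -big_split /=; apply: eq_bigr => m _.
by rewrite /vD [G0 p m]G0C; ring.
Qed.

Lemma vdGamE a k i j :
  - (\sum_p (-2 * dxc a * kron k p * vGam p i j + Q * dxc a * kup k p * Gam0 p i j))
  + 2^-1 * \sum_l (W0 k l * (vH a i j l + vH a j i l - vH a l i j)
     + vW k l * (6 * (dxc a * dxc i * G0 j l) + 6 * (dxc a * dxc j * G0 i l)
                 - 6 * (dxc a * dxc l * G0 i j)))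
  = (Q - 1) * (dxc a * vGam k i j).
Proof.
set S1 := \sum_p _; set S2 := \sum_l _.
have -> : S1 = -2 * dxc a * (\sum_p kron k p * vGam p i j)
   + Q * dxc a * \sum_p kup k p * Gam0 p i j.
  by rewrite !mulr_sumr -big_split /=; apply: eq_bigr => p _; ring.
have -> : S2 = \sum_l (W0 k l * ((Q - 2) * (Q - 3) * dxc a *
   (dxc i * kap j l + dxc j * kap i l - dxc l * kap i j))
        + vW k l * (6 * dxc a * (dxc i * G0 j l + dxc j * G0 i l - dxc l * G0 i j))).
  by apply: eq_bigr => l _; rewrite /vH; ring.
by rewrite S3 sum_kron sum_Gam0_up /vGam; field.
Qed.

Lemma trace_vGam k : \sum_i vGam i i k = Q / 2 * (dxc k * ktr).
Proof.
rewrite (_ : \sum_i _ = Q / 2 * ((\sum_i dxc i * kup i k) + dxc k * \sum_i kup i i)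
  - (\sum_i kup i o * G0 i k) - (Q - 2) / 2 * (\sum_i dxc i * kap i k)).
  by rewrite !sum_dx sum_kupG kupo [kap k o]kapC /ktr; field.
rewrite !mulr_sumr -!sumrN -!big_split /= !mulr_sumr -!big_split /=.
by apply: eq_bigr => i _; rewrite /vGam; ring.
Qed.

Lemma vGam_o j k : vGam o j k = Q / 2 * (dxc j * kap o k + dxc k * kap o j)
  - kap o o * G0 j k - (Q - 2) / 2 * kap j k.
Proof. by rewrite /vGam dx_self !kupo mul1r. Qed.

Lemma sum_GvGam j k : \sum_p G0 j p * vGam p o k =
  Q / 2 * kap j k + (Q - 2) / 2 * (dxc k * kap j o - dxc j * kap o k).
Proof.
rewrite (_ : \sum_p _ = Q / 2 * ((\sum_p G0 j p * kup p k) + dxc k * (\sum_p G0 j p * kup p o))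
  - dxc k * (\sum_p G0 j p * kup p o) - (Q - 2) / 2 * (kap o k * \sum_p dxc p * G0 j p)).
  by rewrite !sum_Gkup sum_dx [G0 j o]G0C G0o; field.
rewrite !mulr_sumr -!sumrN -!big_split /= !mulr_sumr -!big_split /=.
by apply: eq_bigr => i _; rewrite /vGam dx_self G0o; ring.
Qed.

(** The linearization of Ric at the hyperbolic background, evaluated on
    x^(q-2) kap / q. It is algebraic in kap, since derivatives of kap along the
    boundary only contribute at higher order in x. *)
Definition vRic j k : R :=
  (Q + 1 - n%:R) * vGam o j k - Q * (Q - 1) / 2 * (ktr * dxc j * dxc k)
  + Q / 2 * ktr * G0 j k - Q * kap j k.

Lemma vRicE j k :
  \sum_i ((Q - 1) * (dxc i * vGam i j k) - (Q - 1) * (dxc j * vGam i i k)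
    + \sum_p (Gam0 i i p * vGam p j k + vGam i i p * Gam0 p j k
              - (Gam0 i j p * vGam p i k + vGam i j p * Gam0 p i k)))
  = vRic j k.
Proof.
rewrite (_ : \sum_i _ = (Q - 1) * (\sum_i dxc i * vGam i j k)
   - (Q - 1) * dxc j * (\sum_i vGam i i k)
   + ((\sum_i \sum_p Gam0 i i p * vGam p j k) + (\sum_i \sum_p vGam i i p * Gam0 p j k)
   - (\sum_i \sum_p Gam0 i j p * vGam p i k) - (\sum_i \sum_p vGam i j p * Gam0 p i k))).
  rewrite !sum_traceX sum_Gam0_X (sum_X_Gam0 _ _ vGamC) !trace_vGam sum_dx !sum_GvGam.
  have -> : \sum_p (\sum_i Gam0 i i p) * vGam p j k = - n%:R * vGam o j k.
    rewrite -(sum_dx (fun p => vGam p j k)) mulr_sumr; apply: eq_bigr => p _.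
    by rewrite trace_Gam0; ring.
  have -> : \sum_p (\sum_i vGam i i p) * Gam0 p j k = Q / 2 * ktr * Gam0 o j k.
    rewrite -(sum_dx (fun p => Gam0 p j k)) mulr_sumr; apply: eq_bigr => p _.
    by rewrite trace_vGam; ring.
  rewrite /vRic [vGam o k j]vGamC [kap k o]kapC [kap j o]kapC [kap k j]kapC.
  by rewrite /Gam0 dx_self [kron o k]kronC [kron o j]kronC -/(dxc j) -/(dxc k); field.
rewrite !mulr_sumr -!sumrN -!big_split /=; apply: eq_bigr => i _.
rewrite !mulrA; congr (_ + _).
rewrite -!sumrN -!big_split /=; apply: eq_bigr => p _; ring.
Qed.

End Perturbation.

Section Background.
Variables (T : 'I_n -> 'I_n -> 'I_n -> R) (TT : 'I_n -> 'I_n -> 'I_n -> 'I_n -> R).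
Hypothesis TC : forall i j l, T i j l = T i l j.
Hypothesis To1 : forall j l, T o j l = 0.
Hypothesis To2 : forall i l, T i o l = 0.
Variables (r s K : R).
Hypothesis s2 : s ^+ 2 = 1 + K * r ^+ 2.

(** With r = rho, s = drho/dx and T, TT the derivatives of G0, these are
    rho^3 d_i g_jl and rho^4 d_a d_i g_jl for the background g = rho^-2 G0. *)
Definition bD i j l : R := r * T i j l - 2 * s * (dxc i * G0 j l).
Definition bH a i j l : R := r ^+ 2 * TT a i j l
  - 2 * r * s * (dxc a * T i j l + dxc i * T a j l)
  + (6 + 4 * K * r ^+ 2) * (dxc a * dxc i * G0 j l).

Let Gt := jetGam W0 T.
Let Ut a k p := \sum_m W0 k m * T a m p.

Let To3 i j : T i j o = 0. Proof. by rewrite TC To2. Qed.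

Lemma tGam_o i j : Gt o i j = 0.
Proof.
rewrite /Gt /jetGam; under eq_bigr do rewrite W0o.
by rewrite sum_dx !To3 To1 subr0 addr0 mulr0.
Qed.

Lemma tGam_o1 k j : Gt k o j = 0.
Proof.
rewrite /Gt /jetGam big1 ?mulr0// => l _.
by rewrite To1 !To2 add0r subrr mulr0.
Qed.

Lemma tGamC k i j : Gt k i j = Gt k j i.
Proof. by rewrite /Gt /jetGam; congr (_ * _); apply: eq_bigr => l _; rewrite [T l j i]TC; ring. Qed.

Lemma bGamE k i j : jetGam W0 bD k i j = r * Gt k i j + s * Gam0 k i j.
Proof.
have := jetGam_const (-2 * s) k i j; rewrite (_ : - (-2 * s / 2) = s); last by field.
move=> <-; rewrite /Gt /jetGam mulrCA -mulrDr; congr (_ * _).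
by rewrite mulr_sumr -big_split; apply: eq_bigr => l _ /=; rewrite /bD; ring.
Qed.

Lemma Ut_o a k : Ut a k o = 0.
Proof. by rewrite /Ut big1// => m _; rewrite To3 mulr0. Qed.

Lemma bdGamE a k i j : jetdGam W0 bD bH a k i j =
  r ^+ 2 * jetdGam W0 T TT a k i j - dxc a * Gam0 k i j + r * s * (dxc k * T a i j).
Proof.
rewrite /jetdGam -/Gt.
set S1 := \sum_p _; set S2 := \sum_l _; set S1' := \sum_p _; set S2' := \sum_l _.
have UW p : \sum_m W0 k m * bD a m p = r * Ut a k p - 2 * s * (dxc a * kron k p).
  transitivity (r * Ut a k p + -2 * s * dxc a * \sum_m W0 k m * G0 m p).
    rewrite /Ut !mulr_sumr -big_split; apply: eq_bigr => m _ /=.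
    by rewrite /bD; ring.
  by rewrite WG; ring.
have -> : S1 = r ^+ 2 * S1' + r * s * (\sum_p Ut a k p * Gam0 p i j)
   - 2 * r * s * dxc a * (\sum_p kron k p * Gt p i j)
   - 2 * s ^+ 2 * dxc a * (\sum_p kron k p * Gam0 p i j).
  rewrite !mulr_sumr -!sumrN -!big_split; apply: eq_bigr => p _ /=.
  rewrite UW bGamE -/(Ut a k p); ring.
rewrite sum_Gam0_up !sum_kron Ut_o.
have -> : S2 = r ^+ 2 * S2' - 2 * r * s * (dxc a * (\sum_l W0 k l * (T i j l + T j i l - T l i j))
    + dxc i * (\sum_l W0 k l * T a l j) + dxc j * (\sum_l W0 k l * T a l i)
    - T a i j * \sum_l dxc l * W0 k l)
  + (6 + 4 * K * r ^+ 2) * dxc a * (dxc i * (\sum_l W0 k l * G0 l j)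
    + dxc j * (\sum_l W0 k l * G0 l i) - G0 i j * \sum_l dxc l * W0 k l).
  rewrite !mulr_sumr -!sumrN -!big_split !mulr_sumr -!sumrN -!big_split.
  apply: eq_bigr => l _ /=; rewrite /bH [T a l j]TC [T a l i]TC [G0 l j]G0C [G0 l i]G0C; ring.
rewrite !WG sum_dx W0C W0o -/(Ut a k j) -/(Ut a k i).
have -> : \sum_l W0 k l * (T i j l + T j i l - T l i j) = 2 * Gt k i j.
  by rewrite /Gt /jetGam; field.
by rewrite /Gam0 s2; field.
Qed.

Lemma sum_Gam0_Gam0 j k :
  \sum_i \sum_p (Gam0 i i p * Gam0 p j k - Gam0 i j p * Gam0 p i k)
  = (n%:R - 2) * (dxc j * dxc k - G0 j k).
Proof.
rewrite (_ : \sum_i _ = (\sum_i \sum_p Gam0 i i p * Gam0 p j k)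
   - \sum_i \sum_p Gam0 i j p * Gam0 p i k); last first.
  by rewrite -sumrB; apply: eq_bigr => i _; rewrite sumrB.
rewrite sum_traceX sum_Gam0_X trace_Gam0.
have -> : \sum_p (\sum_i Gam0 i i p) * Gam0 p j k = - n%:R * Gam0 o j k.
  rewrite -(sum_dx (fun p => Gam0 p j k)) mulr_sumr; apply: eq_bigr => p _.
  by rewrite trace_Gam0; ring.
have -> : \sum_p G0 j p * Gam0 p o k = - (G0 j k + dxc k * dxc j - dxc j * dxc k).
  rewrite (_ : \sum_p _ = - ((\sum_p kron p k * G0 j p) + dxc k * (\sum_p kron p o * G0 j p)
    - dxc k * \sum_p dxc p * G0 j p)).
    by rewrite !sum_kronr ?sum_dx [G0 j o]G0C G0o; ring.
  rewrite !mulr_sumr -!sumrN -!big_split -sumrN; apply: eq_bigr => p _ /=.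
  by rewrite /Gam0 dx_self G0o; ring.
by rewrite /Gam0 dx_self [kron o k]kronC [kron o j]kronC -/(dxc j) -/(dxc k); ring.
Qed.

Lemma sum_Gam0_Gt j k :
  \sum_i \sum_p (Gt i i p * Gam0 p j k + Gam0 i i p * Gt p j k
                  - (Gt i j p * Gam0 p i k + Gam0 i j p * Gt p i k)) = 0.
Proof.
rewrite (_ : \sum_i _ = (\sum_i \sum_p Gt i i p * Gam0 p j k)
   + (\sum_i \sum_p Gam0 i i p * Gt p j k)
   - (\sum_i \sum_p Gt i j p * Gam0 p i k) - \sum_i \sum_p Gam0 i j p * Gt p i k); last first.
  rewrite -!sumrN -!big_split; apply: eq_bigr => i _ /=.
  by rewrite -!sumrN -!big_split; apply: eq_bigr => p _ /=; ring.
rewrite !sum_traceX sum_Gam0_X (sum_X_Gam0 _ _ tGamC) sum_Gam0_up.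
have -> : \sum_p (\sum_i Gam0 i i p) * Gt p j k = - n%:R * Gt o j k.
  rewrite -(sum_dx (fun p => Gt p j k)) mulr_sumr; apply: eq_bigr => p _.
  by rewrite trace_Gam0; ring.
rewrite !tGam_o.
have z1 a b : \sum_p G0 a p * Gt p o b = 0.
  by rewrite big1// => p _; rewrite tGam_o1 mulr0.
have z2 : \sum_i Gt i i o = 0.
  by rewrite big1// => p _; rewrite tGamC tGam_o1.
by rewrite !z1 z2; ring.
Qed.

(** The background rho^-2 (dx^2 + h) is exactly Einstein, at every x: the
    relation s^2 = 1 + K r^2 compensates the curvature of h. *)
Lemma bRicE j k :
  jetRic W0 T TT j k = (n%:R - 2) * K * (G0 j k - dxc j * dxc k) ->
  jetRic W0 bD bH j k = - (n%:R - 1) * G0 j k.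
Proof.
move=> RT; rewrite /jetRic.
transitivity (r ^+ 2 * jetRic W0 T TT j k
   + (- (\sum_i dxc i * Gam0 i j k) + dxc j * (\sum_i Gam0 i i k)
      + r * s * (\sum_i dxc i * T i j k) - r * s * (\sum_i dxc i * T j i k))
   + r * s * (\sum_i \sum_p (Gt i i p * Gam0 p j k + Gam0 i i p * Gt p j k
                  - (Gt i j p * Gam0 p i k + Gam0 i j p * Gt p i k)))
   + s ^+ 2 * \sum_i \sum_p (Gam0 i i p * Gam0 p j k - Gam0 i j p * Gam0 p i k)).
  rewrite /jetRic !mulr_sumr -!sumrN -!big_split /=.
  apply: eq_bigr => i _; rewrite !bdGamE.
  set S := \sum_p _; set S' := \sum_p _; set S1 := \sum_p _; set S2 := \sum_p _.
  have -> : S = r ^+ 2 * S' + r * s * S1 + s ^+ 2 * S2.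
    rewrite !mulr_sumr -!big_split; apply: eq_bigr => p _ /=.
    by rewrite !bGamE -/Gt; ring.
  ring.
rewrite sum_Gam0_Gt sum_Gam0_Gam0 trace_Gam0 !sum_dx To1 To2 RT s2.
by rewrite /Gam0 dx_self [kron o k]kronC [kron o j]kronC -/(dxc j) -/(dxc k); ring.
Qed.

End Background.

End IndexAlgebra.

(** * Expansions to order x^q around a background *)

Section Expands.
Variables (R : realType) (q : nat).
Hypothesis q_gt0 : (0 < q)%N.
Implicit Types (u b : R -> R) (z c : R).

Local Notation eps := (fun x : R => x ^+ q / q%:R).

(** The function u equals b + c x^q/q up to order x^(q+1), where the background b
    may vary with x but tends to z. Backgrounds are kept exact because they cancel
    in the end, while coefficients only see the limits z. *)
Definition expands u b z c : Prop :=
  bigO0 1 (fun x => b x - z) /\ bigO0 q.+1 (fun x => u x - b x - c * (x ^+ q / q%:R)).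

Lemma bigO0_eps : bigO0 q eps.
Proof.
have := bigO0Ml (q%:R^-1) (bigO0_X R q).
by apply: bigO0_ext => x; rewrite mulrC.
Qed.

Lemma bigO0_M1 u b : bigO0 1 u -> bigO0 q b -> bigO0 q.+1 (fun x => u x * b x).
Proof. by move=> ou ob; have := bigO0M ou ob; rewrite add1n. Qed.

Lemma bigO0_M0 p u b : bigO0 p u -> bigO0 0 b -> bigO0 p (fun x => u x * b x).
Proof. by move=> ou ob; have := bigO0M ou ob; rewrite addn0. Qed.

Lemma bigO0_sub0 b z : bigO0 1 (fun x => b x - z) -> bigO0 0 b.
Proof.
move=> H; have := bigO0D (bigO0W (leq0n 1) H) (bigO0_cst z).
by apply: bigO0_ext => x; rewrite subrK.
Qed.

Lemma expands_diff u b z c : expands u b z c -> bigO0 q (fun x => u x - b x).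
Proof.
move=> [_ H]; have := bigO0D (bigO0W (leqnSn q) H) (bigO0Ml c bigO0_eps).
by apply: bigO0_ext => x; rewrite subrK.
Qed.

Lemma expands_bounded u b z c : expands u b z c -> bigO0 0 u.
Proof.
move=> H; have := bigO0D (bigO0W (leq0n q) (expands_diff H)) (bigO0_sub0 H.1).
by apply: bigO0_ext => x; rewrite subrK.
Qed.

Lemma expands_eq u b z c u' b' z' c' : expands u b z c ->
  u =1 u' -> b =1 b' -> z = z' -> c = c' -> expands u' b' z' c'.
Proof.
move=> [H1 H2] uu bb <- <-; split.
  by apply: bigO0_ext H1 => x; rewrite bb.
by apply: bigO0_ext H2 => x; rewrite uu bb.
Qed.

Lemma expands_cst c0 : expands (fun=> c0) (fun=> c0) c0 0.
Proof.
split; first by apply: bigO0_ext (bigO0_0 R _) => x; rewrite subrr.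
by apply: bigO0_ext (bigO0_0 R _) => x; rewrite subrr mul0r subr0.
Qed.

Lemma expandsD u b z c u' b' z' c' : expands u b z c -> expands u' b' z' c' ->
  expands (fun x => u x + u' x) (fun x => b x + b' x) (z + z') (c + c').
Proof.
move=> [H1 H2] [H1' H2']; split.
  by apply: bigO0_ext (bigO0D H1 H1') => x; ring.
by apply: bigO0_ext (bigO0D H2 H2') => x; ring.
Qed.

Lemma expandsZ a u b z c : expands u b z c ->
  expands (fun x => a * u x) (fun x => a * b x) (a * z) (a * c).
Proof.
move=> [H1 H2]; split.
  by apply: bigO0_ext (bigO0Ml a H1) => x; ring.
by apply: bigO0_ext (bigO0Ml a H2) => x; ring.
Qed.

Lemma expandsN u b z c : expands u b z c ->
  expands (fun x => - u x) (fun x => - b x) (- z) (- c).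
Proof.
move=> /(expandsZ (-1)) H; apply: (expands_eq H) => [x|x||]; exact: mulN1r.
Qed.

Lemma expandsB u b z c u' b' z' c' : expands u b z c -> expands u' b' z' c' ->
  expands (fun x => u x - u' x) (fun x => b x - b' x) (z - z') (c - c').
Proof. by move=> H /expandsN; exact: expandsD. Qed.

(** Replacing the backgrounds by their limits in Leibniz' rule costs a factor
    O(x), which is absorbed by the remainder. *)
Lemma expandsM u b z c u' b' z' c' : expands u b z c -> expands u' b' z' c' ->
  expands (fun x => u x * u' x) (fun x => b x * b' x) (z * z') (z * c' + c * z').
Proof.
move=> H H'; have [H1 H2] := H; have [H1' H2'] := H'.
have ub := expands_bounded H; have ub' := expands_bounded H'.
have bb := bigO0_sub0 H1; have bb' := bigO0_sub0 H1'.
split.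
  have K1 := bigO0_M0 H1 bb'; have K2 := bigO0Ml z H1'.
  by apply: bigO0_ext (bigO0D K1 K2) => x; ring.
have K1 := bigO0_M0 H2 ub'.
have K2 := bigO0_M0 H2' bb.
have K3 := bigO0Ml c (bigO0_M1 H1' bigO0_eps).
have K4 := bigO0Ml c' (bigO0_M1 H1 bigO0_eps).
have K5 : bigO0 q.+1 (fun x => x ^+ q / q%:R * (u' x - b' x)).
  apply: (bigO0W (q := (q + q)%N)); first by rewrite -addn1 leq_add2l.
  exact: bigO0M bigO0_eps (expands_diff H').
have := bigO0D (bigO0D K1 K2) (bigO0D (bigO0D K3 K4) (bigO0Ml c K5)).
by apply: bigO0_ext => x; ring.
Qed.

Lemma expands_sum (I : finType) (u b : I -> R -> R) (z c : I -> R) :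
  (forall i, expands (u i) (b i) (z i) (c i)) ->
  expands (fun x => \sum_i u i x) (fun x => \sum_i b i x) (\sum_i z i) (\sum_i c i).
Proof.
move=> H; split.
  apply: bigO0_ext (bigO0_sum (index_enum I) (fun i => (H i).1)) => x.
  by rewrite sumrB.
apply: bigO0_ext (bigO0_sum (index_enum I) (fun i => (H i).2)) => x.
by rewrite !sumrB mulr_suml.
Qed.

End Expands.

Section RicciExpansion.
Variables (R : realType) (n : nat) (o : 'I_n) (q : nat).
Hypothesis q_gt0 : (0 < q)%N.
Variables (G0 W0 kap : 'I_n -> 'I_n -> R).
Hypothesis G0C : forall i j, G0 i j = G0 j i.
Hypothesis W0C : forall i j, W0 i j = W0 j i.
Hypothesis G0o : forall j, G0 o j = dxc R o j.
Hypothesis W0o : forall j, W0 o j = dxc R o j.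
Hypothesis WG : forall k j, \sum_l W0 k l * G0 l j = kron R k j.
Hypothesis kapC : forall i j, kap i j = kap j i.
Variables (T : 'I_n -> 'I_n -> 'I_n -> R) (TT : 'I_n -> 'I_n -> 'I_n -> 'I_n -> R).
Hypothesis TC : forall i j l, T i j l = T i l j.
Hypothesis To1 : forall j l, T o j l = 0.
Hypothesis To2 : forall i l, T i o l = 0.
Variables (rho sigma : R -> R) (K : R).
Hypothesis s2 : forall x, sigma x ^+ 2 = 1 + K * rho x ^+ 2.
Hypothesis RicT : forall j k,
  jetRic W0 T TT j k = (n%:R - 2) * K * (G0 j k - dxc R o j * dxc R o k).

Local Notation e := (dxc R o).
Local Notation expands := (expands q).
Let bDx x := bD o G0 T (rho x) (sigma x).
Let bHx x := bH o G0 T TT (rho x) (sigma x) K.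

Variables (W : R -> 'I_n -> 'I_n -> R) (D : R -> 'I_n -> 'I_n -> 'I_n -> R).
Variable H : R -> 'I_n -> 'I_n -> 'I_n -> 'I_n -> R.
Hypothesis eW : forall k l,
  expands (fun x => W x k l) (fun=> W0 k l) (W0 k l) (vW W0 kap k l).
Hypothesis eD : forall i j l,
  expands (fun x => D x i j l) (fun x => bDx x i j l) (-2 * (e i * G0 j l)) (vD o kap q i j l).
Hypothesis eH : forall a i j l,
  expands (fun x => H x a i j l) (fun x => bHx x a i j l) (6 * (e a * e i * G0 j l))
    (vH o kap q a i j l).

Lemma expands_Gam k i j :
  expands (fun x => jetGam (W x) (D x) k i j) (fun x => jetGam W0 (bDx x) k i j)
    (Gam0 o G0 k i j) (vGam o G0 W0 kap q k i j).
Proof.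
apply: expands_eq (expandsZ (2^-1) (expands_sum (fun l =>
   expandsM q_gt0 (eW k l) (expandsB (expandsD (eD i j l) (eD j i l)) (eD l i j))))) _ _ _ _ => //.
  have := jetGam_const (o := o) G0C W0C W0o WG (-2) k i j.
  rewrite (_ : - (-2 / 2) = 1); last by field.
  by rewrite mul1r.
exact: (vGamE (o := o) G0C W0C W0o WG _ kapC).
Qed.

Lemma expands_dGam a k i j :
  expands (fun x => jetdGam (W x) (D x) (H x) a k i j)
    (fun x => jetdGam W0 (bDx x) (bHx x) a k i j)
    (- e a * Gam0 o G0 k i j) ((q%:R - 1) * (e a * vGam o G0 W0 kap q k i j)).
Proof.
have eWD p : expands (fun x => \sum_m W x k m * D x a m p)
    (fun x => \sum_m W0 k m * bDx x a m p) (-2 * e a * kron R k p)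
    (q%:R * e a * kup W0 kap k p).
  apply: expands_eq (expands_sum (fun m => expandsM q_gt0 (eW k m) (eD a m p))) _ _ _ _ => //.
    exact: (sum_WD0 o WG).
  exact: (sum_vWD o G0C WG kap q).
have eWDG := expands_sum (fun p => expandsM q_gt0 (eWD p) (expands_Gam p i j)).
have eWH := expands_sum (fun l => expandsM q_gt0 (eW k l)
  (expandsB (expandsD (eH a i j l) (eH a j i l)) (eH a l i j))).
apply: expands_eq (expandsD (expandsN eWDG) (expandsZ (2^-1) eWH)) _ _ _ _ => //.
  have := jetGam_const (o := o) G0C W0C W0o WG (6 * e a) k i j; rewrite /jetGam => E.
  rewrite (_ : \sum_p _ = -2 * e a * \sum_p kron R k p * Gam0 o G0 p i j); last first.
    by rewrite mulr_sumr; apply: eq_bigr => p _; ring.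
  rewrite sum_kron.
  rewrite [\sum_l _](eq_bigr (fun l => W0 k l * (6 * e a * (e i * G0 j l) + 6 * e a * (e j * G0 i l)
    - 6 * e a * (e l * G0 i j)))); last by move=> l _; ring.
  by rewrite E; field.
exact: (vdGamE (o := o) G0C W0C W0o WG _ kapC).
Qed.

(** Ric is polynomial in the jet (W, D, H), so that its coefficient follows by
    Leibniz' rule; the zeroth order part is the Ricci tensor of the Einstein
    background. *)
Lemma ricci_expansion j k : bigO0 q.+1 (fun x =>
  jetRic (W x) (D x) (H x) j k + (n%:R - 1) * G0 j k
  - vRic o G0 W0 kap q j k * (x ^+ q / q%:R)).
Proof.
have eG := expands_Gam; have ed := expands_dGam.
have := expands_sum (fun i => expandsD (expandsB (ed i i j k) (ed j i i k))
   (expands_sum (fun p => expandsB (expandsM q_gt0 (eG i i p) (eG p j k))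
                                   (expandsM q_gt0 (eG i j p) (eG p i k))))).
move=> [_]; rewrite (vRicE (o := o) G0C W0C G0o W0o WG q kapC); apply: bigO0_ext => x.
have := bRicE G0C W0C G0o W0o WG TC To1 To2 (s2 x) (RicT j k).
rewrite -[X in X = _]/(\sum_i (jetdGam W0 (bDx x) (bHx x) i i j k -
   jetdGam W0 (bDx x) (bHx x) j i i k + \sum_p (jetGam W0 (bDx x) i i p * jetGam W0 (bDx x) p j k -
   jetGam W0 (bDx x) i j p * jetGam W0 (bDx x) p i k))).
move=> ->; congr (_ - _); rewrite mulNr opprK; congr (_ + _).
Qed.

End RicciExpansion.

(** * The conformal factor rho_k *)

Section Rho.
Variable R : realType.
Implicit Types (x : R) (k : bool).

Definition cosh x : R := (expR x + expR (- x)) / 2.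

Definition drhok k x : R := if k then cosh x else 1.

Lemma is_derive_expRN x : is_derive x 1 (fun x : R => expR (- x)) (- expR (- x)).
Proof.
have := is_derive1_comp (is_derive_expR (- x)) (is_deriveN (is_derive_id x (1 : R))).
by rewrite mulrN1.
Qed.

Lemma is_derive_sinh x : is_derive x 1 (@sinh R) (cosh x).
Proof.
rewrite (_ : @sinh R = 2^-1 *: (@expR R - (fun x => expR (- x)))); last first.
  by apply/funext => y; rewrite /sinh mulrC.
apply: is_derive_eq (is_deriveZ (2^-1) (is_deriveB (is_derive_expR x) (is_derive_expRN x))) _.
by rewrite /GRing.scale /= opprK mulrC.
Qed.

Lemma is_derive_cosh x : is_derive x 1 cosh (sinh x).
Proof.
rewrite (_ : cosh = 2^-1 *: (@expR R + (fun x => expR (- x)))); last first.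
  by apply/funext => y; rewrite /cosh mulrC.
apply: is_derive_eq (is_deriveZ (2^-1) (is_deriveD (is_derive_expR x) (is_derive_expRN x))) _.
by rewrite /GRing.scale /= mulrC.
Qed.

Lemma is_derive_rhok k x : is_derive x 1 (@rhok R k) (drhok k x).
Proof. by case: k; [exact: is_derive_sinh|exact: is_derive_id]. Qed.

Lemma is_derive_drhok k x : is_derive x 1 (drhok k) (k%:R * rhok k x).
Proof.
case: k; first by rewrite mul1r; exact: is_derive_cosh.
by rewrite mul0r; exact: is_derive_cst.
Qed.

(** For both values of k the function rho solves rho'^2 = 1 + k rho^2; this is
    what makes rho^-2 (dx^2 + h) Einstein. *)
Lemma drhok2 k x : drhok k x ^+ 2 = 1 + k%:R * rhok k x ^+ 2.
Proof.
case: k; rewrite /= ?mul0r ?addr0 ?expr1n// mul1r /cosh /sinh.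
have : expR x * expR (- x) = 1 by rewrite -expRD subrr expR0.
move: (expR x) (expR (- x)) => a b ab.
suff : ((a + b) / 2) ^+ 2 = a * b + ((a - b) / 2) ^+ 2 by rewrite ab.
by field.
Qed.

Lemma rhok_gt0 k x : 0 < x -> 0 < rhok k x.
Proof.
case: k => //= x0; rewrite /sinh divr_gt0// subr_gt0 ltr_expR.
by rewrite (lt_trans _ x0)// oppr_lt0.
Qed.

Lemma rhok_sub_id k : bigO0 2 (fun x => rhok k x - x).
Proof.
case: k => /=; last by apply: bigO0_ext (bigO0_0 R 2) => x; rewrite subrr.
pose phi (l : nat) : R -> R := match l with
  | 0 => fun x => sinh x - x | 1 => fun x => cosh x - 1 | _ => @sinh R end.
have d l (x : R) : (l <= 1)%N -> `|x| < 1 -> is_derive x 1 (phi l) (phi l.+1 x).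
  case: l => [|[|l]] // _ _ /=.
    exact: (is_deriveB (is_derive_sinh x) (is_derive_id x 1)).
  have H := is_deriveB (is_derive_cosh x) (is_derive_cst (1 : R) x (1 : R)).
  by rewrite subr0 in H.
have p0 l : (l <= 1)%N -> phi l 0 = 0.
  case: l => [|[|l]] // _ /=; rewrite /sinh /cosh oppr0 expR0; first by rewrite subrr mul0r addr0.
  by rewrite -[1 + 1]/(2%:R) divff// ?subrr// pnatr_eq0.
have pC (x : R) : `|x| < 1 -> `|phi 2%N x| <= expR 1.
  rewrite ltr_norml => /andP[x1 x2] /=; rewrite /sinh normrM [`|2^-1|]gtr0_norm//.
  rewrite ler_pdivrMr// (le_trans (ler_normB _ _))//.
  rewrite !ger0_norm ?expR_ge0// mulr_natr mulr2n lerD// ler_expR ltW//.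
  by rewrite ltrNl.
exists (expR 1); near=> x.
have x0 : 0 <= x by near: x; exact: nbhs_right_ge.
have x1 : x < 1 by near: x; exact: nbhs_right_lt.
exact: (taylor_bound d p0 pC (l := 0) isT x0 x1).
Unshelve. all: by end_near. Qed.

Lemma bigO0_divx p (u : R -> R) : bigO0 p.+1 u -> bigO0 p (fun x => u x / x).
Proof.
move=> [C Cu]; exists C; near=> x.
have x0 : 0 < x by near: x; exact: nbhs_right_gt.
rewrite normrM normfV (gtr0_norm x0) ler_pdivrMr// -mulrA -exprSr.
by near: x.
Unshelve. all: by end_near. Qed.

Lemma rhok_ratio k : bigO0 1 (fun x => rhok k x / x - 1).
Proof.
apply: bigO0_near (bigO0_divx (rhok_sub_id k)); near=> x.
have x0 : 0 < x by near: x; exact: nbhs_right_gt.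
by rewrite mulrBl divff// gt_eqF.
Unshelve. all: by end_near. Qed.

Lemma rhok_bigO k : bigO0 1 (@rhok R k).
Proof.
have := bigO0D (bigO0W (p := 1) (q := 2) isT (rhok_sub_id k)) (bigO0_id R).
by apply: bigO0_ext => x; rewrite subrK.
Qed.

Lemma drhok_sub1 k : bigO0 1 (fun x => drhok k x - 1).
Proof.
case: k => /=; last by apply: bigO0_ext (bigO0_0 R 1) => x; rewrite subrr.
(* cosh = sqrt (1 + sinh^2) and (cosh - 1) (cosh + 1) = sinh^2 *)
have H := bigO0M (rhok_bigO true) (rhok_bigO true).
apply: (bigO0W (q := 2)) => //.
have [C CH] := H; exists C; near=> x.
have c1 : 0 <= cosh x by rewrite divr_ge0// addr_ge0// expR_ge0.
have := drhok2 true x; rewrite mul1r => E.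
have CHx : `|rhok true x * rhok true x| <= C * x ^+ 2 by near: x.
apply: le_trans CHx.
have -> : rhok true x * rhok true x = (cosh x - 1) * (cosh x + 1).
  by rewrite -expr2 -[rhok _ _ ^+ 2](addKr 1) -E /=; ring.
by rewrite normrM ler_peMr// ger0_norm ?addr_ge0// lerDr.
Unshelve. all: by end_near. Qed.

Lemma is_derive_rhokX k x (m : nat) (f : R -> R) df : rhok k x != 0 -> is_derive x 1 f df ->
  is_derive x 1 (fun x => f x * (rhok k x)^-1 ^+ m.+1)
   (df * (rhok k x)^-1 ^+ m.+1 - m.+1%:R * f x * drhok k x * (rhok k x)^-1 ^+ m.+2).
Proof.
move=> r0 fd.
have d1 : is_derive x 1 (fun x => (rhok k x)^-1) (- (rhok k x) ^- 2 * drhok k x).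
  have [rd rE] := is_derive_rhok k x.
  apply: DeriveDef; first exact: derivableV.
  by rewrite deriveV// rE.
have d2 : is_derive x 1 (fun x => (rhok k x)^-1 ^+ m.+1)
    (m.+1%:R * (rhok k x)^-1 ^+ m * (- (rhok k x) ^- 2 * drhok k x)).
  have := @is_deriveX _ _ _ m.+1 x 1 _ d1.
  by rewrite exprfctE.
have H := is_deriveM fd d2.
apply: (is_derive_eq H); rewrite /GRing.scale /= -exprVn !exprS; ring.
Qed.

End Rho.

Section RadialProduct.
Variables (R : realType) (d : nat).
Implicit Types (v : 'rV[R]_(1 + d)).
Local Notation e := (dxc R (ox d)).

Lemma xcoord_line (h : R) i v :
  xcoord (h *: delta_mx 0 i + v) = h * e i + xcoord v.
Proof. by rewrite /xcoord !mxE eqxx /= /dxc /kron eq_sym. Qed.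

Lemma is_derive_xcoord (phi : R -> R) (dphi : R) i v : is_derive (xcoord v) 1 phi dphi ->
  is_derive v (delta_mx 0 i) (fun w => phi (xcoord w)) (e i * dphi).
Proof.
move=> [pd_ pE]; rewrite /dxc /kron; case: eqP => [->|io].
  have E : (fun h : R => h^-1 *: (((fun w => phi (xcoord w)) \o shift v) (h *: delta_mx 0 (ox d))
             - phi (xcoord v))) =
           (fun h : R => h^-1 *: ((phi \o shift (xcoord v)) (h *: 1) - phi (xcoord v))).
    apply/funext => h /=; congr (_ *: (phi _ - _)).
    by rewrite xcoord_line dx_self [h *: 1]mulr1 mulr1.
  rewrite mul1r; apply: DeriveDef; first by rewrite /derivable E.
  by rewrite -pE /derive E.
have E : (fun h : R => h^-1 *: (((fun w => phi (xcoord w)) \o shift v) (h *: delta_mx 0 i)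
             - phi (xcoord v))) = (fun=> 0).
  apply/funext => h /=; rewrite xcoord_line /dxc /kron (introF eqP io) mulr0 add0r.
  by rewrite subrr scaler0.
rewrite mul0r; apply: DeriveDef; first by rewrite /derivable E; exact: is_cvg_cst.
by rewrite /derive E lim_cst.
Qed.

Lemma is_derive_radial (phi : R -> R) (dphi : R) (f : 'rV[R]_(1 + d) -> R) i v :
  is_derive (xcoord v) 1 phi dphi -> derivable f v (delta_mx 0 i) ->
  is_derive v (delta_mx 0 i) (fun w => phi (xcoord w) * f w)
    (e i * dphi * f v + phi (xcoord v) * pd i f v).
Proof.
move=> pd_ fd; have [xd xE] := is_derive_xcoord i pd_.
apply: DeriveDef; first exact: derivable_mulfun.
by rewrite derive_mulfun// xE.
Qed.

(** Each derivative falling on rho^-2 costs one power of rho. The powers are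
    collected in front, and the remaining factors are regular at x = 0. *)
Lemma pd_rescaled k (f : 'rV[R]_(1 + d) -> R) U v : open U -> open_smooth U f -> U v ->
  (forall w, U w -> rhok k (xcoord w) != 0) ->
  forall (r s : R) (g : 'rV[R]_(1 + d) -> R),
  r = rhok k (xcoord v) -> s = drhok k (xcoord v) ->
  g = (fun w => (rhok k (xcoord w))^-1 ^+ 2 * f w) ->
  (forall i, pd i g v = r^-1 ^+ 3 * (r * pd i f v - 2 * s * (e i * f v))) /\
  (forall a i, pd a (pd i g) v = r^-1 ^+ 4 *
    (r ^+ 2 * pd a (pd i f) v - 2 * r * s * (e a * pd i f v + e i * pd a f v)
     + (6 + 4 * k%:R * r ^+ 2) * (e a * e i * f v))).
Proof.
move=> oU sf Uv r0 r s g rE sE ->{g}; set g := (fun w => _ * f w).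
have fd i w : U w -> derivable f w (delta_mx 0 i) by exact: open_smooth_derivable.
have p1 (x : R) : rhok k x != 0 -> is_derive x 1 (fun x => (rhok k x)^-1 ^+ 2)
    (- 2 * drhok k x * (rhok k x)^-1 ^+ 3).
  move=> x0; have := is_derive_rhokX 1 x0 (is_derive_cst (1 : R) x 1).
  rewrite (_ : (fun x => cst 1 x * _) = (fun x => (rhok k x)^-1 ^+ 2)).
    by move=> H; apply: (is_derive_eq H); rewrite /cst; ring.
  by apply/funext => y; rewrite mul1r.
have p2 (x : R) : rhok k x != 0 -> is_derive x 1 (fun x => - 2 * drhok k x * (rhok k x)^-1 ^+ 3)
    ((6 + 4 * k%:R * rhok k x ^+ 2) * (rhok k x)^-1 ^+ 4).
  have d0 : is_derive x 1 (fun x => - 2 * drhok k x) (- 2 * (k%:R * rhok k x)).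
    exact: (is_deriveZ (- 2) (is_derive_drhok k x)).
  move=> x0; have H := is_derive_rhokX 2 x0 d0; apply: (is_derive_eq H).
  have := drhok2 k x => s2.
  transitivity ((6 * drhok k x ^+ 2 - 2 * k%:R * rhok k x ^+ 2) * (rhok k x)^-1 ^+ 4).
    by field.
  by rewrite s2; congr (_ * _); ring.
have gE i w : U w -> pd i g w = e i * ((- 2 * drhok k (xcoord w) * (rhok k (xcoord w))^-1 ^+ 3) * f w)
    + (rhok k (xcoord w))^-1 ^+ 2 * pd i f w.
  move=> Uw; have [_ E] := is_derive_radial (p1 _ (r0 w Uw)) (fd i w Uw).
  by rewrite {1}/pd [LHS]E; ring.
have rv : r != 0 by rewrite rE; exact: r0.
split=> [i|a i]; first by rewrite gE// -rE -sE; field.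
have E : pd a (pd i g) v = pd a (fun w =>
   e i * ((- 2 * drhok k (xcoord w) * (rhok k (xcoord w))^-1 ^+ 3) * f w)
    + (rhok k (xcoord w))^-1 ^+ 2 * pd i f w) v.
  by apply: near_eq_pd; exact: near_open oU Uv (gE i).
have [d1 e1] := is_derive_radial (p2 _ (r0 v Uv)) (fd a v Uv).
have pfd : derivable (pd i f) v (delta_mx 0 a).
  exact: open_smooth_derivable (open_smooth_pd i sf) Uv.
have [d2 e2] := is_derive_radial (p1 _ (r0 v Uv)) pfd.
have d1' := derivableZ (k := e i) d1.
rewrite E; have := deriveD d1' d2; rewrite deriveZ// e1 e2 /GRing.scale /= => E2.
rewrite /pd [LHS]E2 -rE -sE -/(pd i f v) -/(pd a f v) -/(pd a (pd i f) v).
by field.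
Qed.

End RadialProduct.

(** * Inverse matrices and the product metric dx^2 + h *)

Section InverseExpansion.
Variables (R : realType) (n q : nat).
Hypothesis q_gt0 : (0 < q)%N.

Lemma bigO0_prod_diff (I : Type) (s : seq I) (f : I -> R -> R) (c : I -> R) :
  (forall i, bigO0 1 (fun x => f i x - c i)) ->
  bigO0 1 (fun x => \prod_(i <- s) f i x - \prod_(i <- s) c i).
Proof.
move=> H; elim: s => [|i s IH].
  by apply: bigO0_ext (bigO0_0 R 1) => x; rewrite !big_nil subrr.
have K1 := bigO0_M0 (H i) (bigO0_sub0 IH).
have K2 := bigO0Ml (c i) IH.
by apply: bigO0_ext (bigO0D K1 K2) => x; rewrite !big_cons; ring.
Qed.

Lemma bigO0_det_diff m (A : R -> 'M[R]_m) (B : 'M[R]_m) :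
  (forall i j, bigO0 1 (fun x => A x i j - B i j)) ->
  bigO0 1 (fun x => \det (A x) - \det B).
Proof.
move=> H.
have K (s : 'S_m) := bigO0Ml ((-1) ^+ s)
   (bigO0_prod_diff (index_enum _) (fun i => H i (s i))).
apply: bigO0_ext (bigO0_sum (index_enum _) K) => x.
by rewrite /determinant -sumrB; apply: eq_bigr => s _; rewrite mulrBr.
Qed.

Lemma bigO0_inv (f : R -> R) (c : R) : c != 0 -> bigO0 1 (fun x => f x - c) ->
  bigO0 0 (fun x => (f x)^-1).
Proof.
move=> c0 /bigO0_cvg0 H.
apply: (@cvg_bounded_bigO0 _ _ c^-1); apply: cvgV => //.
have H' := cvgD H (cvg_cst c); rewrite add0r in H'.
suff E : f = (fun x => f x - c + c) by rewrite E; exact: H'.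
by apply/funext => x; rewrite subrK.
Qed.

(** A^-1 - B^-1 = - A^-1 (A - B) B^-1, and A^-1 is bounded by Cramer's rule. *)
Lemma expands_invmx (A : R -> 'M[R]_n) (B kap : 'M[R]_n) : B \in unitmx ->
  (\forall x \near 0^'+, A x \in unitmx) ->
  (forall i j, bigO0 q.+1 (fun x => A x i j - B i j - kap i j * (x ^+ q / q%:R))) ->
  forall k l, expands q (fun x => invmx (A x) k l) (fun=> invmx B k l) (invmx B k l)
    (vW (fun k l => invmx B k l) (fun i j => kap i j) k l).
Proof.
move=> Bu Au H.
have HP i j : bigO0 q (fun x => A x i j - B i j).
  have := bigO0D (bigO0W (leqnSn q) (H i j)) (bigO0Ml (kap i j) (bigO0_eps R q)).
  by apply: bigO0_ext => x; rewrite subrK.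
have H1 i j := bigO0W q_gt0 (HP i j).
have Wb k l : bigO0 0 (fun x => invmx (A x) k l).
  have Hd := bigO0_inv _ (bigO0_det_diff H1).
  have {}Hd := Hd (_ : \det B != 0).
  have := Hd; rewrite -unitfE -unitmxE => /(_ Bu) {}Hd.
  have Hc : bigO0 0 (fun x => \det (row' l (col' k (A x)))).
    apply: (bigO0_sub0 (z := \det (row' l (col' k B)))); apply: bigO0_det_diff => i j.
    by apply: bigO0_ext (H1 (lift l i) (lift k j)) => x; rewrite !mxE.
  have := bigO0_M0 Hd (bigO0Ml ((-1) ^+ (l + k)) Hc).
  apply: bigO0_near; near=> x.
  have Ax : A x \in unitmx by near: x.
  by rewrite /invmx Ax !mxE.
have WE : \forall x \near 0^'+, forall k l, invmx (A x) k l - invmx B k l =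
    - \sum_m (\sum_j invmx (A x) k j * (A x j m - B j m)) * invmx B m l.
  near=> x => k l; have Ax : A x \in unitmx by near: x.
  have : invmx (A x) - invmx B = - (invmx (A x) *m (A x - B) *m invmx B).
    by rewrite mulmxBr mulVmx// mulmxBl mul1mx -mulmxA mulmxV// mulmx1 opprB.
  move=> /(congr1 (fun M : 'M[R]_n => M k l)); rewrite !mxE => ->; congr (- _).
  by apply: eq_bigr => m _; rewrite mxE; congr (_ * _); apply: eq_bigr => j _; rewrite !mxE.
have WP k l : bigO0 q (fun x => invmx (A x) k l - invmx B k l).
  apply: (bigO0_near (u := fun x => - \sum_m (\sum_j invmx (A x) k j * (A x j m - B j m)) * invmx B m l)).
    by apply: filterS WE => x ->.
  apply: bigO0N; apply: bigO0_sum => m; apply: bigO0_M0; last exact: bigO0_cst.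
  apply: bigO0_sum => j; apply: bigO0_ext (bigO0_M0 (HP j m) (Wb k j)) => x.
  by rewrite mulrC.
move=> k l; split; first by apply: bigO0_ext (bigO0_0 R 1) => x; rewrite subrr.
apply: (bigO0_near (u := fun x => - \sum_m (\sum_j
   ((invmx (A x) k j - invmx B k j) * (A x j m - B j m)
    + invmx B k j * (A x j m - B j m - kap j m * (x ^+ q / q%:R)))) * invmx B m l)).
  apply: filterS WE => x -> /=.
  rewrite /vW mulNr opprK mulr_suml -!sumrN -big_split; apply: eq_bigr => m _ /=.
  set X := \sum_j _; set Y := \sum_j _.
  have -> : X = Y - kup (fun k l => invmx B k l) (fun i j => kap i j) k m * (x ^+ q / q%:R).
    by rewrite /kup mulr_suml -sumrB; apply: eq_bigr => j _; ring.
  ring.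
apply: bigO0N; apply: bigO0_sum => m; apply: bigO0_M0; last exact: bigO0_cst.
apply: bigO0_sum => j; apply: bigO0D; last exact: bigO0Ml.
apply: (bigO0W (q := (q + q)%N)); first by rewrite -addn1 leq_add2l.
exact: bigO0M.
Unshelve. all: by end_near. Qed.

End InverseExpansion.

Section ProductMetric.
Variables (R : realType) (d : nat) (hN : 'rV[R]_d -> 'M[R]_d) (V : set 'rV[R]_d).
Variables (y0 : 'rV[R]_d) (K : R).
Hypotheses (oV : open V) (Vy0 : V y0).
Hypothesis shN : forall i j, open_smooth V (fun y => hN y i j).
Hypothesis hsym : forall y, V y -> (hN y)^T = hN y.
Hypothesis hunit : forall y, V y -> hN y \in unitmx.
Hypothesis hric : ricci hN y0 = ((1 + d)%:R - 2) * K *: hN y0.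

(** The product metric dx^2 + h. *)
Definition cyl (y : 'rV[R]_d) : 'M[R]_(1 + d) := block_mx (1%:M : 'M[R]_1) 0 0 (hN y).

Local Notation o := (ox d).
Local Notation e := (dxc R (ox d)).

Lemma dx_x : e (lshift d ord0) = 1. Proof. exact: dx_self. Qed.
Lemma dx_y A : e (rshift 1 A) = 0. Proof. by rewrite /dxc /kron eq_rlshift. Qed.

Lemma cyl_o y j : cyl y o j = e j.
Proof.
case: (split_ordP j) => A ->; rewrite ?dx_y ?ord1 ?dx_x /cyl.
  by rewrite block_mxEul mxE eqxx.
by rewrite block_mxEur mxE.
Qed.

Lemma cyl_rr y A B : cyl y (rshift 1 A) (rshift 1 B) = hN y A B.
Proof. exact: block_mxEdr. Qed.

Lemma cyl_rl y A : cyl y (rshift 1 A) o = 0.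
Proof. by rewrite /cyl block_mxEdl mxE. Qed.

Lemma cylC y i j : V y -> cyl y i j = cyl y j i.
Proof.
move=> Vy; have /(congr1 (fun M : 'M[R]_(1 + d) => M j i)) : (cyl y)^T = cyl y.
  by rewrite /cyl tr_block_mx !trmx0 trmx1 hsym.
by rewrite mxE.
Qed.

Lemma cyl_unit y : V y -> cyl y \in unitmx.
Proof.
by move=> Vy; rewrite unitmxE det_ublock det1 mul1r -unitmxE hunit.
Qed.

Lemma invmx_cyl y : V y -> invmx (cyl y) = block_mx (1%:M : 'M[R]_1) 0 0 (invmx (hN y)).
Proof.
move=> Vy; rewrite -[RHS]mul1mx -(mulVmx (cyl_unit Vy)) -mulmxA mulmx_block.
rewrite !mulmx0 !mul0mx !mulmx1 !addr0 !add0r mulmxV ?hunit//.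
by rewrite -scalar_mx_block mulmx1.
Qed.

Let W0 i j := invmx (cyl y0) i j.
Let G0 i j := cyl y0 i j.

Lemma W0_o j : W0 o j = e j.
Proof.
rewrite /W0 invmx_cyl//; case: (split_ordP j) => A ->; rewrite ?dx_y ?ord1 ?dx_x.
  by rewrite block_mxEul mxE eqxx.
by rewrite block_mxEur mxE.
Qed.

Lemma W0_rr A B : W0 (rshift 1 A) (rshift 1 B) = invmx (hN y0) A B.
Proof. by rewrite /W0 invmx_cyl// block_mxEdr. Qed.

Lemma W0_rl A : W0 (rshift 1 A) o = 0.
Proof. by rewrite /W0 invmx_cyl// block_mxEdl mxE. Qed.

Lemma W0_C i j : W0 i j = W0 j i.
Proof.
have /(congr1 (fun M : 'M[R]_(1 + d) => M j i)) : (invmx (cyl y0))^T = invmx (cyl y0).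
  by rewrite trmx_inv /cyl tr_block_mx !trmx0 trmx1 hsym.
by rewrite mxE.
Qed.

Lemma W0_G0 k j : \sum_l W0 k l * G0 l j = kron R k j.
Proof.
have := congr1 (fun M : 'M[R]_(1 + d) => M k j) (mulVmx (cyl_unit Vy0)).
by rewrite !mxE.
Qed.

(** The derivatives of the product metric in all directions, those in the
    direction x being 0. *)
Definition cylT (i j l : 'I_(1 + d)) : R :=
  if fintype.split i is inr A then pd A (fun y => cyl y j l) y0 else 0.

Definition cylTT (a i j l : 'I_(1 + d)) : R :=
  if fintype.split a is inr A then
    if fintype.split i is inr B then pd A (pd B (fun y => cyl y j l)) y0 else 0
  else 0.

Lemma split_lshift A : fintype.split (lshift d A : 'I_(1 + d)) = inl A.
Proof. exact: (unsplitK (inl A)). Qed.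
Lemma split_rshift A : fintype.split (rshift 1 A : 'I_(1 + d)) = inr A.
Proof. exact: (unsplitK (inr A)). Qed.

Lemma cylT_o j l : cylT o j l = 0. Proof. by rewrite /cylT split_lshift. Qed.

Lemma pd_cyl_o A l : pd A (fun y => cyl y o l) = (fun=> 0).
Proof.
rewrite (_ : (fun y => _) = (fun=> e l)); last by apply/funext => y; rewrite cyl_o.
by apply/funext => y; exact: derive_cst.
Qed.

Lemma cylT_o2 i l : cylT i o l = 0.
Proof. by rewrite /cylT; case: fintype.split => // A; rewrite pd_cyl_o. Qed.

Lemma cylT_C i j l : cylT i j l = cylT i l j.
Proof.
rewrite /cylT; case: fintype.split => // A; apply: near_eq_pd.
by apply: (near_open oV Vy0) => y Vy; exact: cylC.
Qed.

Lemma cylTT_o1 i j l : cylTT o i j l = 0. Proof. by rewrite /cylTT split_lshift. Qed.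
Lemma cylTT_o2 a j l : cylTT a o j l = 0.
Proof. by rewrite /cylTT; case: fintype.split => // A; rewrite split_lshift. Qed.
Lemma cylTT_o3 a i l : cylTT a i o l = 0.
Proof.
rewrite /cylTT; case: fintype.split => // A; case: fintype.split => // B.
by rewrite pd_cyl_o; exact: derive_cst.
Qed.
Lemma cylTT_C a i j l : cylTT a i j l = cylTT a i l j.
Proof.
rewrite /cylTT; case: fintype.split => [//|A]; case: fintype.split => [//|B].
have E : \forall y \near y0, (fun y => cyl y j l) y = (fun y => cyl y l j) y.
  by apply: (near_open oV Vy0) => y Vy; exact: cylC.
exact: (nbhs_singleton (near_eq_iter_pd [:: A; B] E)).
Qed.

Let Wh A B := invmx (hN y0) A B.
Let Dh A B C := pd A (fun y => hN y B C) y0.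
Let Hh A B C D := pd A (pd B (fun y => hN y C D)) y0.

Lemma cylT_rrr A B C : cylT (rshift 1 A) (rshift 1 B) (rshift 1 C) = Dh A B C.
Proof.
rewrite /cylT split_rshift /Dh; congr (pd A _ y0).
by apply/funext => y; rewrite cyl_rr.
Qed.

Lemma cylTT_rrrr A B C D :
  cylTT (rshift 1 A) (rshift 1 B) (rshift 1 C) (rshift 1 D) = Hh A B C D.
Proof.
rewrite /cylTT !split_rshift /Hh; congr (pd A (pd B _) y0).
by apply/funext => y; rewrite cyl_rr.
Qed.

Lemma sum_ord1d (f : 'I_(1 + d) -> R) :
  \sum_i f i = f o + \sum_(A < d) f (rshift 1 A).
Proof. by rewrite big_split_ord /= big_ord1. Qed.

Local Notation Gc := (jetGam W0 cylT).
Local Notation dGc := (jetdGam W0 cylT cylTT).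

Let Gc_o1 i j : Gc o i j = 0.
Proof. exact: (tGam_o (o := o) W0_o cylT_C cylT_o cylT_o2). Qed.
Let Gc_o2 k j : Gc k o j = 0.
Proof. exact: (tGam_o1 (o := o) W0 cylT_o cylT_o2). Qed.
Let Gc_C k i j : Gc k i j = Gc k j i.
Proof. exact: (tGamC W0 cylT_C). Qed.
Let Gc_o3 k i : Gc k i o = 0. Proof. by rewrite Gc_C Gc_o2. Qed.

Lemma Gc_rrr A B C : Gc (rshift 1 A) (rshift 1 B) (rshift 1 C) = jetGam Wh Dh A B C.
Proof.
rewrite /jetGam sum_ord1d W0_rl mul0r add0r; congr (_ * _).
by apply: eq_bigr => D _; rewrite W0_rr !cylT_rrr.
Qed.

Lemma dGc_rrrr A B C D :
  dGc (rshift 1 A) (rshift 1 B) (rshift 1 C) (rshift 1 D) = jetdGam Wh Dh Hh A B C D.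
Proof.
rewrite /jetdGam; congr (- _ + _ * _).
  rewrite sum_ord1d Gc_o1 mulr0 add0r; apply: eq_bigr => p _; rewrite Gc_rrr.
  congr (_ * _); rewrite sum_ord1d W0_rl mul0r add0r.
  by apply: eq_bigr => m _; rewrite W0_rr cylT_rrr.
rewrite sum_ord1d W0_rl mul0r add0r.
by apply: eq_bigr => l _; rewrite W0_rr !cylTT_rrrr.
Qed.

Let dGc_0 a k i j : (forall p, Gc p i j = 0) ->
  (forall l, cylTT a i j l + cylTT a j i l - cylTT a l i j = 0) -> dGc a k i j = 0.
Proof.
move=> H1 H2; rewrite /jetdGam !big1 ?mulr0 ?oppr0 ?addr0// => l _.
  by rewrite H2 mulr0.
by rewrite H1 mulr0.
Qed.

Let dGc_o1 k i j : dGc o k i j = 0.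
Proof.
rewrite /jetdGam !big1 ?mulr0 ?oppr0 ?addr0// => l _.
  by rewrite !cylTT_o1 addr0 subrr mulr0.
by rewrite big1 ?mul0r// => m _; rewrite cylT_o mulr0.
Qed.
Let dGc_o2 a i j : dGc a o i j = 0.
Proof.
rewrite /jetdGam.
have W0o l : W0 o l = e l := W0_o l.
under eq_bigr => p _.
  under eq_bigr => m _ do rewrite W0o.
  rewrite sum_dx cylT_o2 mul0r.
  over.
rewrite big1// oppr0 add0r.
under eq_bigr => l _ do rewrite W0o.
rewrite sum_dx [cylTT a i j o]cylTT_C [cylTT a j i o]cylTT_C !cylTT_o3 cylTT_o2.
by rewrite addr0 subrr mulr0.
Qed.
Let dGc_o3 a k j : dGc a k o j = 0.
Proof. by apply: dGc_0 => [p|l]; rewrite ?Gc_o2// cylTT_o2 !cylTT_o3 addr0 subrr. Qed.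
Let dGc_o4 a k i : dGc a k i o = 0.
Proof.
apply: dGc_0 => [p|l]; rewrite ?Gc_o3// cylTT_o2 cylTT_o3 [cylTT a l i o]cylTT_C.
by rewrite cylTT_o3 addr0 subrr.
Qed.

(** All Christoffel symbols with an index in the direction x vanish, so that
    only the Ricci tensor of h is left. *)
Lemma ricci_cyl j k :
  jetRic W0 cylT cylTT j k = ((1 + d)%:R - 2) * K * (G0 j k - e j * e k).
Proof.
case: (split_ordP j) => J ->.
  rewrite ord1 dx_x mul1r /G0 cyl_o subrr mulr0 /jetRic big1// => i _.
  rewrite dGc_o3 dGc_o1 subrr add0r big1// => p _.
  by rewrite Gc_o2 Gc_o2 mulr0 mul0r subrr.
case: (split_ordP k) => L ->.
  rewrite ord1 dx_y mul0r /G0 cyl_rl subrr mulr0 /jetRic big1// => i _.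
  rewrite !dGc_o4 subrr add0r big1// => p _.
  by rewrite !Gc_o3 !mulr0 subrr.
rewrite !dx_y mul0r subr0 /G0 cyl_rr.
have <- : ricci hN y0 J L = ((1 + d)%:R - 2) * K * hN y0 J L by rewrite hric mxE.
rewrite (ricci_jet oV shN hunit) // /jetRic sum_ord1d.
rewrite dGc_o1 dGc_o2 subrr add0r big1 ?add0r => [|p _]; last first.
  by rewrite !Gc_o1 !mul0r subrr.
apply: eq_bigr => I _; rewrite !dGc_rrrr; congr (_ + _).
rewrite sum_ord1d !Gc_o1 !mulr0 subrr add0r.
by apply: eq_bigr => P _; rewrite !Gc_rrr.
Qed.

End ProductMetric.

(** * The Ricci tensor in a collar *)

Section LocalRicci.
Variables (R : realType) (d : nat) (k : bool) (w : R) (V : set 'rV[R]_d).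
Variables (y0 : 'rV[R]_d) (hN : 'rV[R]_d -> 'M[R]_d) (gM : 'rV[R]_(1 + d) -> 'M[R]_(1 + d)).
Variable q : nat.
Local Notation o := (ox d).
Local Notation e := (dxc R (ox d)).

Definition collar_dom (w : R) (V : set 'rV[R]_d) : set 'rV[R]_(1 + d) :=
  [set v | [/\ 0 < xcoord v, xcoord v < w & V (ycoord v)]].

Local Notation Om := (collar_dom w V).

Lemma open_collar_dom : open V -> open Om.
Proof.
move=> oV.
have -> : Om = (@xcoord R d @^-1` [set x | 0 < x]) `&`
    ((@xcoord R d @^-1` [set x | x < w]) `&` (@ycoord R d @^-1` V)).
  by apply/seteqP; split=> [v [a b c]|v [a [b c]]]; split.
apply: openI; [|apply: openI]; apply: open_comp => //.
- by move=> v _; exact: xcoord_continuous.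
- by move=> v _; exact: xcoord_continuous.
- by move=> v _; exact: ycoord_continuous.
Qed.

Hypotheses (w_gt0 : 0 < w) (oV : open V) (Vy0 : V y0) (q_gt0 : (0 < q)%N).
Hypothesis shN : forall i j, open_smooth V (fun y => hN y i j).
Hypothesis hsym : forall y, V y -> (hN y)^T = hN y.
Hypothesis hunit : forall y, V y -> hN y \in unitmx.
Hypothesis hric : ricci hN y0 = ((1 + d)%:R - 2) * k%:R *: hN y0.
Hypothesis sgM : forall i j, open_smooth Om (fun v => gM v i j).
Hypothesis gunit : forall v, Om v -> gM v \in unitmx.

(** The compactified metric rho^2 g as a function of the point. *)
Definition ghat (v : 'rV[R]_(1 + d)) i j : R := rhok k (xcoord v) ^+ 2 * gM v i j.

(* u i j is a smooth extension of rho^2 g_ij across x = 0 *)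
Variables (u : 'I_(1 + d) -> 'I_(1 + d) -> 'rV[R]_(1 + d) -> R).
Variables (U : 'I_(1 + d) -> 'I_(1 + d) -> set 'rV[R]_(1 + d)).
Hypotheses (oU : forall i j, open (U i j)) (Uy0 : forall i j, U i j (pack 0 y0)).
Hypothesis su : forall i j, open_smooth (U i j) (u i j).
Hypothesis uE : forall i j v, U i j v -> Om v -> u i j v = ghat v i j.

Variable kap : 'M[R]_(1 + d).
Hypothesis kapC : kap^T = kap.
Hypothesis expV : forall y i j, V y ->
  bigO0 q (fun x => ghat (pack x y) i j - cyl hN y i j).
Hypothesis exp0 : forall i j, bigO0 q.+1 (fun x =>
  ghat (pack x y0) i j - cyl hN y0 i j - (x ^+ q / q%:R) * kap i j).

Lemma near0_collar_dom y : V y -> \forall x \near 0^'+, Om (pack x y).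
Proof.
move=> Vy; near=> x; rewrite /collar_dom /= xcoord_pack ycoord_pack; split; last by [].
  by near: x; exact: nbhs_right_gt.
by near: x; exact: nbhs_right_lt.
Unshelve. all: by end_near. Qed.

Lemma near0_open (U' : set 'rV[R]_(1 + d)) y : open U' -> U' (pack 0 y) ->
  \forall x \near 0^'+, U' (pack x y).
Proof.
move=> oU' Uy; have [r r0 Ur] := box_nbhs oU' Uy; near=> x.
have x0 : 0 <= x by near: x; exact: nbhs_right_ge.
have xr : x < r by near: x; exact: nbhs_right_lt.
by apply: Ur; rewrite ?subrr ?normr0 ?subr0 ?ger0_norm.
Unshelve. all: by end_near. Qed.

Lemma near0_u i j y : V y -> U i j (pack 0 y) ->
  \forall x \near 0^'+, u i j (pack x y) = ghat (pack x y) i j.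
Proof.
move=> Vy Uy.
by apply: filterS2 (near0_open (@oU i j) Uy) (near0_collar_dom Vy) => x; exact: uE.
Qed.

Lemma u_bdry i j y : V y -> U i j (pack 0 y) -> u i j (pack 0 y) = cyl hN y i j.
Proof.
move=> Vy Uy.
have := xcoef_vanish (@oU i j) (@su i j) Uy (b := cyl hN y i j) (q := q).
move=> H; have := H _ 0%N q_gt0; rewrite mulr1; apply.
apply: bigO0_near (expV i j Vy).
by apply: filterS (near0_u Vy Uy) => x ->.
Qed.

Let uU i j : \forall y \near y0, V y /\ U i j (pack 0 y).
Proof.
by apply: filterI; [exact: open_nbhs_nbhs|exact: near_slice (@oU i j) (Uy0 i j)].
Qed.

Let ub i j : \forall y \near y0, bigO0 q (fun x => u i j (pack x y) - u i j (pack 0 y)).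
Proof.
apply: filterS (uU i j) => y [Vy Uy]; rewrite u_bdry//.
apply: bigO0_near (expV i j Vy).
by apply: filterS (near0_u Vy Uy) => x ->.
Qed.

Let u_slice i j : \forall y \near y0, u i j (pack 0 y) = cyl hN y i j.
Proof. by apply: filterS (uU i j) => y [Vy Uy]; exact: u_bdry. Qed.

Let qn0 : q%:R != 0 :> R. Proof. by rewrite pnatr_eq0 -lt0n. Qed.

Let kapE i j : xcoef (u i j) q y0 / (q.-1)`!%:R = kap i j.
Proof.
rewrite (xcoef_leading (@oU i j) (@su i j) (Uy0 i j) q_gt0 (b := cyl hN y0 i j)
   (a := kap i j / q%:R)).
  have f0 : (q.-1)`!%:R != 0 :> R by rewrite pnatr_eq0 -lt0n fact_gt0.
  by rewrite -[in q`!](prednK q_gt0) factS prednK// natrM; field; rewrite f0.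
apply: bigO0_near (exp0 i j).
by apply: filterS (near0_u Vy0 (Uy0 i j)) => x ->; ring.
Qed.

Local Notation r := (@rhok R k).
Local Notation s := (@drhok R k).
Local Notation T := (cylT hN y0).
Local Notation TT := (cylTT hN y0).
Local Notation G0 := (fun i j => cyl hN y0 i j).
Local Notation W0 := (fun i j => invmx (cyl hN y0) i j).
Local Notation eps := (fun x : R => x ^+ q / q%:R).
Local Notation expands := (expands q).
Let m (x : R) := r x / x.

Let mm1 : bigO0 1 (fun x => m x - 1). Proof. exact: rhok_ratio. Qed.
Let m0 : bigO0 0 m. Proof. exact: bigO0_sub0 (rhok_ratio R k). Qed.
Let rE : \forall x \near 0^'+, r x = m x * x.
Proof.
near=> x; have x0 : 0 < x by near: x; exact: nbhs_right_gt.
by rewrite /m divfK// gt_eqF.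
Unshelve. all: by end_near. Qed.

Let er : expands r r 0 0.
Proof.
split; first by apply: bigO0_ext (rhok_bigO R k) => x; rewrite subr0.
by apply: bigO0_ext (bigO0_0 R _) => x; rewrite subrr mul0r subr0.
Qed.

Let es : expands s s 1 0.
Proof.
split; first exact: drhok_sub1.
by apply: bigO0_ext (bigO0_0 R _) => x; rewrite subrr mul0r subr0.
Qed.

Let e3 i j : expands (fun x => u i j (pack x y0)) (fun=> G0 i j) (G0 i j) (kap i j).
Proof.
split; first by apply: bigO0_ext (bigO0_0 R _) => x; rewrite subrr.
apply: bigO0_near (exp0 i j).
by apply: filterS (near0_u Vy0 (Uy0 i j)) => x ->; ring.
Qed.

Let jt i j t : bigO0 q (fun x => iter_pd (map (@rshift 1 d) t) (u i j) (pack x y0)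
   - iter_pd t (fun y => cyl hN y i j) y0).
Proof.
apply: bigO0_ext (jet_tangential (@oU i j) (@su i j) (Uy0 i j) q_gt0 (ub i j) t) => x.
by rewrite (nbhs_singleton (near_eq_iter_pd t (u_slice i j))).
Qed.

Let vanishing (b : R -> R) : bigO0 1 b -> bigO0 1 (fun x => b x - 0).
Proof. by apply: bigO0_ext => x; rewrite subr0. Qed.

(* rho d_i u: at order x^q only the normal derivative contributes *)
Let e2 i j l : expands (fun x => r x * pd i (u j l) (pack x y0)) (fun x => r x * T i j l)
   0 (q%:R * (e i * kap j l)).
Proof.
split; first by apply/vanishing/(bigO0_M0 (rhok_bigO R k))/bigO0_cst.
case: (split_ordP i) => A ->.
  rewrite ord1 cylT_o dx_x.
  have J := jet_dx (@oU j l) (@su j l) (Uy0 j l) q_gt0 (ub j l); rewrite kapE in J.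
  have J' : bigO0 q (fun x => x * pd o (u j l) (pack x y0)).
    have := bigO0D (bigO0W (leqnSn q) J) (bigO0Ml (kap j l) (bigO0_X R q)).
    by apply: bigO0_ext => x; rewrite subrK.
  apply: bigO0_near (bigO0D (bigO0_M1 mm1 J') J).
  apply: filterS rE => x rx.
  rewrite rx; field; exact: qn0.
rewrite dx_y mul0r mulr0 /cylT split_rshift.
have := bigO0_M1 (rhok_bigO R k) (jt j l [:: A]).
by apply: bigO0_ext => x /=; rewrite mul0r subr0 mulrBr.
Qed.

(* rho^2 d_a d_i u: at order x^q only the second normal derivative contributes *)
Let e1 a i j l : expands (fun x => r x ^+ 2 * pd a (pd i (u j l)) (pack x y0))
   (fun x => r x ^+ 2 * TT a i j l) 0 (q%:R * (q%:R - 1) * (e a * e i * kap j l)).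
Proof.
have r2 : bigO0 2 (fun x => r x ^+ 2).
  by apply: bigO0_ext (bigO0M (rhok_bigO R k) (rhok_bigO R k)) => x; rewrite expr2.
split; first exact/vanishing/(bigO0_M0 (bigO0W _ r2))/bigO0_cst.
have mixed A (f : R -> R) z : z = 0 -> bigO0 q (fun x => x * f x) ->
    bigO0 q.+1 (fun x => r x ^+ 2 * f x - r x ^+ 2 * 0 - A * (z * kap j l) * (x ^+ q / q%:R)).
  move=> -> fx; have H := bigO0_M1 (bigO0_id R) (bigO0_M0 (bigO0_M0 fx m0) m0).
  apply: bigO0_near H; apply: filterS rE => x ->; ring.
case: (split_ordP a) => A ->; case: (split_ordP i) => B ->; rewrite ?ord1 ?dx_x ?dx_y.
- rewrite cylTT_o1.
  have J := jet_dxdx (@oU j l) (@su j l) (Uy0 j l) q_gt0 (ub j l); rewrite kapE in J.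
  have J' : bigO0 q (fun x => x ^+ 2 * pd o (pd o (u j l)) (pack x y0)).
    have := bigO0D (bigO0W (leqnSn q) J) (bigO0Ml (kap j l * (q%:R - 1)) (bigO0_X R q)).
    by apply: bigO0_ext => x; rewrite subrK.
  have m1 : bigO0 1 (fun x => m x ^+ 2 - 1).
    have M1 := bigO0D m0 (bigO0_cst 1).
    by apply: bigO0_ext (bigO0_M0 mm1 M1) => x; ring.
  apply: bigO0_near (bigO0D (bigO0_M1 m1 J') J).
  apply: filterS rE => x rx; rewrite rx; field; exact: qn0.
- rewrite cylTT_o1; apply: mixed; first exact: mulr0.
  exact: (jet_mixed (@oU j l) (@su j l) (Uy0 j l) q_gt0 (ub j l) B).1.
- rewrite cylTT_o2; apply: mixed; first exact: mul0r.
  exact: (jet_mixed (@oU j l) (@su j l) (Uy0 j l) q_gt0 (ub j l) A).2.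
rewrite /cylTT !split_rshift.
have := bigO0_M1 (bigO0W (p := 1) (q := 2) isT r2) (jt j l [:: A; B]).
by apply: bigO0_ext => x; rewrite !mul0r mulr0 mul0r subr0 -mulrBr.
Qed.

(* the rescaled jet of g = rho^-2 u at (x, y0), in terms of the smooth u *)
Let Dt x i j l := r x * pd i (u j l) (pack x y0) - 2 * s x * (e i * u j l (pack x y0)).
Let Ht x a i j l := r x ^+ 2 * pd a (pd i (u j l)) (pack x y0)
  - 2 * r x * s x * (e a * pd i (u j l) (pack x y0) + e i * pd a (u j l) (pack x y0))
  + (6 + 4 * k%:R * r x ^+ 2) * (e a * e i * u j l (pack x y0)).
Let Wt x i j : R := (r x)^-1 ^+ 2 * invmx (gM (pack x y0)) i j.

Let eD i j l : expands (fun x => Dt x i j l) (fun x => bD o G0 T (r x) (s x) i j l)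
  (-2 * (e i * G0 j l)) (vD o (fun i j => kap i j) q i j l).
Proof.
have H := expandsB (e2 i j l) (expandsZ (2 * e i) (expandsM q_gt0 es (e3 j l))).
apply: expands_eq H _ _ _ _ => [x|x||]; rewrite /Dt /bD /vD; ring.
Qed.

Let eH a i j l : expands (fun x => Ht x a i j l)
  (fun x => bH o G0 T TT (r x) (s x) k%:R a i j l)
  (6 * (e a * e i * G0 j l)) (vH o (fun i j => kap i j) q a i j l).
Proof.
have er2 := expandsM q_gt0 er er.
have H1 := expandsZ (2 * e a) (expandsM q_gt0 es (e2 i j l)).
have H2 := expandsZ (2 * e i) (expandsM q_gt0 es (e2 a j l)).
have H3 := expandsZ (e a * e i) (expandsM q_gt0
   (expandsD (expands_cst q 6) (expandsZ (4 * k%:R) er2)) (e3 j l)).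
have H := expandsD (expandsB (e1 a i j l) (expandsD H1 H2)) H3.
apply: expands_eq H _ _ _ _ => [x|x||]; rewrite /Ht /bH /vH; ring.
Qed.

Let Ax x : 'M[R]_(1 + d) := r x ^+ 2 *: gM (pack x y0).

Let near_r : \forall x \near 0^'+, r x != 0.
Proof.
near=> x; have x0 : 0 < x by near: x; exact: nbhs_right_gt.
by rewrite gt_eqF// rhok_gt0.
Unshelve. all: by end_near. Qed.

Let eW i j : expands (fun x => Wt x i j) (fun=> W0 i j) (W0 i j)
  (vW W0 (fun i j => kap i j) i j).
Proof.
have near_Ax : \forall x \near 0^'+, Ax x \in unitmx.
  apply: filterS2 near_r (near0_collar_dom Vy0) => x rx Ox.
  by rewrite unitmxZ ?gunit// unitfE expf_neq0.
have HA i' j' : bigO0 q.+1 (fun x => Ax x i' j' - cyl hN y0 i' j'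
    - kap i' j' * (x ^+ q / q%:R)).
  apply: bigO0_ext (exp0 i' j') => x.
  by rewrite /Ax [(_ *: gM _) _ _]mxE /ghat xcoord_pack; ring.
have [H1 H2] := expands_invmx q_gt0 (cyl_unit hunit Vy0) near_Ax HA i j.
split=> //; apply: bigO0_near H2.
apply: filterS2 near_r (near0_collar_dom Vy0) => x rx Ox.
have r2u : r x ^+ 2 *: gM (pack x y0) \in unitmx.
  by rewrite unitmxZ ?gunit// unitfE expf_neq0.
by rewrite /Ax invmxZ// [(_ *: invmx _) _ _]mxE /Wt exprVn.
Qed.

Let near_ricci : \forall x \near 0^'+, forall i j,
  r x ^+ 2 * ricci gM (pack x y0) i j = jetRic (Wt x) (Dt x) (Ht x) i j.
Proof.
have nU : \forall x \near 0^'+, forall ij : 'I_(1 + d) * 'I_(1 + d), U ij.1 ij.2 (pack x y0).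
  by apply: filter_forall => -[i j] /=; exact: near0_open.
near=> x => i j.
have rx : r x != 0 by near: x; exact: near_r.
have Ox : Om (pack x y0) by near: x; exact: near0_collar_dom.
have Ux i' j' : U i' j' (pack x y0).
  have : forall ij : 'I_(1 + d) * 'I_(1 + d), U ij.1 ij.2 (pack x y0) by near: x.
  by move=> /(_ (i', j')).
have oO := open_collar_dom oV.
rewrite (ricci_jet oO sgM gunit)//.
have loc j' l : let B := U j' l `&` Om in [/\ open B, open_smooth B (u j' l), B (pack x y0)
    & forall v, B v -> r (xcoord v) != 0].
  split=> //; first exact: openI.
    by apply: open_smoothS (@su j' l) => v [].
  by move=> v [_ [x0 _ _]]; rewrite gt_eqF// rhok_gt0.
have gE j' l : \forall v \near pack x y0,
    (r (xcoord v))^-1 ^+ 2 * u j' l v = gM v j' l.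
  have [oB _ Bx Br] := loc j' l.
  apply: (near_open oB Bx) => v [Uv Ov].
  rewrite (uE Uv Ov) /ghat mulrA -exprMn mulVf ?expr1n ?mul1r//.
  exact: (Br v (conj Uv Ov)).
have P j' l := let: And4 oB sB Bx Br := loc j' l in
  pd_rescaled oB sB Bx Br erefl erefl erefl.
have PD i' j' l : pd i' (fun v => gM v j' l) (pack x y0) = (r x)^-1 ^+ 3 * Dt x i' j' l.
  rewrite -(near_eq_pd i' (gE j' l)) (P j' l).1 xcoord_pack; congr (_ * _).
have PH a i' j' l : pd a (pd i' (fun v => gM v j' l)) (pack x y0)
    = (r x)^-1 ^+ 4 * Ht x a i' j' l.
  have := near_eq_iter_pd [:: a; i'] (gE j' l) => /nbhs_singleton /= <-.
  by rewrite (P j' l).2 xcoord_pack.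
have := jetRic_scale (r x ^+ 2) ((r x)^-1 ^+ 3) (Wt x) (Dt x) (Ht x) i j.
rewrite (_ : (r x ^+ 2 * (r x)^-1 ^+ 3) ^+ 2 = (r x)^-1 ^+ 2); last by field.
move=> E; transitivity (r x ^+ 2 * ((r x)^-1 ^+ 2 * jetRic (Wt x) (Dt x) (Ht x) i j)).
  rewrite -E; congr (_ * _); apply: eq_jetRic.
  - by move=> i' j'; rewrite /Wt mulrA -exprMn divff// expr1n mul1r.
  - by move=> i' j' l; rewrite PD.
  - by move=> a i' j' l; rewrite PH; congr (_ * _); field.
by rewrite mulrA -exprMn divff// expr1n mul1r.
Unshelve. all: by end_near. Qed.

(** The coefficient of x^q/q in rho^2 (Ric + (n - 1) g), with n - 1 = d. *)
Definition flow_coef i j : R :=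
  vRic o G0 W0 (fun i j => kap i j) q i j + d%:R * kap i j.

(** Up to powers of rho the jet of g is (Wt, Dt, Ht), which is regular at x =
    0 and has an expansion around the jet of the background. The zeroth order
    part cancels since the background is Einstein. *)
Lemma local_ricci i j : bigO0 q.+1 (fun x =>
  r x ^+ 2 * (ricci gM (pack x y0) i j + d%:R * gM (pack x y0) i j)
  - flow_coef i j * (x ^+ q / q%:R)).
Proof.
have kC i' j' : kap i' j' = kap j' i' by rewrite -{1}kapC mxE.
have GC i' j' : G0 i' j' = G0 j' i' by rewrite (cylC hsym i' j' Vy0).
have H1 := ricci_expansion (o := o) q_gt0 GC (W0_C Vy0 hsym) (cyl_o hN y0) (W0_o Vy0 hunit)
  (W0_G0 Vy0 hunit) kC (cylT_C oV Vy0 hsym) (cylT_o hN y0) (cylT_o2 hN y0) (drhok2 k)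
  (ricci_cyl oV Vy0 shN hsym hunit hric) eW eD eH i j.
have H2 := bigO0Ml d%:R (exp0 i j).
apply: bigO0_near (bigO0D H1 H2).
apply: filterS near_ricci => x /(_ i j) <-.
by rewrite /ghat xcoord_pack /flow_coef natrD; ring.
Qed.

End LocalRicci.

(** * Charts of the collar and of the complete manifold *)

Section SmoothOn.
Variables (R : realType) (n : nat).

Lemma smooth_onS (A B : set 'rV[R]_n) f : B `<=` A -> smooth_on A f -> smooth_on B f.
Proof.
move=> BA sf v /BA Av; have [U [F [Uv [oU sF FE]]]] := sf v Av.
by exists U, F; split=> //; split=> // w Uw /BA; exact: FE.
Qed.

Lemma smooth_on_open (A : set 'rV[R]_n) f : open A -> smooth_on A f -> open_smooth A f.
Proof.
move=> oA sf s v Av; have [U [F [Uv [oU sF FE]]]] := sf v Av.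
have oUA : open (U `&` A) by exact: openI.
apply: (open_smooth_near (U := U `&` A) (f := F)) => //.
  by apply: open_smoothS sF => w [].
by move=> w [Uw Aw]; exact: FE.
Qed.

Lemma posdef_unit (G : 'M[R]_n) :
  (forall a, a != 0 -> 0 < inner G a a) -> G \in unitmx.
Proof.
move=> H; rewrite unitmxE unitfE; apply/negP => /det0P[v v0 vG].
by have := H v v0; rewrite /inner vG mul0mx mxE ltxx.
Qed.

End SmoothOn.

Section Interior.
Variables (R : realType) (n : nat) (H : set 'rV[R]_n) (X : manifold H).

Lemma open_chart_preimage (c : chart R n X) (A : set 'rV[R]_n) : atlas c -> open A ->
  open (cdom c `&` cmap c @^-1` A).
Proof.
move=> /atlas_is_chart[oc _ _ cc _] oA; rewrite openE => p [cp Ap].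
rewrite /interior; apply: filterI; first exact: open_nbhs_nbhs.
by apply: (cc p cp); exact: open_nbhs_nbhs.
Qed.

Lemma open_minterior : open (@minterior R n H X).
Proof.
rewrite openE => p [c [ac cp Hp]]; rewrite /interior.
have oB := open_chart_preimage ac (@open_interior _ H).
have : nbhs p (cdom c `&` cmap c @^-1` H°) by exact: open_nbhs_nbhs.
by apply: filterS => q [cq Hq]; exists c.
Qed.

End Interior.

Lemma open_cimg (R : realType) (d : nat) (N : manifold [set: 'rV[R]_d])
  (c : chart R d N) : atlas c -> open (cimg c).
Proof. by move=> /atlas_is_chart[_ [A oA ->] _ _ _]; rewrite setIT. Qed.

Section CollarCharts.
Variables (R : realType) (d : nat).
Variables (Mt : manifold (@halfspace R d)) (N : manifold [set: 'rV[R]_d]).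
Variable X : collar Mt N.

Lemma interior_chi x y : 0 < x -> x < width X -> minterior (chi X x y).
Proof.
move=> x0 xw; apply: contrapT => H.
have /(collar_boundary X)[y' E] : mboundary (chi X x y) by [].
have := congr1 (px X) E; rewrite px_chi ?ltW// px_chi// ?width_gt0// => x00.
by rewrite x00 ltxx in x0.
Qed.

Lemma boundary_chi y : mboundary (chi X 0 y).
Proof. by apply/(collar_boundary X); exists y. Qed.

Variable c : chart R d N.
Hypothesis ac : atlas c.

Local Notation C := (collar_chart X c).

Let ci y : cdom c y -> cinv c (cmap c y) = y.
Proof. by have [_ _ + _ _] := atlas_is_chart ac; apply. Qed.

Lemma cmap_collar x y : 0 <= x -> x < width X ->
  cmap C (chi X x y) = pack x (cmap c y).
Proof. by move=> x0 xw; rewrite /= px_chi// py_chi. Qed.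

Lemma cinv_collar x v : cinv C (pack x v) = chi X x (cinv c v).
Proof. by rewrite /= xcoord_pack ycoord_pack. Qed.

Lemma cdom_collar x y : 0 <= x -> x < width X -> cdom c y -> cdom C (chi X x y).
Proof. by move=> x0 xw cy; exists (x, y). Qed.

Lemma cimg_cdom v : cimg c v -> cdom c (cinv c v) /\ cmap c (cinv c v) = v.
Proof. by move=> [y cy <-]; rewrite ci. Qed.

Lemma collar_atlasE : atlas C. Proof. exact: collar_atlas. Qed.

Lemma interior_collarE p : cdom C p -> minterior p <-> exists x y,
  [/\ 0 < x, x < width X, cdom c y & p = chi X x y].
Proof.
move=> [[x y] /= [x0 [xw cy]] <-]; split; last first.
  by move=> [x' [y' [x'0 x'w _ ->]]]; exact: interior_chi.
move=> ip; exists x, y; split=> //; rewrite lt_neqAle x0 andbT; apply/eqP => E.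
by move: ip; rewrite -E; exact: boundary_chi.
Qed.

End CollarCharts.

Section PushChart.
Variables (R : realType) (d : nat) (M : manifold [set: 'rV[R]_(1 + d)]).
Variables (Mt : manifold (@halfspace R d)) (N : manifold [set: 'rV[R]_d]).
Variables (psi : Mt -> M) (psi' : M -> Mt) (X : collar Mt N) (c : chart R d N).
Hypotheses (diffeo : interior_diffeo psi psi') (ac : atlas c).

Local Notation C := (collar_chart X c).
Local Notation P := (push_chart psi psi' C).

Lemma psiK p : minterior p -> psi' (psi p) = p.
Proof. by have [+ _ _ _] := diffeo; apply. Qed.
Lemma psi'K q : psi (psi' q) = q.
Proof. by have [_ + _ _] := diffeo; move=> /(_ q)[]. Qed.
Lemma cdom_pushE : cdom P = psi' @^-1` (cdom C `&` @minterior _ _ _ Mt).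
Proof.
apply/seteqP; split=> [q [p [Cp ip] <-]|q [Cq iq]]; first by rewrite /= psiK.
by exists (psi' q) => //; exact: psi'K.
Qed.

Lemma cimg_pushE : cimg P = collar_dom (width X) (cimg c).
Proof.
apply/seteqP; split=> [v [q Pq <-]|v [v0 vw [y cy Ey]]].
  move: Pq; rewrite cdom_pushE => -[Cq iq].
  have [x [y [x0 xw cy E]]] := (interior_collarE Cq).1 iq.
  change (collar_dom (width X) (cimg c) (cmap C (psi' q))).
  rewrite E (cmap_collar c y (ltW x0) xw).
  by split; rewrite ?xcoord_pack ?ycoord_pack//; exists y.
have ic : minterior (chi X (xcoord v) y) by exact: interior_chi.
exists (psi (chi X (xcoord v) y)).
  by exists (chi X (xcoord v) y) => //; split=> //; exact: cdom_collar (ltW v0) vw cy.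
change (cmap C (psi' (psi (chi X (xcoord v) y))) = v).
by rewrite psiK// (cmap_collar c y (ltW v0) vw) Ey packK.
Qed.

Lemma open_cimg_push : open (cimg P).
Proof. by rewrite cimg_pushE; apply: open_collar_dom; exact: open_cimg. Qed.

Lemma cimg_push_interior v : cimg P v -> minterior (cinv C v) /\ cdom C (cinv C v).
Proof.
rewrite cimg_pushE => -[v0 vw /(cimg_cdom ac)[cy _]].
rewrite -(packK v) cinv_collar; split; first exact: interior_chi.
exact: cdom_collar (ltW v0) vw cy.
Qed.

Lemma cimg_push_sub : cimg P `<=` cimg C.
Proof.
rewrite cimg_pushE => v [v0 vw [y cy Ey]].
exists (chi X (xcoord v) y); first exact: cdom_collar (ltW v0) vw cy.
by rewrite (cmap_collar c y (ltW v0) vw) Ey packK.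
Qed.

Lemma push_is_chart : is_chart setT P.
Proof.
have [dK1 dK2 [pc ps] [pc' ps']] := diffeo.
have [oC [A oA CA] CK cmC ciC] := atlas_is_chart (collar_atlasE X ac).
split.
- rewrite cdom_pushE; apply: open_comp; last exact: openI oC (@open_minterior _ _ _ Mt).
  by move=> q _; exact: pc'.
- by exists (cimg P); [exact: open_cimg_push|rewrite setIT].
- rewrite cdom_pushE => q [Cq _].
  by change (psi (cinv C (cmap C (psi' q))) = q); rewrite CK// psi'K.
- rewrite cdom_pushE => q [Cq _].
  by apply: continuous_comp; [exact: pc'|exact: cmC].
have ciP : {in cimg P, continuous (cinv C)}.
  rewrite -continuous_open_subspace; last exact: open_cimg_push.
  exact: continuous_subspaceW cimg_push_sub ciC.
rewrite continuous_open_subspace; last exact: open_cimg_push.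
move=> v Pv; apply: continuous_comp; first exact: ciP.
by apply: pc; move: Pv; rewrite inE => /cimg_push_interior[].
Qed.

(** By maximality the atlas of M contains the chart c o psi^-1, in which
    covariance of tensors and the flow equation may therefore be used. *)
Lemma push_atlas : atlas P.
Proof.
apply: atlas_maximal; first exact: push_is_chart.
have [dK1 dK2 [pc ps] [pc' ps']] := diffeo.
have aC := collar_atlasE X ac.
move=> c' ac'; split=> i.
  apply: smooth_onS (ps _ _ aC ac' i) => v [q [Pq cq] <-].
  move: Pq; rewrite cdom_pushE => -[Cq iq]; exists (psi' q) => //.
  by split; [split|rewrite /= psi'K].
apply: smooth_onS (ps' _ _ ac' aC i) => v [q [cq Pq] <-].
by move: Pq; rewrite cdom_pushE => -[Cq iq]; exists q.
Qed.

End PushChart.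

(** * Evolution of the leading coefficient *)

Section FlowInCollar.
Variables (R : realType) (d : nat) (M : manifold [set: 'rV[R]_(1 + d)]).
Variables (Mt : manifold (@halfspace R d)) (N : manifold [set: 'rV[R]_d]).
Variables (psi : Mt -> M) (psi' : M -> Mt) (X : collar Mt N) (k : bool).
Variables (h : tensor2 N) (T : \bar R) (g : R -> tensor2 M).
Hypothesis diffeo : interior_diffeo psi psi'.
Hypothesis h_metric : riemannian_metric h.
Hypothesis h_ricci : forall (c : chart R d N) y, atlas c -> cimg c y ->
  ricci (h c) y = ((1 + d)%:R - 2) * k%:R *: h c y.
Hypothesis g_metric : forall t, times T t -> riemannian_metric (g t).
Hypothesis g_flow : normalized_ricci_flow T g.
Hypothesis g_smooth : smooth_up_to_collar psi psi' k X T g.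

Local Notation P c := (push_chart psi psi' (collar_chart X c)).
Local Notation cm t c := (collar_metric psi psi' k X (g t) c).

Lemma h_smooth (c : chart R d N) : atlas c ->
  forall i j, open_smooth (cimg c) (fun y => h c y i j).
Proof.
move=> ac i j; apply: smooth_on_open; first exact: open_cimg.
by have [H _ _] := h_metric.2 c ac; exact: H.
Qed.

Lemma h_sym (c : chart R d N) y : atlas c -> cimg c y -> (h c y)^T = h c y.
Proof. by move=> ac cy; have [_ H _] := h_metric.2 c ac; exact: H. Qed.

Lemma h_unit (c : chart R d N) y : atlas c -> cimg c y -> h c y \in unitmx.
Proof. by move=> ac cy; have [_ _ H] := h_metric.2 c ac; apply/posdef_unit/H. Qed.

Lemma g_facts t (c : chart R d N) : times T t -> atlas c ->
  let O := collar_dom (width X) (cimg c) in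
  [/\ forall i j, open_smooth O (fun v => g t (P c) v i j),
      forall v, O v -> (g t (P c) v)^T = g t (P c) v &
      forall v, O v -> g t (P c) v \in unitmx].
Proof.
move=> Tt ac O; have aP := push_atlas X diffeo ac.
have [H1 H2 H3] := (g_metric Tt).2 _ aP.
have E : O = cimg (P c) by rewrite (cimg_pushE X c diffeo).
rewrite E; split=> [i j|//|v Ov]; last exact/posdef_unit/H3.
by apply: smooth_on_open; [exact: open_cimg_push diffeo ac|exact: H1].
Qed.

Lemma collar_metricE t c x y i j :
  cm t c x y i j = ghat k (g t (P c)) (pack x y) i j.
Proof. by rewrite /collar_metric mxE /ghat xcoord_pack. Qed.

Lemma pointwise_expansion t p kappa (c : chart R d N) y i j :
  has_expansion psi psi' k h X (g t) p kappa -> atlas c -> cimg c y ->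
  bigO0 p.+1 (fun x => cm t c x y i j - cyl (h c) y i j - (x ^+ p / p%:R) * kappa c y i j).
Proof.
move=> H ac cy.
have [||C [del [del0 HC]]] := H c [set y] ac; first exact: compact_set1.
  by move=> _ ->.
exists C; near=> x.
have x0 : 0 < x by near: x; exact: nbhs_right_gt.
have xd : x < del by near: x; exact: nbhs_right_lt.
have E (A B D : 'M[R]_(1 + d)) a : (A - B - a *: D) i j = A i j - B i j - a * D i j.
  by rewrite !mxE.
by have := HC x y i j x0 xd erefl; rewrite E.
Unshelve. all: by end_near. Qed.

Lemma local_extension t (c : chart R d N) y i j : times T t -> atlas c -> cimg c y ->
  exists U F, [/\ open U, U (pack t (pack 0 y)), open_smooth U F &
    forall s x y', times T s -> 0 < x -> x < width X -> cimg c y' ->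
      U (pack s (pack x y')) -> F (pack s (pack x y')) = cm s c x y' i j].
Proof.
move=> Tt ac cy; have [F0 [sF FE]] := g_smooth i j ac.
have [|U [F [Uv [oU sFU FU]]]] := sF (pack t (pack 0 y)).
  by split; rewrite ?xcoord_pack ?ycoord_pack ?xcoord_pack ?ycoord_pack ?width_gt0.
exists U, F; split=> // s x y' Ts x0 xw cy' Us.
rewrite FU//; first by rewrite FE.
by split; rewrite ?xcoord_pack ?ycoord_pack ?xcoord_pack ?ycoord_pack// ltW.
Qed.

Section Coefficient.
Variables (p : nat) (kappa : R -> chart R d N -> 'rV[R]_d -> 'M[R]_(1 + d)).
Hypothesis p_gt0 : (0 < p)%N.
Hypothesis Hk : forall t, times T t -> has_expansion psi psi' k h X (g t) p (kappa t).
Variables (c : chart R d N) (ac : atlas c).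

(** The coefficient inherits the symmetry of g and h, since it is determined
    by them. *)
Lemma kappa_sym t y : times T t -> cimg c y -> (kappa t c y)^T = kappa t c y.
Proof.
move=> Tt cy; apply/matrixP => i j; rewrite mxE.
have Hi := pointwise_expansion i j (Hk Tt) ac cy.
have Hj := pointwise_expansion j i (Hk Tt) ac cy.
have [_ gs _] := g_facts Tt ac.
have p0 : p%:R != 0 :> R by rewrite pnatr_eq0 -lt0n.
have : (kappa t c y j i - kappa t c y i j) / p%:R = 0.
  apply: (@bigO0_coef0 _ p); apply: bigO0_near (bigO0B Hi Hj).
  apply: filterS (near0_collar_dom (width_gt0 X) cy) => x Ox.
  have E : cm t c x y i j = cm t c x y j i.
    rewrite !collar_metricE /ghat; congr (_ * _).
    by have := gs _ Ox => /(congr1 (fun A : 'M[R]_(1 + d) => A j i)); rewrite mxE.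
  rewrite E (cylC (fun z => @h_sym c z ac) i j cy); field; exact: p0.
move/eqP; rewrite mulf_eq0 invr_eq0 (negbTE p0) orbF subr_eq0 => /eqP.
by [].
Qed.

Lemma background_expansion t y i j : times T t -> cimg c y ->
  bigO0 p (fun x => cm t c x y i j - cyl (h c) y i j).
Proof.
move=> Tt cy; have H := pointwise_expansion i j (Hk Tt) ac cy.
have := bigO0D (bigO0W (leqnSn p) H) (bigO0Ml (kappa t c y i j) (bigO0_eps R p)).
by apply: bigO0_ext => x; ring.
Qed.

Lemma extension_family t y : times T t -> cimg c y ->
  exists (U : 'I_(1 + d) -> 'I_(1 + d) -> set 'rV[R]_(1 + (1 + d)))
         (F : 'I_(1 + d) -> 'I_(1 + d) -> 'rV[R]_(1 + (1 + d)) -> R),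
  forall i j, [/\ open (U i j), U i j (pack t (pack 0 y)), open_smooth (U i j) (F i j) &
    forall s x y', times T s -> 0 < x -> x < width X -> cimg c y' ->
      U i j (pack s (pack x y')) -> F i j (pack s (pack x y')) = cm s c x y' i j].
Proof.
move=> Tt cy.
have H (ij : 'I_(1 + d) * 'I_(1 + d)) : exists UF :
    set 'rV[R]_(1 + (1 + d)) * ('rV[R]_(1 + (1 + d)) -> R),
  [/\ open UF.1, UF.1 (pack t (pack 0 y)), open_smooth UF.1 UF.2 &
    forall s x y', times T s -> 0 < x -> x < width X -> cimg c y' ->
      UF.1 (pack s (pack x y')) -> UF.2 (pack s (pack x y')) = cm s c x y' ij.1 ij.2].
  by have [U [F HUF]] := local_extension ij.1 ij.2 Tt ac cy; exists (U, F).
have [UF HUF] := choice H.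
by exists (fun i j => (UF (i, j)).1), (fun i j => (UF (i, j)).2) => i j; exact: (HUF (i, j)).
Qed.

(** The time derivative commutes with taking the leading coefficient of rho^2 g,
    and the flow expresses it by the curvature, whose coefficient is known. The
    result is a linear ordinary differential equation at each boundary point. *)
Lemma kappa_flow t y i j : times T t -> cimg c y ->
  has_dt T (fun s => kappa s c y i j) t
    (- 2 * flow_coef y (h c) p (kappa t c y) i j).
Proof.
move=> Tt cy; have [U [F UF]] := extension_family Tt cy.
have [gs gsy gu] := g_facts Tt ac.
have oV := open_cimg ac.
have p0 : p%:R != 0 :> R by rewrite pnatr_eq0 -lt0n.
pose u i j v := F i j (pack t v).
pose U' i j := pack t @^-1` U i j.
have uE i' j' v : U' i' j' v -> collar_dom (width X) (cimg c) v ->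
    u i' j' v = ghat k (g t (P c)) v i' j'.
  move=> Uv [v0 vw vc]; have [_ _ _ FE] := UF i' j'.
  rewrite -(packK v) /u FE//; last by move: Uv; rewrite /U' /= packK.
  by rewrite collar_metricE.
have LR := @local_ricci R d k (width X) (cimg c) y (h c) (g t (P c)) p
  (width_gt0 X) oV cy p_gt0 (h_smooth ac) (fun z => @h_sym c z ac) (fun z => @h_unit c z ac)
  (h_ricci ac cy) gs gu u U'.
have {}LR := LR (fun i j => slice_open (t := t) (let: And4 a _ _ _ := UF i j in a))
  (fun i j => let: And4 _ b _ _ := UF i j in b)
  (fun i j => slice_smooth (t := t) (let: And4 _ _ s _ := UF i j in s)) uE
  (kappa t c y) (kappa_sym Tt cy).
have {}LR := LR (fun y i j Vy => bigO0_ext (fun x => congr1 (fun z => z - _)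
   (collar_metricE t c x y i j)) (background_expansion i j Tt Vy)).
have {}LR := LR (fun i j => bigO0_ext (fun x => congr1 (fun z => z - _ - _)
   (collar_metricE t c x y i j)) (pointwise_expansion i j (Hk Tt) ac cy)) i j.
have [oU Uy sF FE] := UF i j.
have H1 : has_dt T (fun s => kappa s c y i j / p%:R) t
    (- 2 * flow_coef y (h c) p (kappa t c y) i j / p%:R).
  apply: (time_coef (b := cyl (h c) y i j) oU sF Tt Uy p_gt0) => [s Ts Us|].
    have Hs := pointwise_expansion i j (Hk Ts) ac cy.
    apply: bigO0_near Hs.
    have nU := near0_open (slice_open (t := s) oU) Us.
    apply: filterS2 nU (near0_collar_dom (width_gt0 X) cy) => x Ux [].
    rewrite xcoord_pack ycoord_pack => x0 xw _.
    by rewrite FE//; ring.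
  apply: bigO0_near (bigO0Ml (- 2) LR).
  have nU := near0_open (slice_open (t := t) oU) Uy.
  apply: filterS2 nU (near0_collar_dom (width_gt0 X) cy) => x Ux Ox.
  have [] := Ox; rewrite xcoord_pack ycoord_pack => x0 xw _.
  have aP := push_atlas X diffeo ac.
  have Px : cimg (P c) (pack x y) by rewrite (cimg_pushE X c diffeo).
  have F0 : has_dt T (fun s => g s (P c) (pack x y) i j) t
      (- 2 * (ricci (g t (P c)) (pack x y) i j + d%:R * g t (P c) (pack x y) i j)).
    exact: g_flow.
  have F1 := has_dtZ (c := rhok k x ^+ 2) Tt F0.
  have F2 : has_dt T (fun s => F i j (pack s (pack x y))) t
      (pd (lshift (1 + d) (ord0 : 'I_1)) (F i j) (pack t (pack x y))).
    apply: derive_within; apply: is_derive_pack.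
    exact: open_smooth_derivable sF Ux.
  have F3 : has_dt T (fun s => rhok k x ^+ 2 * g s (P c) (pack x y) i j) t
      (pd (lshift (1 + d) (ord0 : 'I_1)) (F i j) (pack t (pack x y))).
    apply: has_dt_near F2 => //.
    have [r r0 Ur] := box_nbhs oU Ux.
    apply/nbhs_ballP; exists r => // s; rewrite /ball /= distrC => sr Ts.
    rewrite FE//; first by rewrite /collar_metric mxE.
    by apply: Ur; rewrite // subrr normr0.
  by rewrite (has_dt_unique Tt F3 F1); field; exact: p0.
have := has_dtZ (c := p%:R) Tt H1.
rewrite (_ : (fun s => _) = (fun s => kappa s c y i j)); last first.
  by apply/funext => s; rewrite mulrC divfK.
by rewrite [p%:R * _]mulrC divfK.
Qed.

End Coefficient.

End FlowInCollar.

(** * The mass aspect and the vanishing of lower coefficients *)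

Section MassAspectAlgebra.
Variables (R : realType) (n : nat) (o : 'I_n).
Variables (G0 W0 kap : 'I_n -> 'I_n -> R) (q : nat).
Hypothesis G0C : forall i j, G0 i j = G0 j i.
Hypothesis W0C : forall i j, W0 i j = W0 j i.
Hypothesis G0o : forall j, G0 o j = dxc R o j.
Hypothesis W0o : forall j, W0 o j = dxc R o j.
Hypothesis WG : forall k j, \sum_l W0 k l * G0 l j = kron R k j.
Hypothesis kapC : forall i j, kap i j = kap j i.
Local Notation e := (dxc R o).
Local Notation Q := (q%:R : R).
Local Notation K := (ktr W0 kap).

(** The linearized flow closes on this combination of the trace and of kap o o.
    For q = n it is n times the density whose integral is the mass. *)
Definition aspect : R := Q * K + (n%:R - 1 - Q) * kap o o.

Let flow i j := vRic o G0 W0 kap q i j + (n%:R - 1) * kap i j.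

Lemma flow_oo : flow o o = - (Q - 2) / 2 * aspect.
Proof. by rewrite /flow /vRic (vGam_o G0 W0o) G0o dx_self /aspect; field. Qed.

Lemma flow_trace : \sum_i \sum_j W0 i j * flow i j = (n%:R - Q) * aspect.
Proof.
have s1 (f : 'I_n -> R) : \sum_i \sum_j W0 i j * (e i * f j) = f o.
  transitivity (\sum_i e i * \sum_j W0 i j * f j).
    by apply: eq_bigr => i _; rewrite mulr_sumr; apply: eq_bigr => j _; ring.
  by rewrite sum_dx; under eq_bigr do rewrite W0o; rewrite sum_dx.
have s2 (f : 'I_n -> R) : \sum_i \sum_j W0 i j * (e j * f i) = f o.
  rewrite exchange_big -[RHS]s1; apply: eq_bigr => i _; apply: eq_bigr => j _ /=.
  by rewrite W0C.
have s3 : \sum_i \sum_j W0 i j * G0 i j = n%:R.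
  rewrite -(trace_kron R n); apply: eq_bigr => i _; rewrite -WG.
  by apply: eq_bigr => j _; rewrite G0C.
have s4 : \sum_i \sum_j W0 i j * kap i j = K.
  by apply: eq_bigr => i _; apply: eq_bigr => j _; rewrite kapC.
pose L (f : 'I_n -> 'I_n -> R) := \sum_i \sum_j W0 i j * f i j.
have LD f f' : L (fun i j => f i j + f' i j) = L f + L f'.
  rewrite /L -big_split; apply: eq_bigr => i _; rewrite -big_split.
  by apply: eq_bigr => j _; rewrite /= mulrDr.
have LZ a f : L (fun i j => a * f i j) = a * L f.
  rewrite /L mulr_sumr; apply: eq_bigr => i _; rewrite mulr_sumr.
  by apply: eq_bigr => j _; ring.
transitivity (L (fun i j => (Q + 1 - n%:R) * Q / 2 * (e i * kap o j)
  + ((Q + 1 - n%:R) * Q / 2 * (e j * kap o i)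
  + ((Q / 2 * K - (Q + 1 - n%:R) * kap o o) * G0 i j
  + ((n%:R - 1 - Q - (Q + 1 - n%:R) * (Q - 2) / 2) * kap i j
  + (- (Q * (Q - 1) / 2 * K)) * (e i * e j)))))).
  apply: eq_bigr => i _; apply: eq_bigr => j _.
  by rewrite /flow /vRic (vGam_o G0 W0o); ring.
by rewrite !LD !LZ /L !s1 !s2 s3 s4 dx_self /aspect; field.
Qed.

Lemma flow_null i j : K = 0 -> kap o o = 0 ->
  flow i j = (Q + 1 - n%:R) * (Q / 2) * (e i * kap o j + e j * kap o i - kap i j).
Proof. by move=> K0 k0; rewrite /flow /vRic (vGam_o G0 W0o) K0 k0; field. Qed.

End MassAspectAlgebra.

Section Evolution.
Variables (R : realType) (d : nat) (M : manifold [set: 'rV[R]_(1 + d)]).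
Variables (Mt : manifold (@halfspace R d)) (N : manifold [set: 'rV[R]_d]).
Variables (psi : Mt -> M) (psi' : M -> Mt) (X : collar Mt N) (k : bool).
Variables (h : tensor2 N) (T : \bar R) (g : R -> tensor2 M).
Hypothesis T_gt0 : (0 < T)%E.
Hypothesis diffeo : interior_diffeo psi psi'.
Hypothesis h_metric : riemannian_metric h.
Hypothesis h_ricci : forall (c : chart R d N) y, atlas c -> cimg c y ->
  ricci (h c) y = ((1 + d)%:R - 2) * k%:R *: h c y.
Hypothesis g_metric : forall t, times T t -> riemannian_metric (g t).
Hypothesis g_flow : normalized_ricci_flow T g.
Hypothesis g_smooth : smooth_up_to_collar psi psi' k X T g.
Variables (p : nat) (kappa : R -> chart R d N -> 'rV[R]_d -> 'M[R]_(1 + d)).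
Hypothesis p_gt0 : (0 < p)%N.
Hypothesis Hk : forall t, times T t -> has_expansion psi psi' k h X (g t) p (kappa t).
Variables (c : chart R d N) (ac : atlas c) (y : 'rV[R]_d) (cy : cimg c y).

Local Notation o := (ox d).
Local Notation n := (1 + d)%N.
Local Notation W0 := (fun i j => invmx (cyl (h c) y) i j).
Local Notation G0 := (fun i j => cyl (h c) y i j).
Let kf t := (fun i j => kappa t c y i j).
Let S t := aspect o W0 (kf t) p.
Let K t := ktr W0 (kf t).

Let hs := fun z => @h_sym _ _ _ _ h_metric c z ac.
Let hu := fun z => @h_unit _ _ _ _ h_metric c z ac.
Let GC i j : G0 i j = G0 j i. Proof. exact: (cylC hs i j cy). Qed.
Let WC i j : W0 i j = W0 j i. Proof. exact: (W0_C cy hs). Qed.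
Let Go j : G0 o j = dxc R o j. Proof. exact: cyl_o. Qed.
Let Wo j : W0 o j = dxc R o j. Proof. exact: (W0_o cy hu). Qed.
Let WGk i j : \sum_l W0 i l * G0 l j = kron R i j. Proof. exact: (W0_G0 cy hu). Qed.
Let kC t : times T t -> forall i j, kf t i j = kf t j i.
Proof.
move=> Tt i j; have H := kappa_sym diffeo h_metric g_metric p_gt0 Hk ac Tt cy.
by rewrite /kf -{1}H mxE.
Qed.

Let flowE t i j : flow_coef y (h c) p (kappa t c y) i j =
  vRic o G0 W0 (kf t) p i j + (n%:R - 1) * kf t i j.
Proof.
rewrite /flow_coef -/(kf t) -[kappa t c y i j]/(kf t i j); congr (_ + _ * _).
by rewrite natrD; ring.
Qed.

Let kdt t i j : times T t -> has_dt T (fun s => kf s i j) t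
   (- 2 * (vRic o G0 W0 (kf t) p i j + (n%:R - 1) * kf t i j)).
Proof.
move=> Tt.
have := kappa_flow diffeo h_metric h_ricci g_metric g_flow g_smooth p_gt0 Hk ac (i := i) (j := j) Tt cy.
by rewrite flowE.
Qed.

Let Kdt t : times T t -> has_dt T K t (- 2 * ((n%:R - p%:R) * S t)).
Proof.
move=> Tt; rewrite -(flow_trace p GC WC Wo WGk (kC Tt)) exchange_big /=.
rewrite mulr_sumr (_ : K = fun s => \sum_i \sum_j W0 i j * kf s j i)//.
apply: has_dt_sum => // i; rewrite mulr_sumr; apply: has_dt_sum => // j.
by rewrite mulrCA [invmx (cyl (h c) y) j i]WC; apply: has_dtZ => //; exact: kdt.
Qed.

Let odt t : times T t -> has_dt T (fun s => kf s o o) t ((p%:R - 2) * S t).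
Proof.
move=> Tt; have := kdt (i := o) (j := o) Tt; rewrite (flow_oo (kf t) p Go Wo).
by congr (has_dt T _ t _); rewrite /S; field.
Qed.

(** The trace K and the component kappa o o both evolve by multiples of the
    aspect, which is a fixed linear combination of them. *)
Lemma aspect_evolution t : times T t -> S t =
  expR ((- 2 * p%:R * (n%:R - p%:R) + (n%:R - 1 - p%:R) * (p%:R - 2)) * t) * S 0.
Proof.
apply: (ode_linear (T := T)) => // {}t Tt.
have := has_dtD Tt (has_dtZ (c := p%:R) Tt (Kdt Tt))
  (has_dtZ (c := n%:R - 1 - p%:R) Tt (odt Tt)).
by congr (has_dt T _ t _); ring.
Qed.

(** The aspect starts at zero, hence vanishes; then the trace and the component
    o o are constant, hence zero; then the other components obey scalar linear
    equations with zero initial value. *)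
Lemma kappa_vanishes : (p < n)%N -> kappa 0 c y = 0 ->
  forall t, times T t -> kappa t c y = 0.
Proof.
move=> pn k0 t Tt.
have kf0 i j : kf 0 i j = 0 by rewrite /kf k0 mxE.
have K0 : K 0 = 0.
  by rewrite /K /ktr /kup !big1// => i _; rewrite big1// => j _; rewrite kf0 mulr0.
have S0 s : times T s -> S s = 0.
  move=> Ts; rewrite aspect_evolution// [X in _ * X](_ : _ = 0) ?mulr0//.
  by rewrite /S /aspect -/(K 0) K0 kf0 !mulr0 addr0.
have const0 (phi : R -> R) : phi 0 = 0 ->
    (forall s, times T s -> has_dt T phi s 0) -> forall s, times T s -> phi s = 0.
  move=> p0 H s Ts; rewrite (@ode_linear _ T 0 phi T_gt0 _ s Ts) ?p0 ?mulr0// => s' Ts'.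
  by rewrite mul0r; exact: H.
have Kz : forall s, times T s -> K s = 0.
  by apply: const0 => // s Ts; have := Kdt Ts; rewrite S0// !mulr0.
have oz : forall s, times T s -> kf s o o = 0.
  by apply: const0 => // s Ts; have := odt Ts; rewrite S0// mulr0.
have fl s i j : times T s -> has_dt T (fun s => kf s i j) s
   (- 2 * ((p%:R + 1 - n%:R) * (p%:R / 2) *
     (dxc R o i * kf s o j + dxc R o j * kf s o i - kf s i j))).
  move=> Ts; have := kdt (i := i) (j := j) Ts.
  by rewrite (flow_null G0 p Wo i j (Kz s Ts) (oz s Ts)).
have oj j : forall s, times T s -> kf s o j = 0.
  case: (split_ordP j) => A ->; first by rewrite (ord1 A) => s Ts; exact: (oz s Ts).
  apply: const0 => // s Ts; have := fl s o (rshift 1 A) Ts.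
  by rewrite dx_x dx_y mul1r mul0r addr0 subrr !mulr0.
apply/matrixP => i j; rewrite [RHS]mxE -[LHS]/(kf t i j).
rewrite (@ode_linear _ T ((p%:R + 1 - n%:R) * p%:R) (fun s => kf s i j) T_gt0 _ t Tt).
  by rewrite kf0 mulr0.
move=> s Ts; have := fl s i j Ts; rewrite !oj// !mulr0 addr0 sub0r.
by congr (has_dt T _ s _); field.
Qed.

End Evolution.

Section NextOrder.
Variables (R : realType) (d : nat) (M : manifold [set: 'rV[R]_(1 + d)]).
Variables (Mt : manifold (@halfspace R d)) (N : manifold [set: 'rV[R]_d]).
Variables (psi : Mt -> M) (psi' : M -> Mt) (X : collar Mt N) (k : bool).
Variables (h : tensor2 N) (T : \bar R) (g : R -> tensor2 M).
Hypothesis g_smooth : smooth_up_to_collar psi psi' k X T g.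
Variables (p : nat) (kappa : chart R d N -> 'rV[R]_d -> 'M[R]_(1 + d)) (t : R).
Hypothesis Tt : times T t.
Hypothesis p_gt0 : (0 < p)%N.
Hypothesis Hk : has_expansion psi psi' k h X (g t) p kappa.
Hypothesis kappa0 : forall (c : chart R d N) y, atlas c -> cimg c y -> kappa c y = 0.

Local Notation cm c := (collar_metric psi psi' k X (g t) c).

(** A limit is used in order to obtain a coefficient that does not depend on
    the choice of a local smooth extension of the metric. *)
Definition next_coef (c : chart R d N) (y : 'rV[R]_d) : 'M[R]_(1 + d) :=
  \matrix_(i, j) (p.+1%:R *
    lim ((cm c x y i j - cyl (h c) y i j) / x ^+ p.+1 @[x --> 0^'+])).

Let flat (c : chart R d N) y i j : atlas c -> cimg c y ->
  bigO0 p.+1 (fun x => cm c x y i j - cyl (h c) y i j).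
Proof.
move=> ac cy; apply: bigO0_ext (pointwise_expansion i j Hk ac cy) => x.
have -> : kappa c y i j = 0 by rewrite kappa0// mxE.
by rewrite mulr0 subr0.
Qed.

Lemma next_coefE (c : chart R d N) y i j a :
  bigO0 p.+2 (fun x => cm c x y i j - cyl (h c) y i j - a * x ^+ p.+1) ->
  next_coef c y i j = p.+1%:R * a.
Proof.
move=> H; rewrite mxE; congr (_ * _); apply/cvg_lim => //.
have H1 : bigO0 1 (fun x => (cm c x y i j - cyl (h c) y i j) / x ^+ p.+1 - a).
  have [C HC] := H; exists C; near=> x.
  have x0 : 0 < x by near: x; exact: nbhs_right_gt.
  have xp : 0 < x ^+ p.+1 by rewrite exprn_gt0.
  rewrite -(ler_pM2r xp) -[X in _ * X <= _](ger0_norm (ltW xp)) -normrM mulrBl.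
  rewrite divfK ?gt_eqF// expr1 -mulrA -exprS.
  by near: x.
have H2 := cvgD (bigO0_cvg0 H1) (cvg_cst a); rewrite add0r in H2.
rewrite (_ : (fun x => _) = (fun x => (cm c x y i j - cyl (h c) y i j) / x ^+ p.+1 - a + a)).
  exact: H2.
by apply/funext => x; rewrite subrK.
Unshelve. all: by end_near. Qed.

Lemma next_uniform (c : chart R d N) y1 i j : atlas c -> cimg c y1 ->
  exists C r : R, 0 < r /\ forall y x, `|y - y1| < r -> 0 < x -> x < r ->
    `|cm c x y i j - cyl (h c) y i j - (x ^+ p.+1 / p.+1%:R) * next_coef c y i j|
      <= C * x ^+ p.+2.
Proof.
move=> ac cy1.
have [U [F [oU Uy sF FE]]] := local_extension g_smooth i j Tt ac cy1.
pose u v := F (pack t v); pose U' := pack t @^-1` U.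
have oU' : open U' := slice_open (t := t) oU.
have su : open_smooth U' u := slice_smooth (t := t) sF.
have [C [r [r0 H]]] := taylor_uniform p.+1 oU' su Uy.
have [r' r'0 Hr'] := box_nbhs (x0 := 0) (open_comp (f := @ycoord R d) (D := cimg c)
  (fun v _ => @ycoord_continuous R d v) (open_cimg ac)) (y0 := y1) (eq_ind_r _ cy1 (ycoord_pack 0 y1)).
pose w := Num.min (Num.min r r') (width X).
have w0 : 0 < w by rewrite !lt_min r0 r'0 width_gt0.
exists C, w; split=> // y x.
rewrite !lt_min => /andP[/andP[yr yr'] _] x0 /andP[/andP[xr xr'] xw].
have cy : cimg c y.
  by have := Hr' 0 y; rewrite subrr normr0 /= ycoord_pack; exact.
have [UU Hy] := H y yr.
have U0 : U' (pack 0 y) by apply: UU; rewrite normr0.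
have uE : \forall x \near 0^'+, u (pack x y) = cm c x y i j.
  apply: filterS2 (near0_open oU' U0) (near0_collar_dom (width_gt0 X) cy) => z Uz [].
  by rewrite xcoord_pack ycoord_pack => z0 zw _; rewrite /u FE.
have fb : bigO0 p.+1 (fun x => u (pack x y) - cyl (h c) y i j).
  by apply: bigO0_near (flat i j ac cy); apply: filterS uE => z ->.
have van := xcoef_vanish oU' su U0 fb.
have main := Hy _ van.
have coefE : next_coef c y i j = p.+1%:R * (xcoef u p.+1 y / (p.+1)`!%:R).
  apply: next_coefE; apply: bigO0_near (expand oU' su U0 van).
  by apply: filterS uE => z ->; rewrite mulr1.
have := main x (ltW x0) xr; rewrite mulr1 coefE /u FE//; last first.
  by apply: UU; rewrite ger0_norm// ltW.
have E (a z : R) : z / p.+1%:R * (p.+1%:R * a) = a * z.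
  by rewrite mulrA divfK ?pnatr_eq0// mulrC.
by rewrite E.
Qed.

Lemma next_uniform_all (c : chart R d N) y1 : atlas c -> cimg c y1 ->
  exists C r : R, 0 < r /\ forall y x i j, `|y - y1| < r -> 0 < x -> x < r ->
    `|cm c x y i j - cyl (h c) y i j - (x ^+ p.+1 / p.+1%:R) * next_coef c y i j|
      <= C * x ^+ p.+2.
Proof.
move=> ac cy1.
have H (ij : 'I_(1 + d) * 'I_(1 + d)) : exists Cr : R * R, 0 < Cr.2 /\
    forall y x, `|y - y1| < Cr.2 -> 0 < x -> x < Cr.2 ->
    `|cm c x y ij.1 ij.2 - cyl (h c) y ij.1 ij.2
       - (x ^+ p.+1 / p.+1%:R) * next_coef c y ij.1 ij.2| <= Cr.1 * x ^+ p.+2.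
  by have [C [r HCr]] := next_uniform ij.1 ij.2 ac cy1; exists (C, r).
have [Cr HCr] := choice H.
have rs : \forall r \near (0 : R)^'+, 0 < r /\ forall ij, r < (Cr ij).2.
  have nC ij : \forall r \near (0 : R)^'+, r < (Cr ij).2.
    by apply: nbhs_right_lt; exact: (HCr ij).1.
  have FF : Filter ((0 : R)^'+) by typeclasses eauto.
  apply: filterI; first exact: nbhs_right_gt.
  exact: (@filter_forall _ _ (fun ij r => r < (Cr ij).2) _ FF nC).
have [r [r0 rr]] := filter_ex rs.
exists (\sum_ij `|(Cr ij).1|), r; split=> // y x i j yr x0 xr.
have := (HCr (i, j)).2 y x (lt_trans yr (rr _)) x0 (lt_trans xr (rr _)).
move=> /le_trans; apply; apply: ler_wpM2r; first by rewrite exprn_ge0// ltW.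
rewrite (le_trans (ler_norm _))// (bigD1 (i, j))//= lerDl.
by rewrite sumr_ge0.
Qed.

(** Taylor's formula for the smooth extensions gives bounds near each boundary
    point; compactness makes their constants uniform. *)
Lemma next_expansion : has_expansion psi psi' k h X (g t) p.+1 next_coef.
Proof.
move=> c K ac cK Kc.
pose F := filter_prod (pinfty_nbhs R) (0 : R)^'+.
pose B (Cx : R * R) (y : 'rV[R]_d) := forall i j,
     `|cm c Cx.2 y i j - cyl (h c) y i j
       - (Cx.2 ^+ p.+1 / p.+1%:R) * next_coef c y i j| <= Cx.1 * Cx.2 ^+ p.+2.
have : \forall Cx \near F, K `<=` B Cx.
  apply: (compact_near_coveringP K).1 => // y1 Ky1.
  have [C [r [r0 HC]]] := next_uniform_all ac (Kc y1 Ky1).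
  exists ([set y | `|y - y1| < r], [set Cx | C < Cx.1 /\ (0 < Cx.2 /\ Cx.2 < r)]).
    split=> /=; first by apply: near_norm r0 _ => y; rewrite distrC.
    exists ([set z | C < z], [set x | 0 < x /\ x < r]); last by move=> [z x] [].
    split=> /=; first by exists C; split; first exact: num_real.
    by apply: filterI; [exact: nbhs_right_gt|exact: nbhs_right_lt].
  move=> [y [z x]] /= [yr [Cz [x0 xr]]] i j.
  apply: le_trans (HC y x i j yr x0 xr) _.
  by apply: ler_wpM2r; [rewrite exprn_ge0// ltW|exact: ltW].
move=> [[A1 A2] /= [HA1 HA2] HA].
have [C A1C] := filter_ex HA1.
move: HA2 => /nbhs_ballP[r /= r0 Hr].
exists C, r; split=> // x y i j x0 xr Ky.
have E (A A' D : 'M[R]_(1 + d)) a : (A - A' - a *: D) i j = A i j - A' i j - a * D i j.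
  by rewrite !mxE.
rewrite E; apply: (HA (C, x)) => //; split=> //=.
by apply: Hr => //; rewrite /ball /= sub0r normrN gtr0_norm.
Qed.

End NextOrder.

(** * Auxiliary estimates for changes of coordinates *)

Section SmoothSub.
Variables (R : realType) (n : nat) (U : set 'rV[R]_n).
Hypothesis oU : open U.

Lemma pd_sub (f g : 'rV[R]_n -> R) i v : derivable f v (delta_mx 0 i) ->
  derivable g v (delta_mx 0 i) -> pd i (fun w => f w - g w) v = pd i f v - pd i g v.
Proof. by move=> fd gd; have := deriveB fd gd. Qed.

Lemma open_smooth_sub (f g : 'rV[R]_n -> R) : open_smooth U f -> open_smooth U g ->
  open_smooth U (fun w => f w - g w).
Proof.
move=> sf sg.
have E s v : U v -> iter_pd s (fun w => f w - g w) v = iter_pd s f v - iter_pd s g v.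
  elim: s v => [//|i s IH] v Uv.
  rewrite -[LHS]/(pd i (iter_pd s (fun w => f w - g w)) v).
  rewrite (near_eq_pd i (near_open oU Uv IH)) pd_sub//.
    exact: (sf s v Uv).1.
  exact: (sg s v Uv).1.
move=> s v Uv; have [fd fc] := sf s v Uv; have [gd gc] := sg s v Uv.
have nE : \forall w \near v, iter_pd s f w - iter_pd s g w = iter_pd s (fun w => f w - g w) w.
  by apply: (near_open oU Uv) => w Uw; rewrite E.
split=> [i|].
  by apply: (near_eq_derivable nE); apply: derivableB; [exact: fd|exact: gd].
rewrite /prop_for /continuous_at -(nbhs_singleton nE).
have nE' : {near v, (fun w => iter_pd s f w - iter_pd s g w) =1
   iter_pd s (fun w => f w - g w)} by [].
apply: cvg_trans (near_eq_cvg nE') _.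
exact: cvgB.
Qed.

Lemma is_derive_coord (v e : 'rV[R]_n) j : is_derive v e (fun w : 'rV[R]_n => w 0 j) (e 0 j).
Proof.
have E : \forall h \near (0 : R)^', e 0 j = h^-1 *: (((fun w : 'rV[R]_n => w 0 j) \o shift v) (h *: e) - v 0 j).
  near=> h; have h0 : h != 0 by near: h; exact: nbhs_dnbhs_neq.
  by rewrite /= !mxE addrK /GRing.scale /= mulrA mulVf ?mul1r.
have C : (fun h : R => h^-1 *: (((fun w : 'rV[R]_n => w 0 j) \o shift v) (h *: e) - v 0 j)) @ 0^' --> e 0 j.
  by apply: cvg_trans (near_eq_cvg E) _; exact: cvg_cst.
by apply: DeriveDef; [apply/cvg_ex; exists (e 0 j)|exact: cvg_lim C].
Unshelve. all: by end_near. Qed.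

Lemma pd_coord i j (v : 'rV[R]_n) : pd i (fun w : 'rV[R]_n => w 0 j) v = kron R i j.
Proof.
have [_ E] := is_derive_coord v (delta_mx 0 i) j.
by rewrite /pd E mxE eqxx /kron eq_sym.
Qed.

Lemma open_smooth_coord j : open_smooth U (fun w : 'rV[R]_n => w 0 j).
Proof.
have E2 s i i' : iter_pd (s ++ [:: i; i']) (fun w : 'rV[R]_n => w 0 j) = (fun=> 0).
  rewrite iter_pd_cat /= (_ : pd i' _ = (fun=> kron R i' j)); last first.
    by apply/funext => v; exact: pd_coord.
  rewrite (_ : pd i _ = (fun=> 0)) ?iter_pd_cst0//.
  by apply/funext => v; exact: derive_cst.
have cstP (a : R) (v : 'rV[R]_n) : (forall i, derivable (fun=> a) v (delta_mx 0 i)) /\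
    {for v, continuous (fun=> a : R)}.
  by split=> [i|]; [exact: derivable_cst|exact: cst_continuous].
move=> s v Uv; case: s => [|i s] /=.
  split=> [i|]; first by have [] := is_derive_coord v (delta_mx 0 i) j.
  exact: coord_continuous.
case/lastP: s => [|s i'].
  rewrite /= (_ : pd i _ = (fun=> kron R i j)); first exact: cstP.
  by apply/funext => w; exact: pd_coord.
rewrite -[pd i _]/(iter_pd (i :: rcons s i') _).
case/lastP E: (i :: s) => [//|s0 i0].
by rewrite -rcons_cons E -cats1 -cats1 -catA E2; exact: cstP.
Qed.

End SmoothSub.

Section RhoDifference.
Variable R : realType.

(** The mean value theorem, with rho' = 1 + O(x). *)
Lemma rhok_diff (k : bool) : exists C delta : R, 0 < delta /\
  forall a b, 0 < a -> a < delta -> 0 < b -> b < delta ->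
    `|rhok k b - rhok k a - (b - a)| <= C * (a + b) * `|b - a|.
Proof.
have [C /nbhs_ballP[r /= r0 Hr]] := drhok_sub1 R k.
exists `|C|, r; split=> //.
have key a b : 0 < a -> a <= b -> b < r ->
    `|rhok k b - rhok k a - (b - a)| <= `|C| * (a + b) * `|b - a|.
  move=> a0 ab br.
  have cont : {within `[a, b], continuous (@rhok R k)}.
    by apply: derivable_within_continuous => x _; have [] := is_derive_rhok k x.
  have [x] := MVT_segment ab (fun x _ => is_derive_rhok k x) cont.
  rewrite in_itv /= => /andP[ax xb] ->.
  have x0 : 0 < x by exact: lt_le_trans ax.
  have -> : drhok k x * (b - a) - (b - a) = (drhok k x - 1) * (b - a) by ring.
  rewrite normrM ler_wpM2r//.
  have : `|drhok k x - 1| <= C * x ^+ 1.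
    apply: Hr => //; rewrite /ball /= sub0r normrN gtr0_norm//.
    exact: le_lt_trans br.
  rewrite expr1 => /le_trans; apply.
  apply: (@le_trans _ _ (`|C| * x)).
    by apply: ler_wpM2r; [exact: ltW|exact: ler_norm].
  by apply: ler_wpM2l => //; rewrite (le_trans xb)// lerDr ltW.
move=> a b a0 ar b0 br; case: (leP a b) => [ab|/ltW ba]; first exact: key.
have E1 : rhok k b - rhok k a - (b - a) = - (rhok k a - rhok k b - (a - b)) by ring.
have E2 : b - a = - (a - b) by ring.
by rewrite E1 E2 !normrN [a + b]addrC; exact: key.
Qed.

End RhoDifference.

Section BoxNeighbourhood.
Variables (R : realType) (d : nat).

Lemma compact_box (V : set 'rV[R]_d) y0 : open V -> V y0 ->
  exists2 K : set 'rV[R]_d, compact K & K `<=` V /\ nbhs y0 K.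
Proof.
move=> oV Vy0.
have /nbhs_ballP[r /= r0 Hr] : nbhs y0 V by exact: open_nbhs_nbhs.
pose K := [set y : 'rV[R]_d | forall j, `[y0 0 j - r / 2, y0 0 j + r / 2]%classic (y 0 j)].
have r2 : 0 < r / 2 by rewrite divr_gt0.
exists K.
  exact: (@rV_compact _ d (fun j => `[y0 0 j - r / 2, y0 0 j + r / 2]%classic)
    (fun j => @segment_compact R _ _)).
split=> [y Ky|].
  apply: Hr; rewrite -ball_normE /=; apply/mx_norm_ltP => // i j.
  have := Ky j; rewrite ord1 !mxE /= in_itv /= => /andP[H1 H2].
  rewrite (@le_lt_trans _ _ (r / 2))//; last by rewrite ltr_pdivrMr// mulr_natr mulr2n ltrDl.
  by rewrite ler_norml; apply/andP; split; lra.
apply: (near_norm r2) => y /(mx_norm_ltP _ r2) H j.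
have := H 0 j; rewrite !mxE ltr_norml /= in_itv /= => /andP[H1 H2].
by apply/andP; split; lra.
Qed.

Lemma mx_norm_le_sum (A : 'rV[R]_d) : `|A| <= \sum_j `|A 0 j|.
Proof.
rewrite [X in X <= _]/Num.Def.normr /= mx_normrE.
apply: bigmax_le; first by rewrite sumr_ge0.
by move=> [i j] _ /=; rewrite ord1 (bigD1 j)//= lerDl sumr_ge0.
Qed.

End BoxNeighbourhood.

(** * The transformation law at leading order *)

Section FlatJet.
Variables (R : realType) (d : nat) (u : 'rV[R]_(1 + d) -> R) (U : set 'rV[R]_(1 + d)).
Variables (y0 : 'rV[R]_d) (q : nat).
Hypotheses (oU : open U) (su : open_smooth U u) (Uy0 : U (pack 0 y0)).
Hypothesis q_gt0 : (0 < q)%N.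
Hypothesis ub : \forall y \near y0, bigO0 q.+1 (fun x => u (pack x y)).

Let a := xcoef u q.+1 y0 / q`!%:R.

Let u0 : \forall y \near y0, u (pack 0 y) = 0.
Proof.
apply: filterS2 (near_slice oU Uy0) ub => y Uy uy.
have := xcoef_vanish (b := 0) (q := q.+1) oU su Uy.
move=> H; have := H _ 0%N (ltn0Sn _); rewrite mul0r; apply.
by apply: bigO0_ext uy => x; rewrite subr0.
Qed.

Let ub0 : \forall y \near y0, bigO0 q.+1 (fun x => u (pack x y) - u (pack 0 y)).
Proof. by apply: filterS2 u0 ub => y -> uy; apply: bigO0_ext uy => x; rewrite subr0. Qed.

Lemma flat_jet_value : bigO0 q.+2 (fun x => u (pack x y0) - a * (x ^+ q.+1 / q.+1%:R)).
Proof.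
apply: bigO0_ext (jet_value oU su Uy0 (ltn0Sn q) ub0) => x.
by rewrite (nbhs_singleton u0) subr0.
Qed.

(** Only the normal derivative lowers the order of vanishing, from x^(q+1) to
    x^q. *)
Lemma flat_jet_pd i : bigO0 q.+1 (fun x =>
  pd i u (pack x y0) - q%:R * (a * dxc R (ox d) i) * (x ^+ q / q%:R)).
Proof.
have q0 : q%:R != 0 :> R by rewrite pnatr_eq0 -lt0n.
case: (split_ordP i) => A ->; rewrite ?ord1 ?dx_x ?dx_y.
  have J := jet_dx oU su Uy0 (ltn0Sn q) ub0; rewrite -/a in J.
  apply: bigO0_near (bigO0_divx J); near=> x.
  have x0 : x != 0 by rewrite gt_eqF//; near: x; exact: nbhs_right_gt.
  by rewrite /= -/a exprS; field; rewrite q0.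
apply: bigO0_ext (jet_tangential oU su Uy0 (ltn0Sn q) ub0 [:: A]) => x.
have -> : iter_pd [:: A] (fun y => u (pack 0 y)) y0 = 0.
  rewrite (nbhs_singleton (near_eq_iter_pd [:: A] (g := fun=> 0) u0)).
  exact: derive_cst.
by rewrite mulr0 mulr0 mul0r.
Unshelve. all: by end_near. Qed.

End FlatJet.

Section TransformationLaw.
Variables (R : realType) (m : nat) (o : 'I_m) (q : nat).
Hypothesis q_gt0 : (0 < q)%N.
Variables (G0 kap kap' : 'I_m -> 'I_m -> R) (a : 'I_m -> R) (b : R).
Variables (rho : R -> R) (L F J : R -> 'I_m -> 'I_m -> R).
Hypothesis Lx : forall i j, expands q (fun x => L x i j) (fun=> G0 i j) (G0 i j) (kap' i j).
Hypothesis Fx : forall i j, expands q (fun x => F x i j) (fun=> G0 i j) (G0 i j) (kap i j).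
Hypothesis Jx : forall i j, expands q (fun x => J x i j) (fun=> kron R i j) (kron R i j)
  (q%:R * (a j * dxc R o i)).
Hypothesis rx : expands q rho (fun=> 1) 1 b.
Hypothesis law : forall i j, \forall x \near 0^'+,
  rho x ^+ 2 * L x i j = \sum_k \sum_l J x i k * F x k l * J x j l.

Local Notation e := (dxc R o).

(** Compare the coefficients of x^q/q on both sides of the transformation law
    g' = J g J^T, in which rho is the quotient of the two conformal factors. *)
Lemma leading_law i j : 2 * b * G0 i j + kap' i j =
  kap i j + q%:R * (e i * \sum_k a k * G0 k j + e j * \sum_k a k * G0 i k).
Proof.
have [_ H1] := expandsM q_gt0 (expandsM q_gt0 rx rx) (Lx i j).
have [_ H2] := expands_sum (fun k => expands_sum (fun l =>
  expandsM q_gt0 (expandsM q_gt0 (Jx i k) (Fx k l)) (Jx j l))).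
have q0 : q%:R != 0 :> R by rewrite pnatr_eq0 -lt0n.
have S0 : \sum_k \sum_l kron R i k * G0 k l * kron R j l = G0 i j.
  transitivity (\sum_k kron R i k * \sum_l kron R j l * G0 k l).
    by apply: eq_bigr => k _; rewrite mulr_sumr; apply: eq_bigr => l _; ring.
  by rewrite sum_kron sum_kron.
set c2 := \sum_k \sum_l (kron R i k * G0 k l * _ + _) in H2.
have S1 : c2 = kap i j + q%:R * (e i * \sum_k a k * G0 k j + e j * \sum_k a k * G0 i k).
  pose f1 := \sum_k kron R i k * \sum_l kron R j l * kap k l.
  pose f2 := \sum_k kron R i k * \sum_l G0 k l * (q%:R * (a l * e j)).
  pose f3 := \sum_k (q%:R * (a k * e i)) * \sum_l kron R j l * G0 k l.
  transitivity (f1 + f2 + f3).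
    rewrite /f1 /f2 /f3 -!big_split; apply: eq_bigr => k _ /=.
    rewrite !mulr_sumr -!big_split; apply: eq_bigr => l _ /=; ring.
  rewrite /f1 /f2 /f3 !sum_kron -addrA; congr (_ + _).
  rewrite mulrDr addrC; congr (_ + _).
    rewrite mulrA mulr_sumr; apply: eq_bigr => k _; rewrite sum_kron; ring.
  by rewrite mulrA mulr_sumr; apply: eq_bigr => k _; ring.
have H : bigO0 q.+1 (fun x => (c2 - ((1 * 1) * kap' i j + (1 * b + b * 1) * G0 i j)) / q%:R * x ^+ q).
  apply: bigO0_near (bigO0B H1 H2); apply: filterS (law i j) => x.
  by rewrite -expr2 => ->; rewrite S0; field.
have /eqP := bigO0_coef0 H.
rewrite mulf_eq0 invr_eq0 (negbTE q0) orbF subr_eq0 S1 => /eqP ->; ring.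
Qed.

End TransformationLaw.

Section RhoQuotient.
Variables (R : realType) (k : bool).
Local Notation r := (@rhok R k).

(** The difference of the two values of rho equals z x - x up to a relative
    error O(x), and rho x / x = 1 + O(x). *)
Lemma rhok_quotient (z : R -> R) p (a : R) : (\forall x \near 0^'+, 0 < z x) ->
  bigO0 p.+2 (fun x => z x - x - a * x ^+ p.+1) ->
  bigO0 p.+1 (fun x => r (z x) / r x - 1 - a * x ^+ p).
Proof.
move=> z0 Hz.
have Hzx : bigO0 p.+1 (fun x => z x - x).
  have := bigO0D (bigO0W (leqnSn _) Hz) (bigO0Ml a (bigO0_X R p.+1)).
  by apply: bigO0_ext => x; ring.
have Hz1 : bigO0 1 z.
  have := bigO0D (bigO0W (p := 1) _ Hzx) (bigO0_id R) => H.
  by apply: bigO0_ext (H isT) => x; ring.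
have [C [del [del0 HC]]] := rhok_diff R k.
have zd : \forall x \near 0^'+, z x < del.
  have := bigO0_cvg0 Hz1 => /cvgrPdist_lt/(_ del del0); apply: filterS => x.
  by rewrite sub0r normrN; apply: le_lt_trans; exact: ler_norm.
have H1 : bigO0 p.+2 (fun x => r (z x) - r x - (z x - x)).
  have [C' HC'] := bigO0Ml C (bigO0M (bigO0D (bigO0_id R) Hz1) Hzx).
  exists C'; near=> x.
  have x0 : 0 < x by near: x; exact: nbhs_right_gt.
  have xd : x < del by near: x; exact: nbhs_right_lt.
  have zx0 : 0 < z x by near: x.
  have zxd : z x < del by near: x.
  have HC'x : `|C * ((x + z x) * (z x - x))| <= C' * x ^+ (1 + p.+1) by near: x.
  apply: le_trans HC'x; apply: le_trans (HC x (z x) x0 xd zx0 zxd) _.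
  rewrite !normrM (gtr0_norm (addr_gt0 x0 zx0)) -mulrA.
  by apply: ler_wpM2r; [rewrite mulr_ge0// addr_ge0// ltW|exact: ler_norm].
have H2 := bigO0D H1 Hz.
have m0 := bigO0_inv (oner_neq0 R) (rhok_ratio R k).
have K1 := bigO0_M0 (bigO0_divx H2) m0.
have K2 := bigO0Ml (- a) (bigO0_M1 (bigO0_M0 (rhok_ratio R k) m0) (bigO0_X R p)).
apply: bigO0_near (bigO0D K1 K2); near=> x.
have x0 : 0 < x by near: x; exact: nbhs_right_gt.
have rx0 := rhok_gt0 k x0.
by rewrite !exprS; field; rewrite !gt_eqF.
Unshelve. all: by end_near. Qed.

End RhoQuotient.

Section AspectOfMassForm.
Variables (R : realType) (d : nat) (hN : 'rV[R]_d -> 'M[R]_d) (V : set 'rV[R]_d).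
Variable y0 : 'rV[R]_d.
Hypothesis Vy0 : V y0.
Hypothesis hunit : forall y, V y -> hN y \in unitmx.
Variables (kap : 'M[R]_(1 + d)) (kap' : 'M[R]_d) (a : 'I_(1 + d) -> R).
Local Notation n := ((1 + d)%:R : R).
Local Notation o := (ox d).
Local Notation e := (dxc R (ox d)).
Local Notation G0 := (fun i j => cyl hN y0 i j).
Local Notation W0 := (fun i j => invmx (cyl hN y0) i j).
Hypothesis law : forall i j,
  2 * (n * (a o / (n + 1))) * G0 i j + block_mx 0 0 0 kap' i j =
  kap i j + n * (e i * \sum_k a k * G0 k j + e j * \sum_k a k * G0 i k).

(** After the change of coordinates the component o o of the coefficient is 0,
    which determines a o from kap o o. The tangential components of the law
    then read kap' = kap + (kap o o / n) h. *)
Lemma trace_mass_form : \tr (invmx (hN y0) *m kap') =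
  aspect o W0 (fun i j => kap i j) (1 + d) / n.
Proof.
have n0 : n != 0 by rewrite pnatr_eq0.
have n1 : n + 1 != 0 by rewrite natr1 pnatr_eq0.
have s1 : \sum_k a k * G0 k o = a o.
  by rewrite sum_ord1d cyl_o dx_x mulr1 big1 ?addr0// => A _; rewrite cyl_rl mulr0.
have s2 : \sum_k a k * G0 o k = a o.
  rewrite sum_ord1d cyl_o dx_x mulr1 big1 ?addr0// => A _.
  by rewrite cyl_o dx_y mulr0.
have Eoo : 2 * (n * (a o / (n + 1))) = kap o o + 2 * n * a o.
  have := law o o; rewrite s1 s2 cyl_o dx_x mulr1 !mul1r.
  have -> : (block_mx 0 0 0 kap' : 'M[R]_(1 + d)) o o = 0 by rewrite block_mxEul mxE.
  by rewrite addr0 => ->; ring.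
have Eb : 2 * (n * (a o / (n + 1))) = - (kap o o / n).
  have K : kap o o = 2 * (n * (a o / (n + 1))) - 2 * n * a o by rewrite Eoo; ring.
  by rewrite K; move: n0 n1; generalize n => z z0 z1; field; rewrite z0.
have Err A B : kap' A B = kap (rshift 1 A) (rshift 1 B) + kap o o / n * hN y0 A B.
  have := law (rshift 1 A) (rshift 1 B).
  have -> : (block_mx 0 0 0 kap' : 'M[R]_(1 + d)) (rshift 1 A) (rshift 1 B) = kap' A B.
    by rewrite block_mxEdr.
  rewrite Eb cyl_rr !dx_y !mul0r addr0 mulr0 addr0 => <-; ring.
have tI : \sum_A \sum_B invmx (hN y0) A B * hN y0 B A = d%:R.
  have := mxtrace1 R d; rewrite -(mulVmx (hunit Vy0)) => <-.
  by apply: eq_bigr => A _; rewrite mxE.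
have T : \tr (invmx (hN y0) *m kap') =
    \sum_A \sum_B invmx (hN y0) A B * kap (rshift 1 B) (rshift 1 A) + kap o o / n * d%:R.
  rewrite -tI mulr_sumr -big_split; apply: eq_bigr => A _; rewrite mxE.
  rewrite mulr_sumr -big_split; apply: eq_bigr => B _ /=; rewrite Err; ring.
have K : ktr W0 (fun i j => kap i j) =
    kap o o + \sum_A \sum_B invmx (hN y0) A B * kap (rshift 1 B) (rshift 1 A).
  rewrite /ktr /kup sum_ord1d; congr (_ + _).
    rewrite sum_ord1d (W0_o Vy0 hunit) dx_x mul1r big1 ?addr0// => A _.
    by rewrite (W0_o Vy0 hunit) dx_y mul0r.
  apply: eq_bigr => A _; rewrite sum_ord1d (W0_rl Vy0 hunit) mul0r add0r.
  by apply: eq_bigr => B _; rewrite (W0_rr Vy0 hunit).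
rewrite /aspect K T; have nE : n = 1 + d%:R by rewrite natrD.
by move: n0; rewrite !nE => n0; field.
Qed.

End AspectOfMassForm.

Section MassFormExpansion.
Variables (R : realType) (d : nat) (M : manifold [set: 'rV[R]_(1 + d)]).
Variables (Mt : manifold (@halfspace R d)) (N : manifold [set: 'rV[R]_d]).
Variables (psi : Mt -> M) (psi' : M -> Mt) (X : collar Mt N) (k : bool).
Variables (h : tensor2 N) (g : tensor2 M) (kappa : tensor2 N).
Hypothesis form : mass_form psi psi' k h X g kappa.

Lemma mass_form_expansion (c : chart R d N) y i j : atlas c -> cimg c y ->
  bigO0 (1 + d).+1 (fun x => collar_metric psi psi' k X g c x y i j - cyl (h c) y i j
    - (x ^+ (1 + d) / (1 + d)%:R) * (block_mx 0 0 0 (kappa c y) : 'M[R]_(1 + d)) i j).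
Proof.
move=> ac cy; have [form1 form2] := form.
have near1 : \forall x \near (0 : R)^'+, let G := collar_metric psi psi' k X g c x y in
    [/\ ulsubmx G = 1%:M, ursubmx G = 0 & dlsubmx G = 0].
  near=> x.
  have x0 : 0 < x by near: x; exact: nbhs_right_gt.
  have xw : x < width X by near: x; apply: nbhs_right_lt; exact: width_gt0.
  exact: form1.
case: (split_ordP i) => A ->; case: (split_ordP j) => B ->.
- apply: bigO0_near (bigO0_0 R _); apply: filterS near1 => x [E _ _].
  have {}E := congr1 (fun Z : 'M[R]_1 => Z A B) E; move: E; rewrite [LHS]mxE [LHS]mxE => ->.
  by rewrite /cyl !block_mxEul; rewrite [X in _ * X]mxE mulr0 subr0 subrr.
- apply: bigO0_near (bigO0_0 R _); apply: filterS near1 => x [_ E _].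
  have {}E := congr1 (fun Z : 'M[R]_(1, d) => Z A B) E; move: E; rewrite [LHS]mxE [LHS]mxE => ->.
  by rewrite /cyl !block_mxEur; rewrite [X in _ * X]mxE mulr0 subr0 subrr.
- apply: bigO0_near (bigO0_0 R _); apply: filterS near1 => x [_ _ E].
  have {}E := congr1 (fun Z : 'M[R]_(d, 1) => Z A B) E; move: E; rewrite [LHS]mxE [LHS]mxE => ->.
  by rewrite /cyl !block_mxEdl; rewrite [X in _ * X]mxE mulr0 subr0 subrr.
have [||C [del [del0 HC]]] := form2 c [set y] ac; first exact: compact_set1.
  by move=> _ ->.
exists C; near=> x.
have x0 : 0 < x by near: x; exact: nbhs_right_gt.
have xd : x < del by near: x; exact: nbhs_right_lt.
have E (Z : 'M[R]_(1 + d)) (D K : 'M[R]_d) u : (drsubmx Z - D - u *: K) A B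
    = Z (rshift 1 A) (rshift 1 B) - D A B - u * K A B by rewrite !mxE.
have := HC x y A B x0 xd erefl; rewrite E.
by rewrite cyl_rr block_mxEdr.
Unshelve. all: by end_near. Qed.

End MassFormExpansion.

(** * Change of collar coordinates *)

Section CollarChange.
Variables (R : realType) (d : nat) (M : manifold [set: 'rV[R]_(1 + d)]).
Variables (Mt : manifold (@halfspace R d)) (N : manifold [set: 'rV[R]_d]).
Variables (psi : Mt -> M) (psi' : M -> Mt) (X X' : collar Mt N) (k : bool).
Variables (h : tensor2 N) (T : \bar R) (g : R -> tensor2 M) (t : R).
Hypothesis diffeo : interior_diffeo psi psi'.
Hypothesis h_metric : riemannian_metric h.
Hypothesis g_metric : riemannian_metric (g t).
Hypothesis g_smooth : smooth_up_to_collar psi psi' k X T g.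
Hypothesis Tt : times T t.
Variables (kappa : chart R d N -> 'rV[R]_d -> 'M[R]_(1 + d)) (kappa' : tensor2 N).
Hypothesis Hk : has_expansion psi psi' k h X (g t) (1 + d) kappa.
Hypothesis change : collar_change X X'.
Hypothesis form : mass_form psi psi' k h X' (g t) kappa'.
Variables (c : chart R d N) (ac : atlas c) (y0 : 'rV[R]_d) (cy : cimg c y0).

Local Notation n := (1 + d)%N.
Local Notation o := (ox d).
Local Notation e := (dxc R (ox d)).
Local Notation C := (collar_chart X c).
Local Notation C' := (collar_chart X' c).
Local Notation P := (push_chart psi psi' C).
Local Notation P' := (push_chart psi psi' C').

(** The change of coordinates from those of X' to those of X. *)
Let Phi (v : 'rV[R]_(1 + d)) : 'rV[R]_(1 + d) := cmap C (cinv C' v).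
Let S := cmap C' @` (cdom C' `&` cdom C).

Let PhiE x y : Phi (pack x y) = cmap C (chi X' x (cinv c y)).
Proof. by rewrite /Phi cinv_collar. Qed.

Lemma change_box : exists (K : set 'rV[R]_d) (del : R),
  [/\ nbhs y0 K, K `<=` cimg c, 0 < del,
   forall x y, 0 < x -> x < del -> K y -> x < width X' /\ cdom C (chi X' x (cinv c y)) &
   forall y j, K y -> bigO0 n.+1 (fun x => Phi (pack x y) 0 j - pack x y 0 j)].
Proof.
have [K cK [Kc nK]] := compact_box (open_cimg ac) cy.
have [change1 change2] := change.
have [del [del0 Hdel]] := change1 c K ac cK Kc.
have [A [del' [del'0 Hdel']]] := change2 c K ac cK Kc.
exists K, (Num.min del (width X')); split=> //; first by rewrite lt_min del0 width_gt0.
  by move=> x y x0; rewrite lt_min => /andP[xd xw] Ky; split=> //; exact: Hdel.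
move=> y j Ky; exists A; near=> x.
have x0 : 0 < x by near: x; exact: nbhs_right_gt.
have xd : x < del' by near: x; exact: nbhs_right_lt.
have := Hdel' x y 0 j x0 xd Ky; rewrite PhiE.
by rewrite [X in `|X| <= _]mxE [X in _ + X]mxE.
Unshelve. all: by end_near. Qed.

Lemma pack_cvg : pack x y0 @[x --> (0:R)^'+] --> pack 0 y0.
Proof.
move=> A /= /nbhs_ballP[r /= r0 Hr].
change (\forall x \near (0 : R)^'+, A (pack x y0)); near=> x.
suff H : `|pack 0 y0 - pack x y0| < r by apply: Hr; rewrite -ball_normE.
rewrite packB subrr norm_pack// normr0; split=> //; rewrite sub0r normrN gtr0_norm.
  by near: x; exact: nbhs_right_lt.
by near: x; exact: nbhs_right_gt.
Unshelve. all: by end_near. Qed.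

Lemma change_cvg : Phi (pack x y0) @[x --> (0:R)^'+] --> pack 0 y0.
Proof.
have [K [del [nK Kc del0 Hdel HPhi]]] := change_box.
have Ky0 := nbhs_singleton nK.
have px0 := pack_cvg.
have Hj j : Phi (pack x y0) 0 j - pack x y0 0 j @[x --> 0^'+] --> (0 : R).
  by apply: bigO0_cvg0; apply: bigO0W (HPhi y0 j Ky0).
move=> A /= /nbhs_ballP[r /= r0 Hr].
change (\forall x \near (0 : R)^'+, A (Phi (pack x y0))).
have r2 : 0 < r / 2 by rewrite divr_gt0.
have FF : Filter ((0 : R)^'+) by typeclasses eauto.
have H1 : \forall x \near (0 : R)^'+, forall j, `|Phi (pack x y0) 0 j - pack x y0 0 j| < r / 2.
  apply: (@filter_forall _ _ (fun j x => `|Phi (pack x y0) 0 j - pack x y0 0 j| < r / 2) _ FF) => j.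
  have := Hj j => /cvgrPdist_lt/(_ _ r2); apply: filterS => x.
  by rewrite sub0r normrN.
have H2 : \forall x \near (0 : R)^'+, `|pack 0 y0 - pack x y0| < r / 2.
  have H2 : \forall x \near (0 : R)^'+, ball (pack 0 y0) (r / 2) (pack x y0) :=
    px0 (ball (pack 0 y0) (r / 2)) (nbhsx_ballx _ _ r2).
  by apply: filterS H2 => x; rewrite -ball_normE.
apply: filterS2 H1 H2 => x K1 K2; apply: Hr; rewrite -ball_normE /=.
have rE : r = r / 2 + r / 2 by field.
rewrite -(subrKA (pack x y0)) (le_lt_trans (ler_normD _ _))// rE ltrD//.
rewrite distrC; apply/mx_norm_ltP => // i j; rewrite ord1 [X in `|X|]mxE [X in _ + X]mxE.
exact: K1.
Qed.

(** Both sides are limits of the points chi X' x (cinv c y0) as x tends to 0: in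
    the coordinates of X as well as of X' these points tend to (0, y0). Hence the
    change of coordinates is defined, and smooth, up to the boundary. *)
Lemma change_boundary : chi X' 0 (cinv c y0) = chi X 0 (cinv c y0).
Proof.
have [K [del [nK Kc del0 Hdel HPhi]]] := change_box.
have Ky0 := nbhs_singleton nK.
have [cdy cmy] := cimg_cdom ac cy.
have inC (Y : collar Mt N) x : 0 <= x -> x < width Y -> cimg (collar_chart Y c) (pack x y0).
  move=> x0 xw; exists (chi Y x (cinv c y0)); first exact: cdom_collar.
  by rewrite (cmap_collar c _ x0 xw) cmy.
have cont (Y : collar Mt N) (gam : R -> 'rV[R]_(1 + d)) :
    (\forall x \near 0^'+, cimg (collar_chart Y c) (gam x)) ->
    gam x @[x --> 0^'+] --> pack 0 y0 ->
    cinv (collar_chart Y c) (gam x) @[x --> 0^'+] --> chi Y 0 (cinv c y0).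
  move=> gC g0.
  have [_ _ _ _ /subspace_continuousP] := atlas_is_chart (collar_atlasE Y ac).
  move=> /(_ _ (inC Y 0 (lexx _) (width_gt0 Y))); rewrite -(cinv_collar Y c 0 y0).
  move=> H B HB; have {}H : nbhs (pack 0 y0) [set v | cimg (collar_chart Y c) v ->
      B (cinv (collar_chart Y c) v)] by exact: (H B HB).
  have {}H : \forall x \near 0^'+, cimg (collar_chart Y c) (gam x) ->
      B (cinv (collar_chart Y c) (gam x)) := g0 _ H.
  change (\forall x \near 0^'+, B (cinv (collar_chart Y c) (gam x))).
  by apply: filterS2 H gC => x H1 /H1.
have px0 := pack_cvg.
have near_del : \forall x \near (0 : R)^'+, 0 < x /\ x < del.
  by apply: filterI; [exact: nbhs_right_gt|exact: nbhs_right_lt].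
have c1 := cont X' (fun x => pack x y0) _ px0.
have {}c1 : chi X' x (cinv c y0) @[x --> (0 : R)^'+] --> chi X' 0 (cinv c y0).
  have {}c1 := c1 _; have E : (fun x : R => chi X' x (cinv c y0)) = (fun x => cinv C' (pack x y0)).
    by apply/funext => x; rewrite -(cinv_collar X' c x y0).
  rewrite E; apply: c1; apply: filterS near_del => x [x0 xd].
  by apply: inC; [exact: ltW|have [] := Hdel x y0 x0 xd Ky0].
have P0 := change_cvg.
have c2 : chi X' x (cinv c y0) @[x --> (0 : R)^'+] --> chi X 0 (cinv c y0).
  have near_C : \forall x \near (0:R)^'+, cdom C (chi X' x (cinv c y0)).
    by apply: filterS near_del => x [x0 xd]; have [] := Hdel x y0 x0 xd Ky0.
  have := cont X (fun x => Phi (pack x y0)) _ P0; move=> H.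
  have {}H := H _.
  have HH : cinv C (Phi (pack x y0)) @[x --> (0:R)^'+] --> chi X 0 (cinv c y0).
    by apply: H; apply: filterS near_C => x Cx; rewrite PhiE; exists (chi X' x (cinv c y0)).
  apply: cvg_trans HH; apply: near_eq_cvg; apply: filterS near_C => x Cx.
  have [_ _ CK _ _] := atlas_is_chart (collar_atlasE X ac).
  by rewrite PhiE CK.
have FF : ProperFilter (chi X' x (cinv c y0) @[x --> (0 : R)^'+]) by typeclasses eauto.
exact: (cvg_unique (@mspace_hausdorff _ _ _ Mt) c1 c2).
Unshelve. all: by end_near. Qed.

Let S_bdry : S (pack 0 y0).
Proof.
have [cdy cmy] := cimg_cdom ac cy.
have w0 (Y : collar Mt N) : cdom (collar_chart Y c) (chi Y 0 (cinv c y0)).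
  by apply: cdom_collar => //; exact: width_gt0.
exists (chi X' 0 (cinv c y0)); first by split; [exact: w0|rewrite change_boundary; exact: w0].
by rewrite (cmap_collar c _ (lexx _) (width_gt0 X')) cmy.
Qed.

Let S_in x y : 0 < x -> x < width X' -> cimg c y -> cdom C (chi X' x (cinv c y)) ->
  S (pack x y).
Proof.
move=> x0 xw /(cimg_cdom ac)[cdy cmy] Cx.
exists (chi X' x (cinv c y)); first by split=> //; exact: cdom_collar (ltW x0) xw cdy.
by rewrite (cmap_collar c _ (ltW x0) xw) cmy.
Qed.

Lemma change_extension j : exists (U : set 'rV[R]_(1 + d)) (F : 'rV[R]_(1 + d) -> R),
  [/\ open U, open_smooth U F, U (pack 0 y0) & forall w, U w -> S w -> F w = Phi w 0 j].
Proof.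
have [U [F [Uy [oU sF FE]]]] :=
  atlas_compatible (collar_atlasE X' ac) (collar_atlasE X ac) j S_bdry.
by exists U, F.
Qed.

Let transitionE w : cimg P' w -> transition P' P w = Phi w.
Proof.
by move=> Pw; have [iw _] := cimg_push_interior diffeo ac Pw; rewrite /transition /= (psiK diffeo).
Qed.

(** The components of the change of coordinates extend smoothly across x = 0
    and differ from the identity by O(x^(n+1)), with leading coefficients a j
    / (n + 1). *)
Lemma change_jets : exists a : 'I_(1 + d) -> R,
  (forall j, bigO0 n.+2 (fun x =>
     Phi (pack x y0) 0 j - pack x y0 0 j - a j * (x ^+ n.+1 / n.+1%:R))) /\
  forall i j, expands n (fun x => jacobian_mx (transition P' P) (pack x y0) i j)
    (fun=> kron R i j) (kron R i j) (n%:R * (a j * dxc R o i)).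
Proof.
have [K [del [nK Kc del0 Hdel HPhi]]] := change_box.
have n0 : (0 < n)%N by [].
suff H (j : 'I_(1 + d)) : exists aj,
    bigO0 n.+2 (fun x => Phi (pack x y0) 0 j - pack x y0 0 j - aj * (x ^+ n.+1 / n.+1%:R)) /\
    forall i, expands n (fun x => jacobian_mx (transition P' P) (pack x y0) i j)
      (fun=> kron R i j) (kron R i j) (n%:R * (aj * dxc R o i)).
  by have [a Ha] := choice H; exists a; split=> [j|i j]; have [] := Ha j.
have [U [F [oU sF Uy FE]]] := change_extension j.
pose u w := F w - w 0 j.
have su : open_smooth U u by apply: open_smooth_sub => //; exact: open_smooth_coord.
pose Q := collar_dom del (K^°).
have oQ : open Q by apply: open_collar_dom; exact: open_interior.
have QS w : Q w -> S w /\ cimg P' w.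
  move=> [w0 wd Kw]; have {}Kw := interior_subset Kw.
  have [ww Cw] := Hdel _ _ w0 wd Kw.
  rewrite (cimg_pushE X' c diffeo) -(packK w); split; first by apply: S_in => //; exact: Kc.
  by split; rewrite ?xcoord_pack ?ycoord_pack//; exact: Kc.
have near_Q y : K^° y -> \forall x \near 0^'+, Q (pack x y).
  by move=> Ky; exact: near0_collar_dom.
have nKi : \forall y \near y0, K^° y by apply: nbhs_interior.
have uE w : U w -> Q w -> u w = Phi w 0 j - w 0 j.
  by move=> Uw /QS[Sw _]; rewrite /u FE.
have ub : \forall y \near y0, bigO0 n.+1 (fun x => u (pack x y)).
  apply: filterS2 nKi (near_slice oU Uy) => y Ky Uy'.
  apply: bigO0_near (HPhi y j (interior_subset Ky)).
  by apply: filterS2 (near0_open oU Uy') (near_Q y Ky) => x Ux Qx; rewrite uE.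
have nUQ : \forall x \near 0^'+, U (pack x y0) /\ Q (pack x y0).
  by apply: filterI; [exact: near0_open|exact: near_Q (nbhs_singleton nKi)].
exists (xcoef u n.+1 y0 / n`!%:R); split.
  apply: bigO0_near (flat_jet_value oU su Uy ub).
  by apply: filterS nUQ => x [Ux Qx]; rewrite uE.
move=> i; split; first by apply: bigO0_ext (bigO0_0 R _) => x; rewrite subrr.
apply: bigO0_near (flat_jet_pd oU su Uy n0 ub i).
apply: filterS nUQ => x [Ux Qx]; congr (_ - _).
rewrite [jacobian_mx _ _ _ _]mxE.
have E : \forall w \near pack x y0, transition P' P w 0 j = F w.
  have oUQ : open (U `&` Q) by exact: openI.
  apply: (near_open oUQ) => // w [Uw Qw].
  by have [Sw Pw] := QS w Qw; rewrite transitionE// FE.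
rewrite (near_eq_pd i E) /u pd_sub ?pd_coord//.
  exact: open_smooth_derivable sF Ux.
by have [] := is_derive_coord (pack x y0) (delta_mx 0 i) j.
Qed.

Let near_change : \forall x \near 0^'+,
  [/\ 0 < x, x < width X', cimg P' (pack x y0), cdom C (cinv C' (pack x y0)) &
     collar_dom (width X) (cimg c) (Phi (pack x y0))].
Proof.
have [K [del [nK Kc del0 Hdel HPhi]]] := change_box.
have Ky0 := nbhs_singleton nK.
near=> x.
have x0 : 0 < x by near: x; exact: nbhs_right_gt.
have xd : x < del by near: x; exact: nbhs_right_lt.
have [xw Cx] := Hdel x y0 x0 xd Ky0.
have Px : cimg P' (pack x y0).
  by rewrite (cimg_pushE X' c diffeo); split; rewrite ?xcoord_pack ?ycoord_pack.
have {}Cx : cdom C (cinv C' (pack x y0)) by rewrite (cinv_collar X' c x y0).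
split=> //.
have [ix _] := cimg_push_interior diffeo ac Px.
have [x' [y' [x'0 x'w cy' E]]] := (interior_collarE Cx).1 ix.
rewrite /Phi E (cmap_collar c y' (ltW x'0) x'w).
by split; rewrite ?xcoord_pack ?ycoord_pack//; exists y'.
Unshelve. all: by end_near. Qed.

Lemma change_norm : bigO0 n.+1 (fun x => `|Phi (pack x y0) - pack x y0|).
Proof.
have [K [del [nK Kc del0 Hdel HPhi]]] := change_box.
have Ky0 := nbhs_singleton nK.
have HN j : bigO0 n.+1 (fun x => `|Phi (pack x y0) 0 j - pack x y0 0 j|).
  by have [A HA] := HPhi y0 j Ky0; exists A; apply: filterS HA => x; rewrite normr_id.
have [A HA] := bigO0_sum (index_enum _) HN; exists A; apply: filterS HA => x.
apply: le_trans; rewrite normr_id (le_trans (mx_norm_le_sum _))//.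
rewrite [X in _ <= X]ger0_norm ?sumr_ge0// le_eqVlt; apply/orP; left; apply/eqP.
by apply: eq_bigr => j _; rewrite [(Phi _ - _) 0 j]mxE [X in _ + X]mxE.
Qed.

(** Moving the point by O(x^(n+1)) changes the smooth function rho^2 g by
    O(x^(n+1)), which does not affect the coefficient. *)
Lemma metric_after_change i j : expands n
  (fun x => ghat k (g t P) (Phi (pack x y0)) i j)
  (fun=> cyl (h c) y0 i j) (cyl (h c) y0 i j) (kappa c y0 i j).
Proof.
split; first by apply: bigO0_ext (bigO0_0 R _) => x; rewrite subrr.
have [U [F [oU Uy sF FE]]] := local_extension g_smooth i j Tt ac cy.
pose u v := F (pack t v); pose U' := pack t @^-1` U.
have oU' : open U' := slice_open (t := t) oU.
have su : open_smooth U' u := slice_smooth (t := t) sF.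
have uE v : U' v -> collar_dom (width X) (cimg c) v -> u v = ghat k (g t P) v i j.
  move=> Uv [v0 vw vc]; rewrite -(packK v) /u FE//; first by rewrite collar_metricE.
  by move: Uv; rewrite /U' /= packK.
have [A [r [r0 lip]]] := locally_lipschitz oU' su Uy.
have nP : \forall x \near (0 : R)^'+, U' (Phi (pack x y0)) /\ `|Phi (pack x y0) - pack 0 y0| < r.
  have HH : \forall w \near pack 0 y0, U' w /\ `|w - pack 0 y0| < r.
    apply: filterI; first exact: open_nbhs_nbhs.
    by apply: (near_norm r0) => w; rewrite distrC.
  exact: change_cvg HH.
have np : \forall x \near (0 : R)^'+, U' (pack x y0) /\ `|pack x y0 - pack 0 y0| < r.
  have HH : \forall w \near pack 0 y0, U' w /\ `|w - pack 0 y0| < r.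
    apply: filterI; first exact: open_nbhs_nbhs.
    by apply: (near_norm r0) => w; rewrite distrC.
  exact: pack_cvg HH.
have H1 : bigO0 n.+1 (fun x => u (Phi (pack x y0)) - u (pack x y0)).
  have [D HD] := bigO0Ml A change_norm; exists D.
  apply: filterS2 (filterI nP np) HD => x [[_ d1] [_ d2]]; apply: le_trans.
  exact: le_trans (lip _ _ d2 d1) (ler_norm _).
have H2 := pointwise_expansion i j Hk ac cy.
have near_om := near0_collar_dom (width_gt0 X) cy.
apply: bigO0_near (bigO0D H1 H2).
apply: filterS2 (filterI nP np) (filterI near_change near_om) => x [[U1 _] [U2 _]].
move=> [[x0 xw Px Cx PhiO] xO].
by rewrite !uE// collar_metricE; ring.
Qed.

Lemma metric_before_change i j : expands n
  (fun x => collar_metric psi psi' k X' (g t) c x y0 i j)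
  (fun=> cyl (h c) y0 i j) (cyl (h c) y0 i j)
  ((block_mx 0 0 0 (kappa' c y0) : 'M[R]_(1 + d)) i j).
Proof.
split; first by apply: bigO0_ext (bigO0_0 R _) => x; rewrite subrr.
by apply: bigO0_ext (mass_form_expansion form i j ac cy) => x; rewrite [X in _ - X]mulrC.
Qed.

Lemma covariance_near i j : \forall x \near 0^'+,
  (rhok k (xcoord (Phi (pack x y0))) / rhok k x) ^+ 2 *
    collar_metric psi psi' k X' (g t) c x y0 i j =
  \sum_a \sum_b jacobian_mx (transition P' P) (pack x y0) i a *
    ghat k (g t P) (Phi (pack x y0)) a b * jacobian_mx (transition P' P) (pack x y0) j b.
Proof.
have [aP aP'] := (push_atlas X diffeo ac, push_atlas X' diffeo ac).
apply: filterS near_change => x [x0 xw Px Cx [Phi0 _ _]].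
have [ix _] := cimg_push_interior diffeo ac Px.
have cP : cdom P (cinv P' (pack x y0)).
  rewrite (cdom_pushE X c diffeo) -[cinv P' _]/(psi (cinv C' (pack x y0))).
  by rewrite /preimage /= (psiK diffeo).
have HI : [set: 'rV[R]_(1 + d)]° (pack x y0) by rewrite interiorT.
have cov := g_metric.1 P' P (pack x y0) aP' aP Px HI cP.
rewrite (transitionE Px) in cov.
rewrite /collar_metric cov.
set J := jacobian_mx _ _; set G := g t P (Phi (pack x y0)).
have rx := rhok_gt0 k x0; have rP := rhok_gt0 k Phi0.
have E (a : R) : (a *: (J *m G *m J^T)) i j = \sum_m \sum_b a * (J i m * G m b * J j b).
  rewrite !mxE exchange_big mulr_sumr; apply: eq_bigr => b _.
  rewrite !mxE mulr_suml mulr_sumr; apply: eq_bigr => m _; ring.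
rewrite E mulr_sumr; apply: eq_bigr => m _; rewrite mulr_sumr; apply: eq_bigr => b _.
rewrite /ghat -/G; field.
by rewrite gt_eqF.
Qed.

(** The mass density of g, which is defined in normalized coordinates, is thus
    read off in the fixed collar coordinates. *)
Lemma mass_aspect_of_change : \tr (invmx (h c y0) *m kappa' c y0) =
  aspect o (fun i j => invmx (cyl (h c) y0) i j) (fun i j => kappa c y0 i j) n / n%:R.
Proof.
have [a [Ha HJ]] := change_jets.
have near_pos : \forall x \near 0^'+, 0 < xcoord (Phi (pack x y0)).
  by apply: filterS near_change => x [_ _ _ _ []].
have HR : bigO0 n.+1 (fun x => rhok k (xcoord (Phi (pack x y0))) / rhok k x - 1
    - a o / n.+1%:R * x ^+ n).
  apply: rhok_quotient near_pos _.
  apply: bigO0_ext (Ha o) => x; rewrite packl -[Phi _ 0 o]/(xcoord _); ring.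
have n0 : n%:R != 0 :> R by rewrite pnatr_eq0.
have ER : expands n (fun x => rhok k (xcoord (Phi (pack x y0))) / rhok k x) (fun=> 1) 1
    (n%:R * (a o / n.+1%:R)).
  split; first by apply: bigO0_ext (bigO0_0 R _) => x; rewrite subrr.
  apply: bigO0_ext HR => x; congr (_ - _).
  have E (al w z : R) : z != 0 -> al * w = z * al * (w / z) by move=> z0; field.
  exact: E.
have law := leading_law (isT : (0 < n)%N) metric_before_change metric_after_change HJ ER
  covariance_near.
apply: (trace_mass_form (V := cimg c) cy (fun y => @h_unit _ _ _ _ h_metric c y ac)).
by move=> i j; have := law i j; rewrite natr1; exact.
Qed.

End CollarChange.

(** * The integral of a positive multiple *)

Section IntegralScaling.
Local Open Scope ereal_scope.
Context {disp : measure_display} {T : measurableType disp} {R : realType}.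
Variable mu : {measure set T -> \bar R}.
Import HBNNSimple.

Let ge0_integral_scale_le (f : T -> \bar R) (c : R) : (0 < c)%R -> (forall x, 0 <= f x) ->
  c%:E * \int[mu]_x f x <= \int[mu]_x (c%:E * f x).
Proof.
move=> c0 f0; rewrite -lee_pdivlMl// ge0_integralTE// ge0_integralTE; last first.
  by move=> x; rewrite mule_ge0// lee_fin ltW.
apply: ub_ereal_sup => _ [u /= uf <-]; rewrite lee_pdivlMl// -sintegralrM.
apply: ereal_sup_ubound; exists (scale_nnsfun u (ltW c0)) => //= x.
by rewrite EFinM lee_pmul2l// ?lte_fin//; exact: uf.
Qed.

Let ge0_integral_scale (f : T -> \bar R) (c : R) : (0 < c)%R -> (forall x, 0 <= f x) ->
  \int[mu]_x (c%:E * f x) = c%:E * \int[mu]_x f x.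
Proof.
move=> c0 f0; apply/eqP; rewrite eq_le ge0_integral_scale_le// andbT.
have ci0 : (0 < c^-1)%R by rewrite invr_gt0.
have cf0 x : 0 <= c%:E * f x by rewrite mule_ge0// lee_fin ltW.
have := ge0_integral_scale_le ci0 cf0; rewrite lee_pdivrMl//.
by under [X in _ <= _ * X]eq_integral do rewrite muleA -EFinM mulVf ?gt_eqF// mul1e.
Qed.

(** The integral of a nonnegative function is the supremum of the integrals of
    the simple functions below it, and multiplication by c permutes the simple
    functions. *)
Lemma integral_scale (f : T -> \bar R) (c : R) : (0 < c)%R ->
  \int[mu]_x (c%:E * f x) = c%:E * \int[mu]_x f x.
Proof.
move=> c0; rewrite integralE [in RHS]integralE.
rewrite (_ : (fun x => c%:E * f x)^\+ = (fun x => c%:E * f^\+ x)); last first.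
  by apply: ge0_funeposM; exact: ltW.
rewrite (_ : (fun x => c%:E * f x)^\- = (fun x => c%:E * f^\- x)); last first.
  by apply: ge0_funenegM; exact: ltW.
rewrite !ge0_integral_scale//.
have cE : 0 < c%:E by rewrite lte_fin.
have A0 : 0 <= \int[mu]_x f^\+ x by exact: integral_ge0.
have B0 : 0 <= \int[mu]_x f^\- x by exact: integral_ge0.
move: (\int[mu]_x f^\+ x) (\int[mu]_x f^\- x) A0 B0 => [a| |] [b| |] //= _ _.
- by rewrite -!EFinM -!EFinB mulrBr.
- by rewrite gt0_muley//= gt0_muleNy.
- by rewrite gt0_muley//=.
- by rewrite !gt0_muley//= gt0_muleNy.
Qed.

End IntegralScaling.

(** * Evolution of the mass *)

Section MassEvolution.
Variables (R : realType) (d : nat) (M : manifold [set: 'rV[R]_(1 + d)]).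
Variables (Mt : manifold (@halfspace R d)) (N : manifold [set: 'rV[R]_d]).
Variables (psi : Mt -> M) (psi' : M -> Mt) (X : collar Mt N) (k : bool).
Variables (h : tensor2 N) (T : \bar R) (g : R -> tensor2 M).
Hypothesis T_gt0 : (0 < T)%E.
Hypothesis diffeo : interior_diffeo psi psi'.
Hypothesis h_metric : riemannian_metric h.
Hypothesis h_ricci : forall (c : chart R d N) y, atlas c -> cimg c y ->
  ricci (h c) y = ((1 + d)%:R - 2) * k%:R *: h c y.
Hypothesis g_metric : forall t, times T t -> riemannian_metric (g t).
Hypothesis g_flow : normalized_ricci_flow T g.
Hypothesis g_smooth : smooth_up_to_collar psi psi' k X T g.
Variable kappa0 : tensor2 N.
Hypothesis g0_form : mass_form psi psi' k h X (g 0) kappa0.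
Local Notation n := (1 + d)%N.

Let T0 : times T 0. Proof. by split. Qed.

Lemma collar_change_refl : collar_change X X.
Proof.
have HK (c : chart R d N) (K : set 'rV[R]_d) y : atlas c -> K `<=` cimg c -> K y ->
    cdom c (cinv c y) /\ cmap c (cinv c y) = y.
  by move=> ac Kc Ky; exact: (cimg_cdom ac (Kc y Ky)).
split=> c K' ac _ Kc.
  exists (width X); split; first exact: width_gt0.
  by move=> x y x0 xw Ky; exact: cdom_collar (ltW x0) xw (HK c K' y ac Kc Ky).1.
exists 0, (width X); split; first exact: width_gt0.
move=> x y i j x0 xw Ky; rewrite (cmap_collar c _ (ltW x0) xw) (HK c K' y ac Kc Ky).2.
by rewrite subrr mxE normr0 mul0r.
Qed.

Lemma initial_coefficient_vanishes p (kappa : chart R d N -> 'rV[R]_d -> 'M[R]_n) :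
  (0 < p < n)%N -> has_expansion psi psi' k h X (g 0) p kappa ->
  forall c y, atlas c -> cimg c y -> kappa c y = 0.
Proof.
move=> /andP[p0 pn] Hk c y ac cy; apply/matrixP => i j; rewrite [RHS]mxE.
have H1 := pointwise_expansion i j Hk ac cy.
have H2 := mass_form_expansion g0_form i j ac cy.
have H3 := bigO0Ml ((block_mx 0 0 0 (kappa0 c y) : 'M[R]_(1 + d)) i j) (bigO0_eps R n).
have pR : p%:R != 0 :> R by rewrite pnatr_eq0 -lt0n.
have : kappa c y i j / p%:R = 0.
  apply: (@bigO0_coef0 _ p).
  have H := bigO0B (bigO0D (bigO0W (leq_trans pn (leqnSn n)) H2) (bigO0W pn H3)) H1.
  by apply: bigO0_ext H => x; ring.
by move/eqP; rewrite mulf_eq0 invr_eq0 (negbTE pR) orbF => /eqP.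
Qed.

(** By induction on the order: the coefficient of x^p vanishes at t = 0
    because g 0 has an expansion of order n, hence at all times, so that the
    expansion starts at the next order. *)
Lemma expansions_improve q : (0 < q)%N ->
  (forall t, times T t -> exists kappa, has_expansion psi psi' k h X (g t) q kappa) ->
  forall p, (q <= p <= n)%N ->
  forall t, times T t -> exists kappa, has_expansion psi psi' k h X (g t) p kappa.
Proof.
move=> q0 Hq; elim=> [|p IH] /andP[qp pn].
  by rewrite leqNgt q0 in qp.
move: qp; rewrite leq_eqVlt => /predU1P[<- //|qp].
rewrite ltnS in qp; have p0 : (0 < p)%N := leq_trans q0 qp.
have {}IH := IH (introT andP (conj qp (ltnW pn))).
have [kappa Hk] : exists kappa : R -> chart R d N -> 'rV[R]_d -> 'M[R]_n,
    forall t, times T t -> has_expansion psi psi' k h X (g t) p (kappa t).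
  have H t : exists ka, times T t -> has_expansion psi psi' k h X (g t) p ka.
    have [/IH[ka Ha]|nT] := pselect (times T t); first by exists ka.
    by exists (fun _ _ => 0) => /nT.
  by have [kappa Hk] := choice H; exists kappa.
move=> t Tt; eexists.
apply: (next_expansion g_smooth Tt (Hk t Tt)) => c y ac cy.
apply: (kappa_vanishes T_gt0 diffeo h_metric h_ricci g_metric g_flow g_smooth p0 Hk ac cy) => //.
by apply: (initial_coefficient_vanishes _ (Hk 0 T0)) => //; rewrite p0.
Qed.

(** Both densities are aspects of the coefficient of x^n, at the times t and
    0. At t = 0 the coordinates are already normalized, which is the case of
    the trivial change of collar. *)
Lemma mass_form_evolution t (X' : collar Mt N) (kappa' : tensor2 N) :
  times T t ->
  (forall s, times T s -> exists kappa, has_expansion psi psi' k h X (g s) n kappa) ->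
  collar_change X X' -> mass_form psi psi' k h X' (g t) kappa' ->
  forall y, trace_wrt h kappa' y = expR (- (d%:R - 1) * t) * trace_wrt h kappa0 y.
Proof.
move=> Tt Hex change form y.
have [kappa Hk] : exists kappa : R -> chart R d N -> 'rV[R]_d -> 'M[R]_n,
    forall t, times T t -> has_expansion psi psi' k h X (g t) n (kappa t).
  have H s : exists ka, times T s -> has_expansion psi psi' k h X (g s) n ka.
    have [/Hex[ka Ha]|nT] := pselect (times T s); first by exists ka.
    by exists (fun _ _ => 0) => /nT.
  by have [kappa Hk] := choice H; exists kappa.
rewrite /trace_wrt; have [ac dc] := chart_atP y; set c := chart_at y in ac dc *.
have cy : cimg c (cmap c y) by exists y.
rewrite (mass_aspect_of_change diffeo h_metric (g_metric Tt) g_smooth Tt (Hk t Tt) change form ac cy).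
rewrite (mass_aspect_of_change diffeo h_metric (g_metric T0) g_smooth T0 (Hk 0 T0)
   collar_change_refl g0_form ac cy).
have := aspect_evolution T_gt0 diffeo h_metric h_ricci g_metric g_flow g_smooth
  (isT : (0 < n)%N) Hk ac cy Tt.
rewrite (_ : - 2 * _ * _ + _ = - (d%:R - 1) :> R); last by rewrite natrD; ring.
by move=> /= ->; rewrite mulrA.
Qed.

End MassEvolution.

Lemma mass_integralZ (R : realType) (d : nat) (N : manifold [set: 'rV[R]_d])
    (h : tensor2 N) (mu : {measure set (borel N) -> \bar R}) (kappa kappa' : tensor2 N) (a : R) :
  0 < a -> (forall y, trace_wrt h kappa' y = a * trace_wrt h kappa y) ->
  mass_integral h mu kappa' = a * mass_integral h mu kappa.
Proof.
move=> a0 E; rewrite /mass_integral /Rintegral.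
rewrite (_ : (fun y => (trace_wrt h kappa' y)%:E) = (fun y => a%:E * (trace_wrt h kappa y)%:E)%E).
  rewrite integral_scale//; case: (integral _ _ _) => [r| |] //=.
    by rewrite gt0_muley ?lte_fin// mulr0.
  by rewrite gt0_muleNy ?lte_fin// mulr0.
by apply/funext => y; rewrite E EFinM.
Qed.

Theorem corollary1p2 (R : realType) (d : nat) (hn : (3 <= 1 + d)%N)
    (M : manifold [set: 'rV[R]_(1 + d)])
    (Mt : manifold (@halfspace R d))
    (N : manifold [set: 'rV[R]_d])
    (psi : Mt -> M) (psi' : M -> Mt)
    (X : collar Mt N)
    (k : bool) (h : tensor2 N)
    (h_metric : riemannian_metric h)
    (h_curvature : forall (c : chart R d N) y, atlas c -> cimg c y ->
       constant_sectional (h c) y k%:R /\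
       ricci (h c) y = ((1 + d)%:R - 2) * k%:R *: h c y)
    (mu : {measure set (borel N) -> \bar R})
    (mu_volume : volume_measure h mu)
    (T : \bar R) (T_gt0 : (0 < T)%E)
    (g : R -> tensor2 M)
    (g_AH : forall t, times T t ->
       asymptotically_hyperbolic psi psi' k (g t))
    (g_flow : normalized_ricci_flow T g)
    (kappa0 : tensor2 N) (m0 : R)
    (g0_form : mass_form psi psi' k h X (g 0) kappa0)
    (m0_mass : m0 = mass_integral h mu kappa0)
    (q : nat) (q_ge1 : (1 <= q)%N) (q_le : (q <= 1 + d)%N)
    (g_expansion : forall t, times T t ->
       exists kappa, has_expansion psi psi' k h X (g t) q kappa)
    (g_smooth : smooth_up_to_collar psi psi' k X T g)
    (m : R -> R)
    (m_mass : forall t, times T t ->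
       (exists kappa, has_expansion psi psi' k h X (g t) (1 + d) kappa) ->
       is_mass psi psi' k h mu X (g t) (m t)) :
  (exists t1 t2 : R,
     [/\ 0 <= t1, t1 < t2, (t2%:E < T)%E & m t1 = m t2])
  <->
  (forall t, times T t -> m t = m0 /\ m0 = 0).
Proof.
have T0 : times T 0 by split.
have [_ _ [rho [gt [[diffeo _ _ _ _] _ _]]]] := g_AH 0 T0.
have g_metric t (Tt : times T t) : riemannian_metric (g t) by have [] := g_AH t Tt.
have h_ricci (c : chart R d N) y (ac : atlas c) (cy : cimg c y) := (h_curvature c y ac cy).2.
have Hex := expansions_improve T_gt0 diffeo h_metric h_ricci g_metric g_flow g_smooth g0_form
  q_ge1 g_expansion (introT andP (conj q_le (leqnn (1 + d)))).
have evolution t : times T t -> m t = expR (- (d%:R - 1) * t) * m0.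
  move=> Tt; have [X' [kappa' [change form ->]]] := m_mass t Tt (Hex t Tt).
  rewrite m0_mass; apply: mass_integralZ; first exact: expR_gt0.
  exact: (mass_form_evolution T_gt0 diffeo h_metric h_ricci g_metric g_flow g_smooth g0_form Tt
    Hex change form).
have d1 : 0 < d%:R - 1 :> R by rewrite subr_gt0 ltr1n.
split=> [[t1 [t2 [t10 t12 t2T mE]]]|H].
  have Tt2 : times T t2 by split=> //; rewrite (le_trans t10)// ltW.
  have Tt1 : times T t1 by split=> //; rewrite (lt_trans _ t2T)// lte_fin.
  have m00 : m0 = 0.
    apply/eqP; have := mE; rewrite !evolution// => /eqP.
    rewrite -subr_eq0 -mulrBl mulf_eq0 subr_eq0 => /orP[/eqP/expR_inj E|//].
    have := mulfI _ E; rewrite oppr_eq0 gt_eqF// => /(_ isT) t12E.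
    by rewrite t12E ltxx in t12.
  by move=> t Tt; rewrite evolution// m00 mulr0.
have [t2 t20 t2T] : exists2 t2 : R, 0 < t2 & (t2%:E < T)%E.
  case: (T) T_gt0 => [r| |] // r0; last by exists 1; rewrite ?ltry.
  by exists (r / 2); rewrite ?lte_fin; move: r0; rewrite lte_fin; lra.
exists 0, t2; split=> //.
have [m_0 m00] := H 0 T0; have [m_2 _] := H t2 (conj (ltW t20) t2T).
by rewrite m_0 m_2.
Qed.
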